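(* Let $f\in\mathfrak m$, let $\Phi:\mathcal M_n\to\mathcal M_r$ be a unital positive linear map, and let $A\in\mathcal M_n$ be accretive with $W(A)\subset S_\alpha$ for some $0\le\alpha<\pi/2$. Then $$\Re f(\Phi(A))\ge\cos^2(\alpha)\,\Re\,\Phi(f(A)).$$
   Context: A matrix $A$ is accretive if $\Re A=\frac{A+A^*}{2}$ is positive definite. $W(A)$ is the numerical range, $S_\alpha=\{z:\Re z>0,\ |\Im z|\le\tan(\alpha)\Re z\}$. $\le$ is the Löwner order. A linear map $\Phi$ is positive if it preserves positive semidefiniteness and unital if $\Phi(\mathcal I)=\mathcal I$. $\mathfrak m$ is the set of matrix monotone $f:(0,\infty)\to(0,\infty)$ with $f(1)=1$; each extends analytically to $\mathbb C\setminus(-\infty,0]$, and for $X$ with spectrum in $D=\mathbb C\setminus(-\infty,0]$, $f(X)=\frac1{2\pi i}\int_\Gamma f(z)(z\mathcal I-X)^{-1}dz$ with $\Gamma\subset D$ a simple closed curve winding once around each eigenvalue of $X$. *)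

(* Defs.v *)
From Stdlib Require Import Reals.
Open Scope R_scope.

Record Cx := mkCx { re : R; im : R }.

Definition RtoC (x : R) : Cx := mkCx x 0.
Definition C0 : Cx := RtoC 0.
Definition C1 : Cx := RtoC 1.
Definition Cadd (z w : Cx) : Cx := mkCx (re z + re w) (im z + im w).
Definition Copp (z : Cx) : Cx := mkCx (- re z) (- im z).
Definition Csub (z w : Cx) : Cx := Cadd z (Copp w).
Definition Cmul (z w : Cx) : Cx :=
  mkCx (re z * re w - im z * im w) (re z * im w + im z * re w).
Definition Cconj (z : Cx) : Cx := mkCx (re z) (- im z).
Definition Cnorm2 (z : Cx) : R := re z * re z + im z * im z.
Definition Cmod (z : Cx) : R := sqrt (Cnorm2 z).
Definition Cinv (z : Cx) : Cx := mkCx (re z / Cnorm2 z) (- im z / Cnorm2 z).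

Definition in_D (z : Cx) : Prop := ~ (im z = 0 /\ re z <= 0).

Fixpoint csum (k : nat) (g : nat -> Cx) : Cx :=
  match k with
  | O => C0
  | S k' => Cadd (csum k' g) (g k')
  end.

(** * Matrices: an n x n matrix is a function on indices; only indices < n matter *)
Definition Mat := nat -> nat -> Cx.
Definition meq (n : nat) (A B : Mat) : Prop :=
  forall i j, (i < n)%nat -> (j < n)%nat -> A i j = B i j.
Definition mid : Mat := fun i j => if Nat.eqb i j then C1 else C0.
Definition madd (A B : Mat) : Mat := fun i j => Cadd (A i j) (B i j).
Definition msub (A B : Mat) : Mat := fun i j => Csub (A i j) (B i j).
Definition mscale (c : Cx) (A : Mat) : Mat := fun i j => Cmul c (A i j).
Definition madj (A : Mat) : Mat := fun i j => Cconj (A j i).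
Definition mmul (n : nat) (A B : Mat) : Mat :=
  fun i j => csum n (fun k => Cmul (A i k) (B k j)).
Definition ReM (A : Mat) : Mat := mscale (RtoC (1/2)) (madd A (madj A)).

Definition quad (n : nat) (A : Mat) (x : nat -> Cx) : Cx :=
  csum n (fun i => Cmul (Cconj (x i)) (csum n (fun j => Cmul (A i j) (x j)))).
Definition nonzero_vec (n : nat) (x : nat -> Cx) : Prop :=
  exists i, (i < n)%nat /\ x i <> C0.
Definition vnorm2 (n : nat) (x : nat -> Cx) : R := re (csum n (fun i => RtoC (Cnorm2 (x i)))).

Definition hermitian (n : nat) (A : Mat) : Prop := meq n A (madj A).
Definition psd (n : nat) (A : Mat) : Prop :=
  hermitian n A /\ forall x, 0 <= re (quad n A x).
Definition pd (n : nat) (A : Mat) : Prop :=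
  hermitian n A /\ forall x, nonzero_vec n x -> 0 < re (quad n A x).
Definition loewner_le (n : nat) (A B : Mat) : Prop := psd n (msub B A).

Definition accretive (n : nat) (A : Mat) : Prop := pd n (ReM A).

Definition numrange (n : nat) (A : Mat) (z : Cx) : Prop :=
  exists x, vnorm2 n x = 1 /\ quad n A x = z.
Definition sector (alpha : R) (z : Cx) : Prop :=
  0 < re z /\ Rabs (im z) <= tan alpha * re z.

Definition unital_positive_linear (n r : nat) (Phi : Mat -> Mat) : Prop :=
  (forall A B, meq n A B -> meq r (Phi A) (Phi B)) /\
  (forall c A B, meq r (Phi (madd (mscale c A) B)) (madd (mscale c (Phi A)) (Phi B))) /\
  (forall A, psd n A -> psd r (Phi A)) /\
  meq r (Phi mid) mid.

Definition unitary (n : nat) (U : Mat) : Prop := meq n (mmul n (madj U) U) mid.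
Definition rdiag (d : nat -> R) : Mat :=
  fun i j => if Nat.eqb i j then RtoC (d i) else C0.
Definition herm_fcalc (f : R -> R) (n : nat) (A B : Mat) : Prop :=
  exists (U : Mat) (d : nat -> R), unitary n U /\
    meq n A (mmul n (mmul n U (rdiag d)) (madj U)) /\
    meq n B (mmul n (mmul n U (rdiag (fun i => f (d i)))) (madj U)).

Definition matrix_monotone_class (f : R -> R) : Prop :=
  (forall x, 0 < x -> 0 < f x) /\ f 1 = 1 /\
  forall (n : nat) (A B FA FB : Mat), pd n A -> pd n B -> loewner_le n A B ->
    herm_fcalc f n A FA -> herm_fcalc f n B FB -> loewner_le n FA FB.

Definition holomorphic_on_D (F : Cx -> Cx) : Prop :=
  forall z, in_D z -> exists d : Cx, forall eps, 0 < eps -> exists delta, 0 < delta /\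
    forall h, Cmod h < delta ->
      Cmod (Csub (Csub (F (Cadd z h)) (F z)) (Cmul d h)) <= eps * Cmod h.
Definition analytic_extension (f : R -> R) (F : Cx -> Cx) : Prop :=
  holomorphic_on_D F /\ forall x, 0 < x -> F (RtoC x) = RtoC (f x).

Definition RI01 (g : R -> Cx) (v : Cx) : Prop :=
  forall eps, 0 < eps -> exists delta, 0 < delta /\
    forall (k : nat) (x xi : nat -> R), x O = 0 -> x k = 1 ->
      (forall i, (i < k)%nat ->
         x i < x (S i) /\ x (S i) - x i < delta /\ x i <= xi i <= x (S i)) ->
      Cmod (Csub (csum k (fun i => Cmul (g (xi i)) (RtoC (x (S i) - x i)))) v) < eps.

Definition eigenvalue (n : nat) (X : Mat) (l : Cx) : Prop :=
  exists v, nonzero_vec n v /\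
    forall i, (i < n)%nat -> csum n (fun j => Cmul (X i j) (v j)) = Cmul l (v i).

Definition two_pi_i : Cx := mkCx 0 (2 * PI).

(** gamma : a C^1, 1-periodic parametrization (derivative gamma') of a simple
    closed curve in D that winds once around each eigenvalue of X *)
Definition admissible_contour (n : nat) (X : Mat) (gamma gamma' : R -> Cx) : Prop :=
  (forall t, gamma (t + 1) = gamma t) /\
  (forall t, derivable_pt_lim (fun s => re (gamma s)) t (re (gamma' t))) /\
  (forall t, derivable_pt_lim (fun s => im (gamma s)) t (im (gamma' t))) /\
  (forall t, continuity_pt (fun s => re (gamma' s)) t) /\
  (forall t, continuity_pt (fun s => im (gamma' s)) t) /\
  (forall s t, 0 <= s < 1 -> 0 <= t < 1 -> gamma s = gamma t -> s = t) /\
  (forall t, in_D (gamma t)) /\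
  (forall l, eigenvalue n X l ->
     (forall t, gamma t <> l) /\
     RI01 (fun t => Cmul (gamma' t) (Cinv (Csub (gamma t) l))) two_pi_i).

(** Y = f(X) = (1/2 pi i) \int_Gamma F(z) (zI - X)^{-1} dz *)
Definition hol_fcalc (F : Cx -> Cx) (n : nat) (X Y : Mat) : Prop :=
  exists (gamma gamma' : R -> Cx) (Rs : R -> Mat),
    admissible_contour n X gamma gamma' /\
    (forall t, meq n (mmul n (msub (mscale (gamma t) mid) X) (Rs t)) mid) /\
    forall i j, (i < n)%nat -> (j < n)%nat ->
      RI01 (fun t => Cmul (Cmul (F (gamma t)) (Rs t i j)) (gamma' t))
           (Cmul two_pi_i (Y i j)).

(* Main.v *)
(* The functions k_t(z) = (1+t)z/(z+t), t > 0, generate the class: matrix monotonicity makes the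
   divided differences of f p^2 on 2N points nonnegative, hence (writing a polynomial that is
   nonnegative on the half-line as a sum of terms c X^b r^2) f lies in every half-space that
   contains all the k_t, so f is a limit of convex combinations g of the k_t on compact intervals.
   A quantitative identity theorem on the slit plane (in logarithmic coordinates) turns this into
   uniform approximation of F along the contours, so it is enough to treat f = k_t.  There
   k_t(X) = (1+t)(1 - t(X+t)^-1), and the inequality is the chain
     Re k_t(Phi A) >= k_t(Phi(Re A)) >= Phi(k_t(Re A)) >= cos^2(alpha) Re Phi(k_t(A)),
   where the middle step uses the spectral decomposition of Re A. *)

(* The contour and the analytic extension are arbitrary, while monotonicity speaks only of real
   points and finite matrices, so no integral representation of f is at hand. What replaces it is
   that convex combinations of the k_t are bounded on each compact part of the slit plane
   independently of their weights and nodes. For a given strip and error, a real interval and a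
   tolerance can therefore be fixed before the combination is chosen, and smallness then travels
   from the interval to both contours at once by a two-constants estimate. The point 1, where f and
   every k_t equal 1, turns the affine half-space condition into a homogeneous inequality, which is
   a statement about a polynomial nonnegative on the half-line.

   Inside the slit plane, only the winding of the contour around eigenvalues is known.
   Cayley-Hamilton makes the resolvent a rational function with no other poles, and this is enough
   to integrate k_t against it.

   The constant comes from A^* H^{-1} A <= (1 + tan^2(alpha)) H with H = Re A, and from cos^2(alpha)
   (1 + tan^2(alpha)) = 1. *)
From Stdlib Require Import Reals Lra Lia List Classical ClassicalEpsilon.
Require Import Defs.

(** * Complex arithmetic, modulus and finite sums *)

Module ComplexNumbers.
Local Open Scope R_scope.

Lemma Cx_ext (z w : Cx) : re z = re w -> im z = im w -> z = w.
Proof. destruct z, w; simpl; intros; subst; reflexivity. Qed.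

Ltac cx := apply Cx_ext; simpl; try ring.

Lemma Cx_ring_theory : ring_theory C0 C1 Cadd Cmul Csub Copp (@eq Cx).
Proof. constructor; intros; try reflexivity; cx. Qed.

Lemma Cnorm2_pos (z : Cx) : z <> C0 -> 0 < Cnorm2 z.
Proof.
intros nz; unfold Cnorm2.
destruct (Req_dec (re z) 0) as [e|e]; [destruct (Req_dec (im z) 0) as [e'|e']|].
- exfalso; apply nz; apply Cx_ext; simpl; assumption.
- nra.
- nra.
Qed.

Lemma Cinv_l (z : Cx) : z <> C0 -> Cmul (Cinv z) z = C1.
Proof.
intros nz; pose proof (Cnorm2_pos z nz) as h; apply Cx_ext; unfold Cinv; simpl; unfold Cnorm2 in *; field; lra.
Qed.

Lemma C1_neq_C0 : C1 <> C0.
Proof. intros e; apply (f_equal re) in e; simpl in e; lra. Qed.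

Lemma Cx_field_theory :
  field_theory C0 C1 Cadd Cmul Csub Copp (fun z w => Cmul z (Cinv w)) Cinv (@eq Cx).
Proof.
constructor.
- exact Cx_ring_theory.
- exact C1_neq_C0.
- reflexivity.
- exact Cinv_l.
Qed.

Add Field Cx_field : Cx_field_theory.

Lemma Cmul_integral (z w : Cx) : Cmul z w = C0 -> z = C0 \/ w = C0.
Proof.
intros e; destruct (Req_dec (Cnorm2 z) 0) as [h|h].
- left; unfold Cnorm2 in h; apply Cx_ext; simpl; nra.
- right; assert (nz : z <> C0) by (intros ->; apply h; unfold Cnorm2; simpl; ring).
  transitivity (Cmul (Cinv z) (Cmul z w)); [field; assumption|rewrite e; ring].
Qed.

Lemma Csub_neq0 (z w : Cx) : z <> w -> Csub z w <> C0.
Proof.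
intros h e; apply h; transitivity (Cadd (Csub z w) w); [ring|rewrite e; ring].
Qed.

Lemma RtoC_add x y : RtoC (x + y) = Cadd (RtoC x) (RtoC y). Proof. cx. Qed.
Lemma RtoC_sub x y : RtoC (x - y) = Csub (RtoC x) (RtoC y). Proof. cx. Qed.
Lemma RtoC_mul x y : RtoC (x * y) = Cmul (RtoC x) (RtoC y). Proof. cx. Qed.
Lemma RtoC_inv x : x <> 0 -> RtoC (/ x) = Cinv (RtoC x).
Proof. intros; apply Cx_ext; unfold Cinv, Cnorm2; simpl; field; auto. Qed.

Lemma re_add z w : re (Cadd z w) = re z + re w. Proof. reflexivity. Qed.
Lemma re_sub z w : re (Csub z w) = re z - re w. Proof. reflexivity. Qed.
Lemma re_RtoC_mul x z : re (Cmul (RtoC x) z) = x * re z. Proof. simpl; ring. Qed.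

Lemma Cnorm2_nonneg z : 0 <= Cnorm2 z. Proof. unfold Cnorm2; nra. Qed.
Lemma Cnorm2_mul z w : Cnorm2 (Cmul z w) = Cnorm2 z * Cnorm2 w.
Proof. unfold Cnorm2; simpl; ring. Qed.

Lemma Cmod_nonneg z : 0 <= Cmod z. Proof. apply sqrt_pos. Qed.
Lemma Cmod_sqr z : Cmod z * Cmod z = Cnorm2 z.
Proof. apply sqrt_sqrt, Cnorm2_nonneg. Qed.
Lemma Cmod_mul z w : Cmod (Cmul z w) = Cmod z * Cmod w.
Proof. unfold Cmod; rewrite Cnorm2_mul; apply sqrt_mult; apply Cnorm2_nonneg. Qed.
Lemma Cmod_0 : Cmod C0 = 0.
Proof. unfold Cmod, Cnorm2; simpl; rewrite Rmult_0_l, Rplus_0_l; apply sqrt_0. Qed.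
Lemma Cmod_1 : Cmod C1 = 1.
Proof. unfold Cmod, Cnorm2; simpl; replace (1 * 1 + 0 * 0) with 1 by ring; apply sqrt_1. Qed.
Lemma Cmod_RtoC x : Cmod (RtoC x) = Rabs x.
Proof. unfold Cmod, Cnorm2; simpl; rewrite <- sqrt_Rsqr_abs; f_equal; unfold Rsqr; ring. Qed.
Lemma Cmod_opp z : Cmod (Copp z) = Cmod z.
Proof. unfold Cmod, Cnorm2; simpl; f_equal; ring. Qed.
Lemma Cmod_conj z : Cmod (Cconj z) = Cmod z.
Proof. unfold Cmod, Cnorm2; simpl; f_equal; ring. Qed.
Lemma Cmod_pos z : z <> C0 -> 0 < Cmod z.
Proof. intros; apply sqrt_lt_R0, Cnorm2_pos; assumption. Qed.
Lemma Cmod_eq0 z : Cmod z = 0 -> z = C0.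
Proof.
intros h; pose proof (Cmod_sqr z) as e; rewrite h in e; unfold Cnorm2 in e.
apply Cx_ext; simpl; nra.
Qed.
Lemma Cmod_inv z : z <> C0 -> Cmod (Cinv z) = / Cmod z.
Proof.
intros nz; pose proof (Cmod_pos z nz) as p.
apply Rmult_eq_reg_r with (Cmod z); [|lra].
rewrite <- Cmod_mul, Cinv_l, Cmod_1 by assumption; field; lra.
Qed.

Lemma Cmod_le_sqr z b : 0 <= b -> Cnorm2 z <= b * b -> Cmod z <= b.
Proof.
intros hb h; pose proof (Cmod_nonneg z); pose proof (Cmod_sqr z); nra.
Qed.

Lemma Rabs_re_le z : Rabs (re z) <= Cmod z.
Proof.
pose proof (Cmod_nonneg z); pose proof (Cmod_sqr z); unfold Cnorm2 in *.
apply Rabs_le; split; nra.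
Qed.

Lemma Rabs_im_le z : Rabs (im z) <= Cmod z.
Proof.
pose proof (Cmod_nonneg z); pose proof (Cmod_sqr z); unfold Cnorm2 in *.
apply Rabs_le; split; nra.
Qed.

Lemma Cmod_le_re_im z : Cmod z <= Rabs (re z) + Rabs (im z).
Proof.
apply Cmod_le_sqr; [pose proof (Rabs_pos (re z)); pose proof (Rabs_pos (im z)); lra|].
unfold Cnorm2; pose proof (Rabs_pos (re z)); pose proof (Rabs_pos (im z)).
rewrite <- (Rabs_right (re z * re z)) by nra; rewrite <- (Rabs_right (im z * im z)) by nra.
rewrite !Rabs_mult; nra.
Qed.

Lemma Cmod_triangle z w : Cmod (Cadd z w) <= Cmod z + Cmod w.
Proof.
pose proof (Cmod_nonneg z); pose proof (Cmod_nonneg w).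
pose proof (Cmod_sqr z) as hz; pose proof (Cmod_sqr w) as hw.
apply Cmod_le_sqr; [lra|].
(* Cauchy-Schwarz, read off from the real part of z times the conjugate of w. *)
assert (h : re z * re w + im z * im w <= Cmod z * Cmod w).
{ assert (k : re (Cmul z (Cconj w)) <= Cmod (Cmul z (Cconj w))).
  { eapply Rle_trans; [apply Rle_abs|apply Rabs_re_le]. }
  rewrite Cmod_mul, Cmod_conj in k; simpl in k; lra. }
unfold Cnorm2 in *; simpl; nra.
Qed.

Lemma Cmod_sub_triangle z w : Cmod (Csub z w) <= Cmod z + Cmod w.
Proof. unfold Csub; eapply Rle_trans; [apply Cmod_triangle|rewrite Cmod_opp; lra]. Qed.

Lemma csum_ext k g h : (forall i, (i < k)%nat -> g i = h i) -> csum k g = csum k h.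
Proof.
induction k as [|k IH]; intros H; [reflexivity|simpl].
rewrite IH by (intros; apply H; lia); rewrite H by lia; reflexivity.
Qed.
Lemma csum_add k g h : csum k (fun i => Cadd (g i) (h i)) = Cadd (csum k g) (csum k h).
Proof. induction k; simpl; [ring|rewrite IHk; ring]. Qed.
Lemma csum_sub k g h : csum k (fun i => Csub (g i) (h i)) = Csub (csum k g) (csum k h).
Proof. induction k; simpl; [ring|rewrite IHk; ring]. Qed.
Lemma csum_mul_l k c g : csum k (fun i => Cmul c (g i)) = Cmul c (csum k g).
Proof. induction k; simpl; [ring|rewrite IHk; ring]. Qed.
Lemma csum_mul_r k c g : csum k (fun i => Cmul (g i) c) = Cmul (csum k g) c.
Proof. induction k; simpl; [ring|rewrite IHk; ring]. Qed.
Lemma csum_conj k g : csum k (fun i => Cconj (g i)) = Cconj (csum k g).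
Proof. induction k; simpl; [cx|rewrite IHk; cx]. Qed.
Lemma csum_0 k : csum k (fun _ => C0) = C0.
Proof. induction k; simpl; [reflexivity|rewrite IHk; ring]. Qed.
Lemma csum_swap k l (g : nat -> nat -> Cx) :
  csum k (fun i => csum l (fun j => g i j)) = csum l (fun j => csum k (fun i => g i j)).
Proof.
induction k; simpl; [rewrite csum_0; reflexivity|].
rewrite IHk, <- csum_add; reflexivity.
Qed.
Lemma csum_delta k (g : nat -> Cx) i : (i < k)%nat ->
  csum k (fun j => Cmul (mid i j) (g j)) = g i.
Proof.
induction k; intros h; [lia|simpl].
destruct (Nat.eq_dec i k) as [->|ne].
- replace (csum k _) with C0; [unfold mid; rewrite Nat.eqb_refl; ring|].
  rewrite <- (csum_0 k); apply csum_ext; intros j hj; unfold mid.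
  rewrite (proj2 (Nat.eqb_neq k j)) by lia; ring.
- rewrite IHk by lia; unfold mid; rewrite (proj2 (Nat.eqb_neq i k)) by lia; ring.
Qed.
Lemma csum_mod k g : Cmod (csum k g) <= re (csum k (fun i => RtoC (Cmod (g i)))).
Proof.
induction k; simpl; [rewrite Cmod_0; lra|].
eapply Rle_trans; [apply Cmod_triangle|simpl in *; lra].
Qed.
Lemma re_csum_le k g h : (forall i, (i < k)%nat -> re (g i) <= re (h i)) ->
  re (csum k g) <= re (csum k h).
Proof.
induction k; intros H; simpl; [lra|].
apply Rplus_le_compat; [apply IHk; intros; apply H; lia|apply H; lia].
Qed.

End ComplexNumbers.

(** * Complex differentiability *)

Module IdentityTheorem.
From Coquelicot Require Import Rcomplements Hierarchy Continuity Derive RInt RInt_analysis ElemFct AutoDerive.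
Import ComplexNumbers.
Local Open Scope R_scope.

(** The pointwise form of [holomorphic_on_D], so that a hypothesis of holomorphy applies without
    conversion. Nothing is assumed about the derivative as a function, not even continuity, so
    Cauchy's theorem has to come from Goursat's argument. *)
Definition Cdiff (q : Cx -> Cx) (z : Cx) : Prop :=
  exists d, forall eps, 0 < eps -> exists delta, 0 < delta /\
    forall h, Cmod h < delta -> Cmod (Csub (Csub (q (Cadd z h)) (q z)) (Cmul d h)) <= eps * Cmod h.

Definition Ccont (q : Cx -> Cx) (z : Cx) : Prop :=
  forall eps, 0 < eps -> exists delta, 0 < delta /\
    forall w, Cmod (Csub w z) < delta -> Cmod (Csub (q w) (q z)) < eps.

Lemma Cdiff_local_Lipschitz q z : Cdiff q z -> exists L delta, 0 < L /\ 0 < delta /\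
  forall h, Cmod h < delta -> Cmod (Csub (q (Cadd z h)) (q z)) <= L * Cmod h.
Proof.
intros [d H]; destruct (H 1 Rlt_0_1) as [delta [dp Hd]].
exists (1 + Cmod d), delta; pose proof (Cmod_nonneg d); repeat split; try lra.
intros h hh; specialize (Hd h hh).
replace (Csub (q (Cadd z h)) (q z)) with
  (Cadd (Csub (Csub (q (Cadd z h)) (q z)) (Cmul d h)) (Cmul d h)) by ring.
eapply Rle_trans; [apply Cmod_triangle|rewrite Cmod_mul; lra].
Qed.

Lemma Cdiff_cont q z : Cdiff q z -> Ccont q z.
Proof.
intros H eps he; destruct (Cdiff_local_Lipschitz q z H) as (L & delta & Lp & dp & HL).
exists (Rmin delta (eps / L)); split.
{ apply Rmin_pos; [assumption|apply Rdiv_lt_0_compat; assumption]. }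
intros w hw; replace w with (Cadd z (Csub w z)) at 1 by ring.
eapply Rle_lt_trans; [apply HL; eapply Rlt_le_trans; [exact hw|apply Rmin_l]|].
assert (h : Cmod (Csub w z) < eps / L) by (eapply Rlt_le_trans; [exact hw|apply Rmin_r]).
apply Rmult_lt_compat_l with (r := L) in h; [|assumption].
replace (L * (eps / L)) with eps in h by (field; lra); exact h.
Qed.

Lemma Cdiff_const c z : Cdiff (fun _ => c) z.
Proof.
exists C0; intros eps he; exists 1; split; [lra|intros h _].
replace (Csub (Csub c c) (Cmul C0 h)) with C0 by ring.
rewrite Cmod_0; pose proof (Cmod_nonneg h); nra.
Qed.

Lemma Cdiff_id z : Cdiff (fun w => w) z.
Proof.
exists C1; intros eps he; exists 1; split; [lra|intros h _].
replace (Csub (Csub (Cadd z h) z) (Cmul C1 h)) with C0 by ring.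
rewrite Cmod_0; pose proof (Cmod_nonneg h); nra.
Qed.

Lemma Cdiff_add q r z : Cdiff q z -> Cdiff r z -> Cdiff (fun w => Cadd (q w) (r w)) z.
Proof.
intros [d H] [e G]; exists (Cadd d e); intros eps he.
destruct (H (eps / 2) ltac:(lra)) as [a [ha Ha]], (G (eps / 2) ltac:(lra)) as [b [hb Hb]].
exists (Rmin a b); split; [apply Rmin_pos; assumption|intros h hh].
specialize (Ha h (Rlt_le_trans _ _ _ hh (Rmin_l _ _))).
specialize (Hb h (Rlt_le_trans _ _ _ hh (Rmin_r _ _))).
replace (Csub _ _) with
  (Cadd (Csub (Csub (q (Cadd z h)) (q z)) (Cmul d h)) (Csub (Csub (r (Cadd z h)) (r z)) (Cmul e h))) by ring.
eapply Rle_trans; [apply Cmod_triangle|lra].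
Qed.

Lemma Cdiff_mul q r z : Cdiff q z -> Cdiff r z -> Cdiff (fun w => Cmul (q w) (r w)) z.
Proof.
intros Hq Hr.
destruct (Cdiff_local_Lipschitz q z Hq) as (L & dL & Lp & dLp & HL).
destruct (Cdiff_local_Lipschitz r z Hr) as (K & dK & Kp & dKp & HK).
destruct Hq as [d H], Hr as [e G]; exists (Cadd (Cmul d (r z)) (Cmul (q z) e)); intros eps he.
set (B := 1 + Cmod (r z) + Cmod (q z)).
assert (Bp : 0 < B) by (pose proof (Cmod_nonneg (r z)); pose proof (Cmod_nonneg (q z)); unfold B; lra).
assert (eB : 0 < eps / (3 * B)) by (apply Rdiv_lt_0_compat; lra).
destruct (H _ eB) as [a [ha Ha]], (G _ eB) as [b [hb Hb]].
assert (LK : 0 < L * K) by (apply Rmult_lt_0_compat; assumption).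
assert (c0 : 0 < eps / (3 * (L * K))) by (apply Rdiv_lt_0_compat; lra).
exists (Rmin (Rmin a b) (Rmin (Rmin dL dK) (eps / (3 * (L * K))))); split.
{ repeat apply Rmin_pos; assumption. }
intros h hh.
assert (h1 : Cmod h < a) by (eapply Rlt_le_trans; [exact hh|eapply Rle_trans; [apply Rmin_l|apply Rmin_l]]).
assert (h2 : Cmod h < b) by (eapply Rlt_le_trans; [exact hh|eapply Rle_trans; [apply Rmin_l|apply Rmin_r]]).
assert (h3 : Cmod h < dL) by (eapply Rlt_le_trans; [exact hh|eapply Rle_trans; [apply Rmin_r|eapply Rle_trans; [apply Rmin_l|apply Rmin_l]]]).
assert (h4 : Cmod h < dK) by (eapply Rlt_le_trans; [exact hh|eapply Rle_trans; [apply Rmin_r|eapply Rle_trans; [apply Rmin_l|apply Rmin_r]]]).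
assert (h5 : Cmod h < eps / (3 * (L * K))) by (eapply Rlt_le_trans; [exact hh|eapply Rle_trans; [apply Rmin_r|apply Rmin_r]]).
specialize (Ha h h1); specialize (Hb h h2); specialize (HL h h3); specialize (HK h h4).
set (x := Cmod h) in *.
assert (xn : 0 <= x) by apply Cmod_nonneg.
replace (Csub _ _) with
  (Cadd (Cadd (Cmul (Csub (Csub (q (Cadd z h)) (q z)) (Cmul d h)) (r z))
              (Cmul (q z) (Csub (Csub (r (Cadd z h)) (r z)) (Cmul e h))))
        (Cmul (Csub (q (Cadd z h)) (q z)) (Csub (r (Cadd z h)) (r z)))) by ring.
eapply Rle_trans; [apply Cmod_triangle|].
eapply Rle_trans; [apply Rplus_le_compat_r, Cmod_triangle|].
rewrite !Cmod_mul.
set (u := eps / (3 * B)) in *.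
assert (uB : u * B = eps / 3) by (unfold u; field; lra).
assert (T1 : Cmod (Csub (Csub (q (Cadd z h)) (q z)) (Cmul d h)) * Cmod (r z) <= u * x * Cmod (r z))
  by (apply Rmult_le_compat_r; [apply Cmod_nonneg|assumption]).
assert (T2 : Cmod (q z) * Cmod (Csub (Csub (r (Cadd z h)) (r z)) (Cmul e h)) <= Cmod (q z) * (u * x))
  by (apply Rmult_le_compat_l; [apply Cmod_nonneg|assumption]).
assert (T3 : Cmod (Csub (q (Cadd z h)) (q z)) * Cmod (Csub (r (Cadd z h)) (r z)) <= (L * x) * (K * x))
  by (apply Rmult_le_compat; try apply Cmod_nonneg; assumption).
assert (T4 : (L * K) * x <= eps / 3).
{ apply Rmult_lt_compat_l with (r := L * K) in h5; [|assumption].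
  replace (L * K * (eps / (3 * (L * K)))) with (eps / 3) in h5 by (field; lra); lra. }
assert (T5 : (L * x) * (K * x) <= eps / 3 * x) by nra.
assert (T6 : u * x * Cmod (r z) + Cmod (q z) * (u * x) <= eps / 3 * x).
{ rewrite <- uB; unfold B.
  assert (0 <= u * x) by (apply Rmult_le_pos; lra).
  replace (u * (1 + Cmod (r z) + Cmod (q z)) * x) with
    (u * x + (u * x * Cmod (r z) + Cmod (q z) * (u * x))) by ring; lra. }
assert (0 <= eps * x) by nra; lra.
Qed.

Lemma Cdiff_sub q r z : Cdiff q z -> Cdiff r z -> Cdiff (fun w => Csub (q w) (r w)) z.
Proof.
intros H [e G]; unfold Csub; apply Cdiff_add; [assumption|].
exists (Copp e); intros eps he; destruct (G eps he) as [b [hb Hb]].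
exists b; split; [assumption|intros h hh; specialize (Hb h hh)].
rewrite <- Cmod_opp; replace (Copp _) with (Csub (Csub (r (Cadd z h)) (r z)) (Cmul e h)) by ring.
exact Hb.
Qed.

Lemma Cdiff_comp q r z : Cdiff r z -> Cdiff q (r z) -> Cdiff (fun w => q (r w)) z.
Proof.
intros Hr [d H].
destruct (Cdiff_local_Lipschitz r z Hr) as (K & dK & Kp & dKp & HK).
destruct Hr as [e G]; exists (Cmul d e); intros eps he.
assert (eK : 0 < eps / (2 * K)) by (apply Rdiv_lt_0_compat; lra).
destruct (H _ eK) as [a [ha Ha]].
pose proof (Cmod_nonneg d) as dn.
assert (ed : 0 < eps / (2 * (Cmod d + 1))) by (apply Rdiv_lt_0_compat; lra).
destruct (G _ ed) as [b [hb Hb]].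
exists (Rmin (Rmin dK b) (a / K)); split.
{ repeat apply Rmin_pos; try assumption; apply Rdiv_lt_0_compat; assumption. }
intros h hh.
assert (h1 : Cmod h < dK) by (eapply Rlt_le_trans; [exact hh|eapply Rle_trans; [apply Rmin_l|apply Rmin_l]]).
assert (h2 : Cmod h < b) by (eapply Rlt_le_trans; [exact hh|eapply Rle_trans; [apply Rmin_l|apply Rmin_r]]).
assert (h3 : Cmod h < a / K) by (eapply Rlt_le_trans; [exact hh|apply Rmin_r]).
specialize (HK h h1); specialize (Hb h h2).
set (k := Csub (r (Cadd z h)) (r z)) in *.
assert (ka : Cmod k < a).
{ eapply Rle_lt_trans; [exact HK|].
  apply Rmult_lt_compat_l with (r := K) in h3; [|assumption].
  replace (K * (a / K)) with a in h3 by (field; lra); exact h3. }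
specialize (Ha k ka).
replace (Cadd (r z) k) with (r (Cadd z h)) in Ha by (unfold k; ring).
replace (Csub _ _) with
  (Cadd (Csub (Csub (q (r (Cadd z h))) (q (r z))) (Cmul d k)) (Cmul d (Csub k (Cmul e h)))) by ring.
eapply Rle_trans; [apply Cmod_triangle|rewrite Cmod_mul].
assert (T1 : eps / (2 * K) * Cmod k <= eps / 2 * Cmod h).
{ replace (eps / 2 * Cmod h) with (eps / (2 * K) * (K * Cmod h)) by (field; lra).
  apply Rmult_le_compat_l; lra. }
assert (T2 : Cmod d * Cmod (Csub k (Cmul e h)) <= eps / 2 * Cmod h).
{ apply Rle_trans with ((Cmod d + 1) * (eps / (2 * (Cmod d + 1)) * Cmod h)).
  - apply Rmult_le_compat; try apply Cmod_nonneg; lra.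
  - right; field; lra. }
lra.
Qed.

Lemma Cdiff_inv z : z <> C0 -> Cdiff Cinv z.
Proof.
intros nz; pose proof (Cmod_pos z nz) as zp.
exists (Copp (Cmul (Cinv z) (Cinv z))); intros eps he.
set (m := Cmod z) in *.
exists (Rmin (m / 2) (eps * (m * m * m) / 2)); split.
{ apply Rmin_pos; [lra|]; repeat apply Rmult_lt_0_compat; lra. }
intros h hh.
assert (h1 : Cmod h < m / 2) by (eapply Rlt_le_trans; [exact hh|apply Rmin_l]).
assert (h2 : Cmod h < eps * (m * m * m) / 2) by (eapply Rlt_le_trans; [exact hh|apply Rmin_r]).
assert (zh : m / 2 <= Cmod (Cadd z h)).
{ pose proof (Cmod_sub_triangle (Cadd z h) h) as t.
  replace (Csub (Cadd z h) h) with z in t by ring; unfold m in *; lra. }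
assert (nzh : Cadd z h <> C0) by (intros e; rewrite e, Cmod_0 in zh; lra).
replace (Csub _ _) with (Cmul (Cmul h h) (Cmul (Cinv (Cadd z h)) (Cmul (Cinv z) (Cinv z))))
  by (field; split; assumption).
rewrite !Cmod_mul, !Cmod_inv by assumption; fold m.
assert (i1 : / Cmod (Cadd z h) <= 2 / m).
{ replace (2 / m) with (/ (m / 2)) by (field; lra); apply Rinv_le_contravar; lra. }
pose proof (Cmod_nonneg h) as hn; set (x := Cmod h) in *.
apply Rle_trans with (x * x * (2 / m * (/ m * / m))).
- apply Rmult_le_compat_l; [nra|]; apply Rmult_le_compat_r; [|exact i1].
  apply Rlt_le, Rmult_lt_0_compat; apply Rinv_0_lt_compat; lra.
- replace (x * x * (2 / m * (/ m * / m))) with (x * (x * (2 / (m * m * m)))) by (field; lra).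
  rewrite (Rmult_comm eps); apply Rmult_le_compat_l; [assumption|].
  assert (m3 : 0 < m * m * m) by (repeat apply Rmult_lt_0_compat; lra).
  replace eps with (eps * (m * m * m) / 2 * (2 / (m * m * m))) by (field; lra).
  apply Rmult_le_compat_r; [|lra].
  apply Rlt_le, Rdiv_lt_0_compat; lra.
Qed.

(** * Subdivision of rectangles *)

Section Bisection.
Variables (x0 y0 a b : R) (P : R -> R -> R -> Prop).
Hypotheses (ha : 0 < a) (hb : 0 < b).
Let inside x y t := x0 <= x /\ x + t * a <= x0 + a /\ y0 <= y /\ y + t * b <= y0 + b.
Hypothesis Hsplit : forall x y t, 0 < t -> inside x y t ->
  P x y (t / 2) -> P (x + t / 2 * a) y (t / 2) -> P x (y + t / 2 * b) (t / 2) ->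
  P (x + t / 2 * a) (y + t / 2 * b) (t / 2) -> P x y t.
Hypothesis Hlocal : forall u v, x0 <= u <= x0 + a -> y0 <= v <= y0 + b ->
  exists delta, 0 < delta /\ forall x y t, 0 < t < delta -> inside x y t ->
    x <= u <= x + t * a -> y <= v <= y + t * b -> P x y t.

(** Chooses a quarter on which P fails. The last quarter is the default: if the first three are good
    and the whole is bad, it must be bad. *)
Let pick (t : R) (p : R * R) : R * R :=
  let x := fst p in let y := snd p in
  if excluded_middle_informative (~ P x y (t / 2)) then (x, y) else
  if excluded_middle_informative (~ P (x + t / 2 * a) y (t / 2)) then (x + t / 2 * a, y) else
  if excluded_middle_informative (~ P x (y + t / 2 * b) (t / 2)) then (x, y + t / 2 * b) else
  (x + t / 2 * a, y + t / 2 * b).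

Let ps : nat -> R * R := fix ps n := match n with O => (x0, y0) | S m => pick ((/ 2) ^ m) (ps m) end.

(** Compactness of the rectangle as an induction principle: the triple x y t stands for the
    rectangle with corner (x, y) and sides t a and t b. If P failed on the whole, nested bad
    quarters would shrink to a point (u, v), where [Hlocal] makes all small rectangles good. Serves
    both Goursat's theorem and the boundedness of continuous functions. *)
Lemma bisection : P x0 y0 1.
Proof.
apply NNPP; intros nP.
assert (pw : forall n, 0 < (/ 2) ^ n) by (intros; apply pow_lt; lra).
assert (pwS : forall n, (/ 2) ^ (S n) = (/ 2) ^ n / 2) by (intros; simpl; field).
assert (inv : forall n, ~ P (fst (ps n)) (snd (ps n)) ((/ 2) ^ n) /\
   inside (fst (ps n)) (snd (ps n)) ((/ 2) ^ n)).
{ induction n as [|n [IH1 IH2]].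
  - simpl; split; [exact nP|unfold inside; lra].
  - rewrite pwS; set (t := (/ 2) ^ n) in *.
    assert (tp : 0 < t) by apply pw.
    change (ps (S n)) with (pick t (ps n)); unfold pick.
    destruct (ps n) as [x y]; simpl in IH1, IH2; cbv zeta; simpl fst; simpl snd.
    assert (ta : 0 < t * a) by (apply Rmult_lt_0_compat; assumption).
    assert (tb : 0 < t * b) by (apply Rmult_lt_0_compat; assumption).
    assert (in1 : inside x y (t / 2) /\ inside (x + t / 2 * a) y (t / 2) /\
       inside x (y + t / 2 * b) (t / 2) /\ inside (x + t / 2 * a) (y + t / 2 * b) (t / 2))
      by (unfold inside in *; lra).
    destruct in1 as (i1 & i2 & i3 & i4).
    destruct excluded_middle_informative as [e1|e1]; [split; assumption|].
    destruct excluded_middle_informative as [e2|e2]; [split; assumption|].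
    destruct excluded_middle_informative as [e3|e3]; [split; assumption|].
    simpl; split; [|assumption]; intros e4; apply IH1, Hsplit; auto; apply NNPP; assumption. }
assert (mono : forall n, fst (ps n) <= fst (ps (S n)) /\
    fst (ps (S n)) + (/ 2) ^ (S n) * a <= fst (ps n) + (/ 2) ^ n * a /\
    snd (ps n) <= snd (ps (S n)) /\
    snd (ps (S n)) + (/ 2) ^ (S n) * b <= snd (ps n) + (/ 2) ^ n * b).
{ intros n; rewrite pwS; pose proof (pw n) as tp; set (t := (/ 2) ^ n) in *.
  assert (ta : 0 < t * a) by (apply Rmult_lt_0_compat; assumption).
  assert (tb : 0 < t * b) by (apply Rmult_lt_0_compat; assumption).
  change (ps (S n)) with (pick t (ps n)); unfold pick; destruct (ps n) as [x y]; cbv zeta; simpl fst; simpl snd.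
  repeat destruct excluded_middle_informative; simpl fst; simpl snd; lra. }
assert (lim : forall (s : nat -> R) (c : R), (forall n, s n <= s (S n)) ->
   (forall n, s (S n) + (/ 2) ^ (S n) * c <= s n + (/ 2) ^ n * c) -> 0 < c ->
   exists u, forall n, s n <= u <= s n + (/ 2) ^ n * c).
{ intros s c h1 h2 cp.
  assert (g1 : forall n k, s n <= s (n + k)%nat).
  { induction k; [rewrite Nat.add_0_r; lra|rewrite Nat.add_succ_r; eapply Rle_trans; [exact IHk|apply h1]]. }
  assert (g2 : forall n k, s (n + k)%nat + (/ 2) ^ (n + k) * c <= s n + (/ 2) ^ n * c).
  { induction k; [rewrite Nat.add_0_r; lra|rewrite Nat.add_succ_r; eapply Rle_trans; [apply h2|exact IHk]]. }
  assert (g3 : forall n m, s m <= s n + (/ 2) ^ n * c).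
  { intros n m; destruct (Nat.le_ge_cases n m) as [l|l].
    - replace m with (n + (m - n))%nat by lia; specialize (g2 n (m - n)%nat).
      assert (0 < (/ 2) ^ (n + (m - n)) * c) by (apply Rmult_lt_0_compat; [apply pw|assumption]); lra.
    - replace n with (m + (n - m))%nat by lia; specialize (g1 m (n - m)%nat).
      assert (0 < (/ 2) ^ (m + (n - m)) * c) by (apply Rmult_lt_0_compat; [apply pw|assumption]); lra. }
  destruct (completeness (fun x => exists n, x = s n)) as [u [u1 u2]].
  - exists (s O + (/ 2) ^ O * c); intros x [n ->]; apply g3.
  - exists (s O), O; reflexivity.
  - exists u; intros n; split; [apply u1; exists n; reflexivity|].
    apply u2; intros x [m ->]; apply g3. }
destruct (lim (fun n => fst (ps n)) a) as [u hu]; [intros; apply mono|intros; apply mono|assumption|].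
destruct (lim (fun n => snd (ps n)) b) as [v hv]; [intros; apply mono|intros; apply mono|assumption|].
destruct (Hlocal u v) as [delta [dp Hd]].
{ specialize (hu O); simpl in hu; lra. }
{ specialize (hv O); simpl in hv; lra. }
destruct (pow_lt_1_zero (/ 2) ltac:(rewrite Rabs_right; lra) delta dp) as [N HN].
specialize (HN N (le_n N)); rewrite Rabs_right in HN by (apply Rle_ge, Rlt_le, pw).
destruct (inv N) as [i1 i2]; apply i1, Hd; auto.
Qed.
End Bisection.

(** * Integrals over segments and rectangles, Goursat's theorem *)

Definition curve_cont (g : R -> Cx) (t : R) : Prop :=
  continuous (fun s => re (g s)) t /\ continuous (fun s => im (g s)) t.

Definition CI (g : R -> Cx) (a b : R) : Cx :=
  mkCx (RInt (fun s => re (g s)) a b) (RInt (fun s => im (g s)) a b).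

Definition Ipt (x y : R) : Cx := mkCx x y.
Definition Ci : Cx := mkCx 0 1.

Lemma cont_seg_ex (g : R -> Cx) a b : a <= b -> (forall t, a <= t <= b -> curve_cont g t) ->
  ex_RInt (fun s => re (g s)) a b /\ ex_RInt (fun s => im (g s)) a b.
Proof.
intros ab H; split; apply (ex_RInt_continuous (V := R_CompleteNormedModule));
  intros t; rewrite Rmin_left, Rmax_right by assumption; intros ht; apply (H t ht).
Qed.

Lemma CI_ext g h a b : a <= b -> (forall t, a < t < b -> g t = h t) -> CI g a b = CI h a b.
Proof.
intros ab H; apply Cx_ext; simpl; apply RInt_ext; intros t;
  rewrite Rmin_left, Rmax_right by assumption; intros ht; rewrite (H t ht); reflexivity.
Qed.

Lemma CI_add g h a b : a <= b -> (forall t, a <= t <= b -> curve_cont g t) ->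
  (forall t, a <= t <= b -> curve_cont h t) ->
  CI (fun t => Cadd (g t) (h t)) a b = Cadd (CI g a b) (CI h a b).
Proof.
intros ab Hg Hh; destruct (cont_seg_ex g a b ab Hg), (cont_seg_ex h a b ab Hh).
apply Cx_ext; simpl; apply (RInt_plus (V := R_CompleteNormedModule)); assumption.
Qed.

Lemma CI_mul_l c g a b : a <= b -> (forall t, a <= t <= b -> curve_cont g t) ->
  CI (fun t => Cmul c (g t)) a b = Cmul c (CI g a b).
Proof.
intros ab Hg; destruct (cont_seg_ex g a b ab Hg) as [h1 h2].
assert (s : forall k (f : R -> R), ex_RInt f a b -> RInt (fun t => k * f t) a b = k * RInt f a b).
{ intros k f hf; apply (RInt_scal (V := R_CompleteNormedModule)); assumption. }
assert (e : forall k (f : R -> R), ex_RInt f a b -> ex_RInt (fun t => k * f t) a b).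
{ intros k f hf; apply (ex_RInt_scal (V := R_CompleteNormedModule)); assumption. }
apply Cx_ext; simpl.
- rewrite (RInt_minus (V := R_CompleteNormedModule) (fun t => re c * re (g t)) (fun t => im c * im (g t))) by auto.
  rewrite !s by assumption; reflexivity.
- rewrite (RInt_plus (V := R_CompleteNormedModule) (fun t => re c * im (g t)) (fun t => im c * re (g t))) by auto.
  rewrite !s by assumption; reflexivity.
Qed.

Lemma CI_chasles g a b c : a <= b -> b <= c -> (forall t, a <= t <= c -> curve_cont g t) ->
  CI g a c = Cadd (CI g a b) (CI g b c).
Proof.
intros ab bc H.
destruct (cont_seg_ex g a b ab) as [h1 h2]; [intros; apply H; lra|].
destruct (cont_seg_ex g b c bc) as [h3 h4]; [intros; apply H; lra|].
apply Cx_ext; simpl; symmetry; apply (RInt_Chasles (V := R_CompleteNormedModule)); assumption.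
Qed.

(** The factor 2 is the price of estimating real and imaginary parts separately. No estimate below
    needs a sharp constant. *)
Lemma CI_bound g a b M : a <= b -> (forall t, a <= t <= b -> curve_cont g t) ->
  (forall t, a <= t <= b -> Cmod (g t) <= M) -> Cmod (CI g a b) <= 2 * (M * (b - a)).
Proof.
intros ab Hg HM; destruct (cont_seg_ex g a b ab Hg) as [h1 h2].
assert (k : forall f : R -> R, ex_RInt f a b -> (forall t, a <= t <= b -> Rabs (f t) <= M) ->
   Rabs (RInt f a b) <= M * (b - a)).
{ intros f hf hM; rewrite Rmult_comm; apply abs_RInt_le_const; assumption. }
eapply Rle_trans; [apply Cmod_le_re_im|simpl].
assert (k1 := k _ h1 (fun t ht => Rle_trans _ _ _ (Rabs_re_le (g t)) (HM t ht))).
assert (k2 := k _ h2 (fun t ht => Rle_trans _ _ _ (Rabs_im_le (g t)) (HM t ht))).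
lra.
Qed.

Lemma CI_opp_arg g a b : a <= b -> (forall t, a <= t <= b -> curve_cont g t) ->
  CI (fun t => g (- t)) (- b) (- a) = CI g a b.
Proof.
intros ab H; destruct (cont_seg_ex g a b ab H) as [h1 h2].
assert (k : forall f : R -> R, ex_RInt f a b -> RInt (fun t => f (- t)) (- b) (- a) = RInt f a b).
{ intros f hf.
  rewrite <- (Rmult_1_l (RInt f a b)).
  apply is_RInt_unique.
  apply (is_RInt_ext (V := R_NormedModule) (fun t => opp (opp (f (- t))))).
  { intros t _; unfold opp; simpl; ring. }
  rewrite Rmult_1_l; rewrite <- (Ropp_involutive (RInt f a b)).
  apply (is_RInt_opp (V := R_NormedModule)).
  apply (is_RInt_comp_opp (V := R_NormedModule)); rewrite !Ropp_involutive.
  apply (is_RInt_swap (V := R_NormedModule)).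
  apply (RInt_correct (V := R_CompleteNormedModule)); assumption. }
apply Cx_ext; [exact (k (fun s => re (g s)) h1)|exact (k (fun s => im (g s)) h2)].
Qed.

Lemma RInt_affine c d a b : RInt (fun t => c + d * t) a b = c * (b - a) + d * (b * b - a * a) / 2.
Proof.
apply is_RInt_unique.
replace (c * (b - a) + d * (b * b - a * a) / 2) with
  (minus (c * b + d * (b * b) / 2) (c * a + d * (a * a) / 2)) by (unfold minus, plus, opp; simpl; field).
apply (is_RInt_derive (fun t => c * t + d * (t * t) / 2)).
- intros t _; auto_derive; [exact I|field].
- intros t _; apply continuity_pt_filterlim; reg.
Qed.

Lemma Cx_line_cont q (u v : R -> R) t : Ccont q (Ipt (u t) (v t)) ->
  continuity_pt u t -> continuity_pt v t -> curve_cont (fun s => q (Ipt (u s) (v s))) t.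
Proof.
intros Hq Hu Hv.
assert (key : forall eps, 0 < eps -> exists delta, 0 < delta /\ forall s, Rabs (s - t) < delta ->
   Cmod (Csub (q (Ipt (u s) (v s))) (q (Ipt (u t) (v t)))) < eps).
{ intros eps he; destruct (Hq eps he) as [d [dp Hd]].
  destruct (Hu (d / 2) ltac:(lra)) as [a [ap Ha]], (Hv (d / 2) ltac:(lra)) as [b [bp Hb]].
  exists (Rmin a b); split; [apply Rmin_pos; assumption|intros s hs; apply Hd].
  eapply Rle_lt_trans; [apply Cmod_le_re_im|simpl].
  assert (a1 : Rabs (u s - u t) < d / 2).
  { destruct (Req_dec s t) as [->|ne]; [rewrite Rminus_diag; rewrite Rabs_R0; lra|].
    apply (Ha s); split; [split; [exact I|auto]|]; simpl; unfold Rdist.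
    eapply Rlt_le_trans; [exact hs|apply Rmin_l]. }
  assert (b1 : Rabs (v s - v t) < d / 2).
  { destruct (Req_dec s t) as [->|ne]; [rewrite Rminus_diag; rewrite Rabs_R0; lra|].
    apply (Hb s); split; [split; [exact I|auto]|]; simpl; unfold Rdist.
    eapply Rlt_le_trans; [exact hs|apply Rmin_r]. }
  unfold Rminus in *; lra. }
split; apply continuity_pt_filterlim; intros eps he; destruct (key eps he) as [d [dp Hd]];
 exists d; (split; [exact dp|]); intros s [_ hs]; simpl in *; unfold Rdist in *;
 eapply Rle_lt_trans; [|exact (Hd s hs)| |exact (Hd s hs)].
- exact (Rabs_re_le (Csub (q (Ipt (u s) (v s))) (q (Ipt (u t) (v t))))).
- exact (Rabs_im_le (Csub (q (Ipt (u s) (v s))) (q (Ipt (u t) (v t))))).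
Qed.

(** The integral of q dz over the boundary, taken counterclockwise; the factor [Ci] is dz on the
    vertical sides. *)
Definition rect_int (q : Cx -> Cx) x0 x1 y0 y1 : Cx :=
  Csub (Cadd (CI (fun x => q (Ipt x y0)) x0 x1) (Cmul Ci (CI (fun y => q (Ipt x1 y)) y0 y1)))
       (Cadd (CI (fun x => q (Ipt x y1)) x0 x1) (Cmul Ci (CI (fun y => q (Ipt x0 y)) y0 y1))).

Definition rect_cont q x0 x1 y0 y1 :=
  forall x y, x0 <= x <= x1 -> y0 <= y <= y1 -> Ccont q (Ipt x y).

Lemma cont_hor q x0 x1 y0 y1 y : rect_cont q x0 x1 y0 y1 -> y0 <= y <= y1 ->
  forall x, x0 <= x <= x1 -> curve_cont (fun t => q (Ipt t y)) x.
Proof.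
intros H hy x hx; apply (Cx_line_cont q (fun t => t) (fun _ => y)); [apply H; assumption|reg|reg].
Qed.

Lemma cont_ver q x0 x1 y0 y1 x : rect_cont q x0 x1 y0 y1 -> x0 <= x <= x1 ->
  forall y, y0 <= y <= y1 -> curve_cont (fun t => q (Ipt x t)) y.
Proof.
intros H hy y hx; apply (Cx_line_cont q (fun _ => x) (fun t => t)); [apply H; assumption|reg|reg].
Qed.

Lemma rect_int_split q x0 x1 x2 y0 y1 y2 : x0 <= x1 -> x1 <= x2 -> y0 <= y1 -> y1 <= y2 ->
  rect_cont q x0 x2 y0 y2 ->
  rect_int q x0 x2 y0 y2 =
  Cadd (Cadd (rect_int q x0 x1 y0 y1) (rect_int q x1 x2 y0 y1))
       (Cadd (rect_int q x0 x1 y1 y2) (rect_int q x1 x2 y1 y2)).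
Proof.
intros a b c d H; unfold rect_int.
rewrite (CI_chasles (fun x => q (Ipt x y0)) x0 x1 x2); auto;
  [|intros; eapply cont_hor; eauto; lra].
rewrite (CI_chasles (fun x => q (Ipt x y2)) x0 x1 x2); auto;
  [|intros; eapply cont_hor; eauto; lra].
rewrite (CI_chasles (fun y => q (Ipt x0 y)) y0 y1 y2); auto;
  [|intros; eapply cont_ver; eauto; lra].
rewrite (CI_chasles (fun y => q (Ipt x2 y)) y0 y1 y2); auto;
  [|intros; eapply cont_ver; eauto; lra].
ring.
Qed.

Lemma rect_int_add q r x0 x1 y0 y1 : x0 <= x1 -> y0 <= y1 ->
  rect_cont q x0 x1 y0 y1 -> rect_cont r x0 x1 y0 y1 ->
  rect_int (fun z => Cadd (q z) (r z)) x0 x1 y0 y1 =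
  Cadd (rect_int q x0 x1 y0 y1) (rect_int r x0 x1 y0 y1).
Proof.
intros a b Hq Hr; unfold rect_int.
assert (y00 : y0 <= y0 <= y1) by lra; assert (y11 : y0 <= y1 <= y1) by lra.
assert (x00 : x0 <= x0 <= x1) by lra; assert (x11 : x0 <= x1 <= x1) by lra.
rewrite (CI_add (fun x => q (Ipt x y0)) (fun x => r (Ipt x y0))) by (auto; eapply cont_hor; eauto).
rewrite (CI_add (fun x => q (Ipt x y1)) (fun x => r (Ipt x y1))) by (auto; eapply cont_hor; eauto).
rewrite (CI_add (fun y => q (Ipt x0 y)) (fun y => r (Ipt x0 y))) by (auto; eapply cont_ver; eauto).
rewrite (CI_add (fun y => q (Ipt x1 y)) (fun y => r (Ipt x1 y))) by (auto; eapply cont_ver; eauto).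
ring.
Qed.

Lemma rect_int_ext q r x0 x1 y0 y1 : x0 <= x1 -> y0 <= y1 -> (forall z, q z = r z) ->
  rect_int q x0 x1 y0 y1 = rect_int r x0 x1 y0 y1.
Proof.
intros a b H; unfold rect_int.
rewrite (CI_ext (fun x => q (Ipt x y0)) (fun x => r (Ipt x y0))) by auto.
rewrite (CI_ext (fun x => q (Ipt x y1)) (fun x => r (Ipt x y1))) by auto.
rewrite (CI_ext (fun y => q (Ipt x0 y)) (fun y => r (Ipt x0 y))) by auto.
rewrite (CI_ext (fun y => q (Ipt x1 y)) (fun y => r (Ipt x1 y))) by auto.
reflexivity.
Qed.

Lemma rect_int_affine c d x0 x1 y0 y1 :
  rect_int (fun z => Cadd c (Cmul d z)) x0 x1 y0 y1 = C0.
Proof.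
assert (e : forall k l (f : R -> R) a b, (forall t, f t = k + l * t) ->
   RInt f a b = k * (b - a) + l * (b * b - a * a) / 2).
{ intros k l f a b H; rewrite <- RInt_affine; apply RInt_ext; intros; apply H. }
unfold rect_int, CI; simpl.
rewrite (e (re c - im d * y0) (re d) (fun x => re c + (re d * x - im d * y0))) by (intros; ring).
rewrite (e (re c - im d * y1) (re d) (fun x => re c + (re d * x - im d * y1))) by (intros; ring).
rewrite (e (re c + re d * x0) (- im d) (fun y => re c + (re d * x0 - im d * y))) by (intros; ring).
rewrite (e (re c + re d * x1) (- im d) (fun y => re c + (re d * x1 - im d * y))) by (intros; ring).
rewrite (e (im c + re d * y0) (im d) (fun x => im c + (re d * y0 + im d * x))) by (intros; ring).
rewrite (e (im c + re d * y1) (im d) (fun x => im c + (re d * y1 + im d * x))) by (intros; ring).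
rewrite (e (im c + im d * x0) (re d) (fun y => im c + (re d * y + im d * x0))) by (intros; ring).
rewrite (e (im c + im d * x1) (re d) (fun y => im c + (re d * y + im d * x1))) by (intros; ring).
apply Cx_ext; simpl; field.
Qed.

Lemma rect_int_bound q x0 x1 y0 y1 M : x0 <= x1 -> y0 <= y1 -> rect_cont q x0 x1 y0 y1 ->
  (forall x y, x0 <= x <= x1 -> y0 <= y <= y1 -> Cmod (q (Ipt x y)) <= M) ->
  Cmod (rect_int q x0 x1 y0 y1) <= 4 * (M * ((x1 - x0) + (y1 - y0))).
Proof.
intros a b Hq HM; unfold rect_int.
assert (y00 : y0 <= y0 <= y1) by lra; assert (y11 : y0 <= y1 <= y1) by lra.
assert (x00 : x0 <= x0 <= x1) by lra; assert (x11 : x0 <= x1 <= x1) by lra.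
assert (ci : Cmod Ci = 1) by (unfold Cmod, Cnorm2, Ci; simpl; replace (0 * 0 + 1 * 1) with 1 by ring; apply sqrt_1).
eapply Rle_trans; [apply Cmod_sub_triangle|].
eapply Rle_trans; [apply Rplus_le_compat; apply Cmod_triangle|rewrite !Cmod_mul, ci].
assert (k1 := CI_bound (fun x => q (Ipt x y0)) x0 x1 M a (cont_hor _ _ _ _ _ _ Hq y00) ltac:(intros; apply HM; lra)).
assert (k2 := CI_bound (fun x => q (Ipt x y1)) x0 x1 M a (cont_hor _ _ _ _ _ _ Hq y11) ltac:(intros; apply HM; lra)).
assert (k3 := CI_bound (fun y => q (Ipt x0 y)) y0 y1 M b (cont_ver _ _ _ _ _ _ Hq x00) ltac:(intros; apply HM; lra)).
assert (k4 := CI_bound (fun y => q (Ipt x1 y)) y0 y1 M b (cont_ver _ _ _ _ _ _ Hq x11) ltac:(intros; apply HM; lra)).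
lra.
Qed.

Lemma Ccont_rect q x0 x1 y0 y1 : (forall x y, x0 <= x <= x1 -> y0 <= y <= y1 -> Cdiff q (Ipt x y)) ->
  rect_cont q x0 x1 y0 y1.
Proof. intros H x y hx hy; apply Cdiff_cont, H; assumption. Qed.

(** [bisection] is applied to the bound eps t^2 K, which adds up over quarters because 4 (t/2)^2 =
    t^2. Locally the remainder of the linearization is at most eps t (a + b) on a boundary of length
    2 t (a + b), and [rect_int_bound] turns this into K = 4 (a + b)^2. *)
Theorem goursat q x0 x1 y0 y1 : x0 < x1 -> y0 < y1 ->
  (forall x y, x0 <= x <= x1 -> y0 <= y <= y1 -> Cdiff q (Ipt x y)) ->
  rect_int q x0 x1 y0 y1 = C0.
Proof.
intros hx hy Hq; apply Cmod_eq0.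
set (a := x1 - x0); set (b := y1 - y0).
assert (ap : 0 < a) by (unfold a; lra); assert (bp : 0 < b) by (unfold b; lra).
assert (Hc := Ccont_rect q x0 x1 y0 y1 Hq).
assert (key : forall eps, 0 < eps -> Cmod (rect_int q x0 x1 y0 y1) <= eps * (4 * ((a + b) * (a + b)))).
{ intros eps he; set (K := 4 * ((a + b) * (a + b))).
  assert (B : Cmod (rect_int q x0 (x0 + 1 * a) y0 (y0 + 1 * b)) <= eps * (1 * 1) * K).
  { apply (bisection x0 y0 a b (fun x y t => Cmod (rect_int q x (x + t * a) y (y + t * b)) <= eps * (t * t) * K)); auto.
    - intros x y t tp (i1 & i2 & i3 & i4) p1 p2 p3 p4.
      assert (ta : 0 < t * a) by (apply Rmult_lt_0_compat; assumption).
      assert (tb : 0 < t * b) by (apply Rmult_lt_0_compat; assumption).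
      rewrite (rect_int_split q x (x + t / 2 * a) (x + t * a) y (y + t / 2 * b) (y + t * b)); try lra.
      2:{ intros u v hu hv; apply Hc; unfold a, b in *; lra. }
      replace (x + t / 2 * a + t / 2 * a) with (x + t * a) in * by field.
      replace (y + t / 2 * b + t / 2 * b) with (y + t * b) in * by field.
      eapply Rle_trans; [apply Cmod_triangle|].
      eapply Rle_trans; [apply Rplus_le_compat; apply Cmod_triangle|].
      replace (eps * (t * t) * K) with (4 * (eps * (t / 2 * (t / 2)) * K)) by field; lra.
    - intros u v hu hv.
      destruct (Hq u v ltac:(unfold a in *; lra) ltac:(unfold b in *; lra)) as [d Hd].
      destruct (Hd eps he) as [de [dep Hde]].
      exists (de / (a + b)); split; [apply Rdiv_lt_0_compat; lra|].
      intros x y t [tp td] (i1 & i2 & i3 & i4) ux vy.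
      assert (ta : 0 < t * a) by (apply Rmult_lt_0_compat; assumption).
      assert (tb : 0 < t * b) by (apply Rmult_lt_0_compat; assumption).
      assert (tab : t * (a + b) < de).
      { apply Rmult_lt_compat_r with (r := a + b) in td; [|lra].
        replace (de / (a + b) * (a + b)) with de in td by (field; lra); exact td. }
      set (z0 := Ipt u v) in *.
      set (c := Csub (q z0) (Cmul d z0)).
      (* Subtracting the tangent affine map leaves the boundary integral unchanged by
         [rect_int_affine]; the remainder is at most eps times the distance to the point of
         tangency. *)
      set (r := fun z => Csub (q z) (Cadd c (Cmul d z))).
      assert (Ha : rect_cont (fun z => Cadd c (Cmul d z)) x (x + t * a) y (y + t * b)).
      { apply Ccont_rect; intros; apply Cdiff_add; [apply Cdiff_const|apply Cdiff_mul; [apply Cdiff_const|apply Cdiff_id]]. }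
      assert (Hr : rect_cont r x (x + t * a) y (y + t * b)).
      { apply Ccont_rect; intros; apply Cdiff_sub; [apply Hq; unfold a, b in *; lra|].
        apply Cdiff_add; [apply Cdiff_const|apply Cdiff_mul; [apply Cdiff_const|apply Cdiff_id]]. }
      assert (E : rect_int q x (x + t * a) y (y + t * b) = rect_int r x (x + t * a) y (y + t * b)).
      { transitivity (rect_int (fun z => Cadd (Cadd c (Cmul d z)) (r z)) x (x + t * a) y (y + t * b)).
        - apply rect_int_ext; [lra|lra|intros z; unfold r; ring].
        - rewrite rect_int_add, rect_int_affine by (auto; lra); ring. }
      rewrite E.
      eapply Rle_trans.
      + apply (rect_int_bound r _ _ _ _ (eps * (t * (a + b)))); [lra|lra|exact Hr|].
        intros x' y' hx' hy'.
        set (h := Csub (Ipt x' y') z0).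
        assert (hb : Cmod h <= t * (a + b)).
        { eapply Rle_trans; [apply Cmod_le_re_im|]; unfold h, z0, Ipt; simpl.
          assert (Rabs (x' + - u) <= t * a) by (apply Rabs_le; clear -ux hx'; lra).
          assert (Rabs (y' + - v) <= t * b) by (apply Rabs_le; clear -vy hy'; lra).
          lra. }
        assert (hb' : Cmod h < de) by lra.
        specialize (Hde h hb').
        replace (r (Ipt x' y')) with (Csub (Csub (q (Cadd z0 h)) (q z0)) (Cmul d h)).
        * eapply Rle_trans; [exact Hde|apply Rmult_le_compat_l; lra].
        * replace (Cadd z0 h) with (Ipt x' y') by (unfold h; ring); unfold r, c, h; ring.
      + right; unfold K; ring. }
  replace (x0 + 1 * a) with x1 in B by (unfold a; ring).
  replace (y0 + 1 * b) with y1 in B by (unfold b; ring).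
  rewrite Rmult_1_r, Rmult_1_r in B; exact B. }
destruct (Rle_lt_or_eq_dec 0 _ (Cmod_nonneg (rect_int q x0 x1 y0 y1))) as [p|e]; [|auto].
set (m := Cmod (rect_int q x0 x1 y0 y1)) in *.
assert (Kp : 0 < 4 * ((a + b) * (a + b))) by nra.
set (K := 4 * ((a + b) * (a + b))) in *.
specialize (key (m / (2 * K)) ltac:(apply Rdiv_lt_0_compat; lra)).
replace (m / (2 * K) * K) with (m / 2) in key by (field; lra); lra.
Qed.

(** * Bounds at the centre of a square *)

Lemma Ipt_neq0 x y : x <> 0 -> Ipt x y <> C0.
Proof. intros h e; apply (f_equal re) in e; simpl in e; auto. Qed.

Lemma Cmod_Ipt_le x y : Cmod (Ipt x y) <= Rabs x + Rabs y.
Proof. exact (Cmod_le_re_im (Ipt x y)). Qed.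

(* A function on the square that is invariant under the rotation by i is controlled at the
   centre by its values on one side: Cauchy's formula over the four congruent rectangles that
   tile the annulus between two concentric squares. *)
Lemma rotation_invariant_bound (P : Cx -> Cx) b m : 0 < b ->
  (forall x y, - b <= x <= b -> - b <= y <= b -> Cdiff P (Ipt x y)) ->
  (forall z, P (Cmul Ci z) = P z) ->
  (forall y, - b <= y <= b -> Cmod (P (Ipt b y)) <= m) ->
  Cmod (P C0) <= 4 * m.
Proof.
intros hb HP Hrot Hm.
set (q := fun z => Cmul (P z) (Cinv z)).
assert (Hq : forall x y, x <> 0 -> - b <= x <= b -> - b <= y <= b -> Cdiff q (Ipt x y)).
{ intros x y nz hx hy; apply Cdiff_mul; [apply HP; assumption|apply Cdiff_inv, Ipt_neq0, nz]. }
assert (qrot : forall z, z <> C0 -> q (Cmul Ci z) = Copp (Cmul Ci (q z))).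
{ intros z nz; unfold q; rewrite Hrot.
  assert (i2 : Cmul Ci Ci = Copp C1) by cx.
  assert (ni : Ci <> C0) by (intros e; apply (f_equal im) in e; simpl in e; lra).
  transitivity (Cmul (P z) (Cmul (Cinv Ci) (Cinv z))); [f_equal; field; split; assumption|].
  replace (Cinv Ci) with (Copp Ci); [ring|].
  transitivity (Cmul (Copp (Cmul Ci Ci)) (Cinv Ci)); [field; assumption|rewrite i2; ring]. }
(* Since q(iz) = -i q(z), the form q dz is invariant under the quarter turn: the four sides of a
   centred square contribute the same amount, and one of them suffices. *)
set (J := fun r => CI (fun y => q (Ipt r y)) (- r) r).
assert (Hver : forall r lo hi, 0 < r <= b -> - b <= lo -> hi <= b ->
   forall t, lo <= t <= hi -> curve_cont (fun y => q (Ipt r y)) t).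
{ intros r lo hi hr h1 h2 t ht.
  apply (Cx_line_cont q (fun _ => r) (fun s => s)); [apply Cdiff_cont, Hq; lra|reg|reg]. }
assert (HJ : forall r, 0 < r < b -> J b = J r).
{ intros r hr.
  (* The quarter turn carries the bottom side of this rectangle to the part of the line x = r above
     height r, and the top side comes from the part of the line x = b below height -r. Goursat
     therefore leaves exactly i (J b - J r) = 0. *)
  assert (G : rect_int q r b (- r) b = C0).
  { apply goursat; try lra; intros x y hx hy; apply Hq; lra. }
  unfold rect_int in G.
  assert (A1 : CI (fun x => q (Ipt x (- r))) r b = Cmul Ci (CI (fun y => q (Ipt r y)) r b)).
  { rewrite <- CI_mul_l by (try lra; apply Hver; lra).
    apply CI_ext; [lra|intros t ht].
    replace (Ipt r t) with (Cmul Ci (Ipt t (- r))) by cx.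
    rewrite qrot by (apply Ipt_neq0; lra).
    replace (Cmul Ci (Copp (Cmul Ci (q (Ipt t (- r)))))) with (Cmul (Copp (Cmul Ci Ci)) (q (Ipt t (- r)))) by ring.
    replace (Copp (Cmul Ci Ci)) with C1 by cx; ring. }
  assert (A2 : CI (fun x => q (Ipt x b)) r b = Copp (Cmul Ci (CI (fun y => q (Ipt b y)) (- b) (- r)))).
  { rewrite <- (CI_opp_arg (fun y => q (Ipt b y))) by (try lra; apply Hver; lra).
    rewrite !Ropp_involutive.
    assert (Hc : forall t, r <= t <= b -> curve_cont (fun y => q (Ipt b (- y))) t).
    { intros t ht; apply (Cx_line_cont q (fun _ => b) (fun s => - s)); [apply Cdiff_cont, Hq; lra|reg|reg]. }
    replace (Copp _) with (Cmul (Copp Ci) (CI (fun y => q (Ipt b (- y))) r b)) by ring.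
    rewrite <- CI_mul_l by (try lra; exact Hc).
    apply CI_ext; [lra|intros t ht].
    replace (Ipt t b) with (Cmul Ci (Ipt b (- t))) by cx.
    rewrite qrot by (apply Ipt_neq0; lra); ring. }
  assert (A3 : J b = Cadd (CI (fun y => q (Ipt b y)) (- b) (- r)) (CI (fun y => q (Ipt b y)) (- r) b)).
  { unfold J; apply CI_chasles; try lra; apply Hver; lra. }
  assert (A4 : CI (fun y => q (Ipt r y)) (- r) b = Cadd (J r) (CI (fun y => q (Ipt r y)) r b)).
  { unfold J; apply CI_chasles; try lra; apply Hver; lra. }
  rewrite A1, A2, A4 in G.
  assert (G2 : Cmul Ci (Csub (J b) (J r)) = C0) by (rewrite A3, <- G; ring).
  destruct (Cmul_integral _ _ G2) as [e|e].
  - apply (f_equal im) in e; simpl in e; lra.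
  - transitivity (Cadd (Csub (J b) (J r)) (J r)); [ring|rewrite e; ring]. }
assert (Hinv : forall r y, 0 < r -> Cmod (Cinv (Ipt r y)) <= / r).
{ intros r y hr; rewrite Cmod_inv by (apply Ipt_neq0; lra).
  apply Rinv_le_contravar; [assumption|].
  eapply Rle_trans; [|exact (Rabs_re_le (Ipt r y))]; simpl; apply Rle_abs. }
assert (JB : Cmod (J b) <= 4 * m).
{ unfold J; eapply Rle_trans.
  - apply (CI_bound _ _ _ (m * / b)); [lra|apply Hver; lra|].
    intros t ht; unfold q; rewrite Cmod_mul.
    apply Rmult_le_compat; [apply Cmod_nonneg|apply Cmod_nonneg|apply Hm; lra|apply Hinv; lra].
  - right; field; lra. }
apply Rnot_lt_le; intros hlt.
set (eta := (Cmod (P C0) - 4 * m) / 8).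
assert (etap : 0 < eta) by (unfold eta; lra).
assert (P0c : Ccont P C0) by (apply Cdiff_cont, (HP 0 0); lra).
destruct (P0c eta etap) as [d [dp Hd]].
set (r := Rmin (b / 2) (d / 3)).
assert (rp : 0 < r) by (apply Rmin_pos; lra).
assert (rb : r <= b / 2) by apply Rmin_l.
assert (rd : r <= d / 3) by apply Rmin_r.
assert (E : J r = Cadd (Cmul (P C0) (CI (fun y => Cinv (Ipt r y)) (- r) r))
                       (CI (fun y => Cmul (Csub (P (Ipt r y)) (P C0)) (Cinv (Ipt r y))) (- r) r)).
{ assert (c1 : forall t, - r <= t <= r -> curve_cont (fun y => Cinv (Ipt r y)) t).
  { intros t ht; apply (Cx_line_cont Cinv (fun _ => r) (fun s => s)); [|reg|reg].
    apply Cdiff_cont, Cdiff_inv, Ipt_neq0; lra. }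
  rewrite <- CI_mul_l by (try lra; exact c1).
  rewrite <- CI_add; [|lra| |].
  - apply CI_ext; [lra|intros t ht; unfold q; ring].
  - intros t ht; apply (Cx_line_cont (fun z => Cmul (P C0) (Cinv z)) (fun _ => r) (fun s => s)); [|reg|reg].
    apply Cdiff_cont, Cdiff_mul; [apply Cdiff_const|apply Cdiff_inv, Ipt_neq0; lra].
  - intros t ht; apply (Cx_line_cont (fun z => Cmul (Csub (P z) (P C0)) (Cinv z)) (fun _ => r) (fun s => s)); [|reg|reg].
    apply Cdiff_cont, Cdiff_mul; [apply Cdiff_sub; [apply HP; lra|apply Cdiff_const]|apply Cdiff_inv, Ipt_neq0; lra]. }
assert (B2 : Cmod (CI (fun y => Cmul (Csub (P (Ipt r y)) (P C0)) (Cinv (Ipt r y))) (- r) r) <= 4 * eta).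
{ eapply Rle_trans.
  - apply (CI_bound _ _ _ (eta * / r)); [lra| |].
    + intros t ht; apply (Cx_line_cont (fun z => Cmul (Csub (P z) (P C0)) (Cinv z)) (fun _ => r) (fun s => s)); [|reg|reg].
      apply Cdiff_cont, Cdiff_mul; [apply Cdiff_sub; [apply HP; lra|apply Cdiff_const]|apply Cdiff_inv, Ipt_neq0; lra].
    + intros t ht; rewrite Cmod_mul.
      apply Rmult_le_compat; [apply Cmod_nonneg|apply Cmod_nonneg| |apply Hinv; lra].
      apply Rlt_le, Hd; replace (Csub (Ipt r t) C0) with (Ipt r t) by cx.
      eapply Rle_lt_trans; [apply Cmod_Ipt_le|].
      rewrite (Rabs_right r) by lra; assert (Rabs t <= r) by (apply Rabs_le; lra); lra.
  - right; field; lra. }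
(* The real part of 1/(r + iy) is r/(r^2 + y^2), at least 1/(2r) on a segment of length 2r; this
   crude bound replaces the exact value PI/2. *)
assert (B1 : 1 <= Cmod (CI (fun y => Cinv (Ipt r y)) (- r) r)).
{ eapply Rle_trans; [|apply Rabs_re_le]; eapply Rle_trans; [|apply Rle_abs]; simpl.
  replace 1 with (RInt (fun _ => / (2 * r)) (- r) r).
  2:{ rewrite (RInt_const (V := R_CompleteNormedModule)); unfold scal; simpl; unfold mult; simpl; field; lra. }
  apply RInt_le; [lra|apply ex_RInt_const| |].
  - apply (cont_seg_ex (fun y => Cinv (Ipt r y))); [lra|].
    intros t ht; apply (Cx_line_cont Cinv (fun _ => r) (fun s => s)); [|reg|reg].
    apply Cdiff_cont, Cdiff_inv, Ipt_neq0; lra.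
  - intros t ht; unfold Cinv, Cnorm2; simpl.
    assert (t2 : t * t <= r * r) by nra.
    assert (s0 : 0 < r * r) by nra; assert (s1 : 0 < r * r + t * t) by nra.
    apply Rmult_le_reg_r with (2 * r * (r * r + t * t)); [apply Rmult_lt_0_compat; lra|].
    field_simplify; nra. }
assert (C : Cmod (P C0) <= Cmod (J r) + 4 * eta).
{ apply Rle_trans with (Cmod (P C0) * Cmod (CI (fun y => Cinv (Ipt r y)) (- r) r)).
  - rewrite <- (Rmult_1_r (Cmod (P C0))) at 1; apply Rmult_le_compat_l; [apply Cmod_nonneg|assumption].
  - rewrite <- Cmod_mul.
    set (X := CI (fun y => Cinv (Ipt r y)) (- r) r) in *.
    set (Y := CI (fun y => Cmul (Csub (P (Ipt r y)) (P C0)) (Cinv (Ipt r y))) (- r) r) in *.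
    replace (Cmul (P C0) X) with (Csub (J r) Y) by (rewrite E; ring).
    eapply Rle_trans; [apply Cmod_sub_triangle|lra]. }
rewrite <- (HJ r) in C by lra.
unfold eta in C; lra.
Qed.

(** P multiplies K at the four points obtained from p + z by quarter turns about p. It is invariant
    under z -> iz, has P(0) = K(p)^4, and when Re z = b its factor at p - iz lies on the bottom
    side, where K is small. Smallness on one side of a square thus controls the centre, in the
    manner of a two-constants theorem. *)
Lemma square_bound (K : Cx -> Cx) x0 y0 b M delta : 0 < b -> 0 <= delta ->
  (forall x y, x0 - b <= x <= x0 + b -> y0 - b <= y <= y0 + b -> Cdiff K (Ipt x y)) ->
  (forall x y, x0 - b <= x <= x0 + b -> y0 - b <= y <= y0 + b -> Cmod (K (Ipt x y)) <= M) ->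
  (forall x, x0 - b <= x <= x0 + b -> Cmod (K (Ipt x (y0 - b))) <= delta) ->
  Cmod (K (Ipt x0 y0)) ^ 4 <= 4 * (delta * M ^ 3).
Proof.
intros hb hd HK HM Hdel.
set (p := Ipt x0 y0).
set (P := fun z => Cmul (Cmul (K (Cadd p z)) (K (Cadd p (Cmul Ci z))))
                       (Cmul (K (Csub p z)) (K (Csub p (Cmul Ci z))))).
assert (i2 : forall z, Cmul Ci (Cmul Ci z) = Copp z) by (intros; cx).
assert (E : P C0 = Cmul (Cmul (K p) (K p)) (Cmul (K p) (K p))).
{ unfold P; do 2 f_equal; f_equal; cx. }
replace (Cmod (K p) ^ 4) with (Cmod (P C0)) by (rewrite E, !Cmod_mul; ring).
apply (rotation_invariant_bound P b); auto.
- intros x y hx hy; unfold P.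
  assert (lin : forall c, Cdiff (fun z => Cadd p (Cmul c z)) (Ipt x y)).
  { intros c; apply Cdiff_add; [apply Cdiff_const|apply Cdiff_mul; [apply Cdiff_const|apply Cdiff_id]]. }
  assert (lin' : forall c, Cdiff (fun z => Csub p (Cmul c z)) (Ipt x y)).
  { intros c; apply Cdiff_sub; [apply Cdiff_const|apply Cdiff_mul; [apply Cdiff_const|apply Cdiff_id]]. }
  repeat apply Cdiff_mul.
  + apply (Cdiff_comp K (fun z => Cadd p z)); [apply Cdiff_add; [apply Cdiff_const|apply Cdiff_id]|].
    replace (Cadd p (Ipt x y)) with (Ipt (x0 + x) (y0 + y)) by cx; apply HK; lra.
  + apply (Cdiff_comp K (fun z => Cadd p (Cmul Ci z))); [apply lin|].
    replace (Cadd p (Cmul Ci (Ipt x y))) with (Ipt (x0 - y) (y0 + x)) by cx; apply HK; lra.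
  + apply (Cdiff_comp K (fun z => Csub p z)); [apply Cdiff_sub; [apply Cdiff_const|apply Cdiff_id]|].
    replace (Csub p (Ipt x y)) with (Ipt (x0 - x) (y0 - y)) by cx; apply HK; lra.
  + apply (Cdiff_comp K (fun z => Csub p (Cmul Ci z))); [apply lin'|].
    replace (Csub p (Cmul Ci (Ipt x y))) with (Ipt (x0 + y) (y0 - x)) by cx; apply HK; lra.
- intros z; unfold P; rewrite !i2.
  replace (Cadd p (Copp z)) with (Csub p z) by ring.
  replace (Csub p (Copp z)) with (Cadd p z) by ring; ring.
- intros y hy; unfold P; rewrite !Cmod_mul.
  replace (Cadd p (Ipt b y)) with (Ipt (x0 + b) (y0 + y)) by cx.
  replace (Cadd p (Cmul Ci (Ipt b y))) with (Ipt (x0 - y) (y0 + b)) by cx.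
  replace (Csub p (Ipt b y)) with (Ipt (x0 - b) (y0 - y)) by cx.
  replace (Csub p (Cmul Ci (Ipt b y))) with (Ipt (x0 + y) (y0 - b)) by cx.
  assert (a1 := HM (x0 + b) (y0 + y) ltac:(lra) ltac:(lra)).
  assert (a2 := HM (x0 - y) (y0 + b) ltac:(lra) ltac:(lra)).
  assert (a3 := HM (x0 - b) (y0 - y) ltac:(lra) ltac:(lra)).
  assert (a4 := Hdel (x0 + y) ltac:(lra)).
  replace (delta * M ^ 3) with ((M * M) * (M * delta)) by ring.
  apply Rmult_le_compat; try (apply Rmult_le_pos; apply Cmod_nonneg);
    apply Rmult_le_compat; try apply Cmod_nonneg; assumption.
Qed.

(** * Propagation of smallness through a strip *)

Section Propagation.
Variable KK : (Cx -> Cx) -> Prop.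
Hypothesis KKdiff : forall K, KK K -> forall x y, - PI < y < PI -> Cdiff K (Ipt x y).
Hypothesis KKbound : forall X c, 0 <= c < PI -> exists M, 0 < M /\ forall K, KK K ->
  forall x y, - X <= x <= X -> 0 <= y <= c -> Cmod (K (Ipt x y)) <= M.

(** The order of quantifiers is the point: Y and delta depend on the family only and are fixed
    before the member K. *)
Definition controlled (c : R) : Prop := forall X eps, 0 < eps -> exists Y delta, 0 < delta /\
  forall K, KK K -> (forall x, - Y <= x <= Y -> Cmod (K (Ipt x 0)) <= delta) ->
    forall x y, - X <= x <= X -> 0 <= y <= c -> Cmod (K (Ipt x y)) <= eps.

(** [square_bound] on the square centred at (x, y) whose bottom side lies at height c. For y up to c
    + (PI - c)/3 its top reaches at most c + 2 (PI - c)/3, still inside the strip, and its half side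
    is below PI, hence the widening of X by PI. *)
Lemma controlled_step c : 0 <= c < PI -> controlled c -> controlled (c + (PI - c) / 3).
Proof.
intros hc H X eps he.
destruct (KKbound (X + PI) (c + 2 * ((PI - c) / 3)) ltac:(lra)) as [M [Mp HM]].
assert (M3 : 0 < M ^ 3) by (apply pow_lt; assumption).
assert (e4 : 0 < eps ^ 4) by (apply pow_lt; assumption).
(* The first entry serves heights up to c; the second makes 4 d1 M^3 at most eps^4. *)
set (d1 := Rmin eps (eps ^ 4 / (4 * M ^ 3))).
assert (d1p : 0 < d1) by (apply Rmin_pos; [assumption|apply Rdiv_lt_0_compat; lra]).
destruct (H (X + PI) d1 d1p) as [Y [delta [dp Hd]]].
exists Y, delta; split; [assumption|intros K hK hdel x y hx hy].
specialize (Hd K hK hdel).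
destruct (Rle_lt_dec y c) as [yc|yc].
{ eapply Rle_trans; [apply Hd; lra|apply Rmin_l]. }
assert (S : Cmod (K (Ipt x y)) ^ 4 <= 4 * (d1 * M ^ 3)).
{ apply (square_bound K x y (y - c)); try lra.
  - intros; apply KKdiff; [assumption|lra].
  - intros; apply HM; [assumption|lra|lra].
  - intros u hu; replace (y - (y - c)) with c by ring; apply Hd; lra. }
assert (S2 : Cmod (K (Ipt x y)) ^ 4 <= eps ^ 4).
{ eapply Rle_trans; [exact S|].
  assert (h : d1 <= eps ^ 4 / (4 * M ^ 3)) by apply Rmin_r.
  apply Rmult_le_compat_r with (r := 4 * M ^ 3) in h; [|lra].
  replace (eps ^ 4 / (4 * M ^ 3) * (4 * M ^ 3)) with (eps ^ 4) in h by (field; lra); lra. }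
apply Rnot_lt_le; intros hlt.
pose proof (Cmod_nonneg (K (Ipt x y))) as kn; set (k := Cmod (K (Ipt x y))) in *.
assert (a1 : eps * eps < k * k) by nra.
assert (a2 : (eps * eps) * (eps * eps) < (k * k) * (k * k)) by (apply Rmult_le_0_lt_compat; nra).
simpl in S2; lra.
Qed.

(** Each step keeps two thirds of the distance to PI, so the heights PI - PI (2/3)^n exhaust the
    strip. At n = 0 only the real axis remains, where control is the hypothesis itself. *)
Lemma controlled_strip c : 0 <= c < PI -> controlled c.
Proof.
intros hc.
assert (pw : forall n, 0 < (2 / 3) ^ n) by (intros; apply pow_lt; lra).
assert (pw1 : forall n, (2 / 3) ^ n <= 1).
{ induction n; simpl; [lra|]; pose proof (pw n); nra. }
assert (C : forall n, controlled (PI - PI * (2 / 3) ^ n)).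
{ induction n as [|n IH].
  - simpl; intros X eps he; exists X, eps; split; [assumption|intros K hK h x y hx hy].
    replace y with 0 by lra; apply h; assumption.
  - replace (PI - PI * (2 / 3) ^ S n) with
      ((PI - PI * (2 / 3) ^ n) + (PI - (PI - PI * (2 / 3) ^ n)) / 3) by (simpl; field).
    apply controlled_step; [|assumption].
    pose proof PI_RGT_0; pose proof (pw n); pose proof (pw1 n); split; nra. }
destruct (pow_lt_1_zero (2 / 3) ltac:(rewrite Rabs_right; lra) ((PI - c) / PI)) as [N HN].
{ pose proof PI_RGT_0; apply Rdiv_lt_0_compat; lra. }
specialize (HN N (le_n N)); rewrite Rabs_right in HN by (apply Rle_ge, Rlt_le, pw).
assert (cN : c <= PI - PI * (2 / 3) ^ N).
{ pose proof PI_RGT_0; apply Rmult_lt_compat_l with (r := PI) in HN; [|assumption].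
  replace (PI * ((PI - c) / PI)) with (PI - c) in HN by (field; lra); lra. }
intros X eps he; destruct (C N X eps he) as (Y & delta & dp & Hd).
exists Y, delta; split; [assumption|intros K hK h x y hx hy; apply Hd; auto; lra].
Qed.
End Propagation.

(** * Exponential, logarithm and the kernels on the slit plane *)

Definition cexp (w : Cx) : Cx := mkCx (exp (re w) * cos (im w)) (exp (re w) * sin (im w)).

Lemma cexp_add z w : cexp (Cadd z w) = Cmul (cexp z) (cexp w).
Proof. apply Cx_ext; unfold cexp; simpl; rewrite exp_plus, ?cos_plus, ?sin_plus; ring. Qed.

Lemma derivable_pt_lim_littleo f l : derivable_pt_lim f 0 l -> forall eps, 0 < eps ->
  exists delta, 0 < delta /\ forall h, Rabs h < delta -> Rabs (f h - f 0 - l * h) <= eps * Rabs h.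
Proof.
intros H eps he; destruct (H eps he) as [d Hd]; exists d; split; [apply cond_pos|intros h hh].
destruct (Req_dec h 0) as [->|nz].
{ replace (f 0 - f 0 - l * 0) with 0 by ring; rewrite Rabs_R0; lra. }
specialize (Hd h nz hh); rewrite Rplus_0_l in Hd.
replace (f h - f 0 - l * h) with (((f h - f 0) / h - l) * h) by (field; assumption).
rewrite Rabs_mult; apply Rmult_le_compat_r; [apply Rabs_pos|lra].
Qed.

(** Differentiability at 0, from the real derivatives of exp, cos and sin there, spreads to every
    point by [cexp_add]. *)
Lemma Cdiff_cexp z : Cdiff cexp z.
Proof.
assert (H0 : forall eps, 0 < eps -> exists delta, 0 < delta /\ forall h, Cmod h < delta ->
   Cmod (Csub (Csub (cexp h) C1) h) <= eps * Cmod h).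
{ intros eps he.
  assert (e8 : 0 < Rmin 1 (eps / 8)) by (apply Rmin_pos; lra).
  set (e := Rmin 1 (eps / 8)) in *.
  assert (e1 : e <= 1) by apply Rmin_l; assert (e2 : e <= eps / 8) by apply Rmin_r.
  destruct (derivable_pt_lim_littleo exp 1 derivable_pt_lim_exp_0 e e8) as [a [ap Ha]].
  assert (dc : derivable_pt_lim cos 0 0).
  { replace 0 with (- sin 0) at 2 by (rewrite sin_0; ring); apply derivable_pt_lim_cos. }
  assert (ds : derivable_pt_lim sin 0 1).
  { rewrite <- cos_0; apply derivable_pt_lim_sin. }
  destruct (derivable_pt_lim_littleo cos 0 dc e e8) as [b [bp Hb]].
  destruct (derivable_pt_lim_littleo sin 1 ds e e8) as [c [cp Hc]].
  exists (Rmin (Rmin a b) (Rmin c e)); split; [repeat apply Rmin_pos; try assumption; lra|intros h hh].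
  assert (h1 : Cmod h < a) by (eapply Rlt_le_trans; [exact hh|eapply Rle_trans; [apply Rmin_l|apply Rmin_l]]).
  assert (h2 : Cmod h < b) by (eapply Rlt_le_trans; [exact hh|eapply Rle_trans; [apply Rmin_l|apply Rmin_r]]).
  assert (h3 : Cmod h < c) by (eapply Rlt_le_trans; [exact hh|eapply Rle_trans; [apply Rmin_r|apply Rmin_l]]).
  assert (h4 : Cmod h < e) by (eapply Rlt_le_trans; [exact hh|eapply Rle_trans; [apply Rmin_r|apply Rmin_r]]).
  pose proof (Rabs_re_le h) as hr; pose proof (Rabs_im_le h) as hi.
  specialize (Ha (re h) ltac:(lra)); specialize (Hb (im h) ltac:(lra)); specialize (Hc (im h) ltac:(lra)).
  rewrite exp_0 in Ha; rewrite cos_0 in Hb; rewrite sin_0 in Hc.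
  eapply Rle_trans; [apply Cmod_le_re_im|unfold cexp; simpl].
  set (x := re h) in *; set (y := im h) in *; set (m := Cmod h) in *.
  assert (mn : 0 <= m) by apply Cmod_nonneg.
  set (E := exp x) in *; set (Cc := cos y) in *; set (S := sin y) in *.
  set (u := E - 1 - 1 * x) in *; set (v := Cc - 1 - 0 * y) in *; set (s := S - 0 - 1 * y) in *.
  assert (hu : Rabs u <= e * m) by (eapply Rle_trans; [exact Ha|apply Rmult_le_compat_l; lra]).
  assert (hv : Rabs v <= e * m) by (eapply Rle_trans; [exact Hb|apply Rmult_le_compat_l; lra]).
  assert (hs : Rabs s <= e * m) by (eapply Rle_trans; [exact Hc|apply Rmult_le_compat_l; lra]).
  assert (cC : Rabs Cc <= 1) by (apply Rabs_le, COS_bound).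
  assert (cS : Rabs S <= 1) by (apply Rabs_le, SIN_bound).
  assert (m1 : e * m <= m) by nra.
  assert (hx1 : Rabs (u + x) <= 2 * m) by (eapply Rle_trans; [apply Rabs_triang|lra]).
  assert (hy1 : Rabs (s + y) <= 2 * m) by (eapply Rle_trans; [apply Rabs_triang|lra]).
  assert (me : m * m <= e * m) by nra.
  replace (E * Cc + - (1) + - x) with (u * Cc + (v + x * v)) by (unfold u, v; ring).
  replace (E * S + - 0 + - y) with ((u + x) * (s + y) + s) by (unfold u, s; ring).
  assert (T1 : Rabs (u * Cc + (v + x * v)) <= 3 * (e * m)).
  { eapply Rle_trans; [apply Rabs_triang|]; rewrite Rabs_mult.
    assert (Rabs (v + x * v) <= 2 * (e * m)).
    { eapply Rle_trans; [apply Rabs_triang|]; rewrite Rabs_mult.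
      assert (Rabs x * Rabs v <= 1 * (e * m)) by (apply Rmult_le_compat; try apply Rabs_pos; lra); lra. }
    assert (Rabs u * Rabs Cc <= (e * m) * 1) by (apply Rmult_le_compat; try apply Rabs_pos; lra); lra. }
  assert (T2 : Rabs ((u + x) * (s + y) + s) <= 5 * (e * m)).
  { eapply Rle_trans; [apply Rabs_triang|]; rewrite Rabs_mult.
    assert (Rabs (u + x) * Rabs (s + y) <= (2 * m) * (2 * m)) by (apply Rmult_le_compat; try apply Rabs_pos; lra); lra. }
  assert (8 * (e * m) <= eps * m) by nra.
  lra. }
exists (cexp z); intros eps he.
pose proof (Cmod_nonneg (cexp z)) as zn.
destruct (H0 (eps / (Cmod (cexp z) + 1))) as [d [dp Hd]]; [apply Rdiv_lt_0_compat; lra|].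
exists d; split; [assumption|intros h hh; specialize (Hd h hh)].
rewrite cexp_add.
replace (Csub _ _) with (Cmul (cexp z) (Csub (Csub (cexp h) C1) h)) by ring.
rewrite Cmod_mul.
apply Rle_trans with ((Cmod (cexp z) + 1) * (eps / (Cmod (cexp z) + 1) * Cmod h)).
- apply Rmult_le_compat; try apply Cmod_nonneg; lra.
- right; field; lra.
Qed.

Lemma Cmod_cexp w : Cmod (cexp w) = exp (re w).
Proof.
unfold Cmod, Cnorm2, cexp; simpl.
replace (exp (re w) * cos (im w) * (exp (re w) * cos (im w)) + exp (re w) * sin (im w) * (exp (re w) * sin (im w)))
  with (exp (re w) * exp (re w)).
- apply sqrt_square, Rlt_le, exp_pos.
- pose proof (sin2_cos2 (im w)) as h; unfold Rsqr in h.
  transitivity (exp (re w) * exp (re w) * (sin (im w) * sin (im w) + cos (im w) * cos (im w))); [rewrite h|]; ring.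
Qed.

Lemma in_D_cexp w : - PI < im w < PI -> in_D (cexp w).
Proof.
intros hw [h1 h2]; unfold cexp in *; simpl in *.
pose proof (exp_pos (re w)).
assert (s : sin (im w) = 0) by (apply Rmult_integral in h1; destruct h1; lra).
assert (i0 : im w = 0).
{ destruct (Rtotal_order (im w) 0) as [n|[e|p]]; [|exact e|].
  - assert (0 < sin (- im w)) by (apply sin_gt_0; lra); rewrite sin_neg in *; lra.
  - assert (0 < sin (im w)) by (apply sin_gt_0; lra); lra. }
rewrite i0, cos_0 in h2; lra.
Qed.

(** Half-angle form of the principal argument: a single formula on the whole slit plane, where re z
    + |z| > 0, with values strictly between -PI and PI. *)
Definition carg (z : Cx) : R := 2 * atan (im z / (re z + Cmod z)).
Definition clog (z : Cx) : Cx := mkCx (ln (Cmod z)) (carg z).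

Lemma in_D_denom z : in_D z -> 0 < re z + Cmod z.
Proof.
intros h; pose proof (Cmod_nonneg z) as n; pose proof (Cmod_sqr z) as s; unfold Cnorm2 in s.
destruct (Rle_lt_dec (re z) 0) as [l|l]; [|lra].
assert (im z <> 0) by (intros e; apply h; auto).
nra.
Qed.

Lemma in_D_neq0 z : in_D z -> z <> C0.
Proof. intros h e; apply h; rewrite e; simpl; lra. Qed.

Lemma cexp_clog z : in_D z -> cexp (clog z) = z.
Proof.
intros h; pose proof (in_D_denom z h) as d.
pose proof (Cmod_pos z (in_D_neq0 z h)) as mp; pose proof (Cmod_sqr z) as s; unfold Cnorm2 in s.
unfold cexp, clog, carg; simpl; rewrite exp_ln by assumption.
set (m := Cmod z) in *; set (x := re z) in *; set (y := im z) in *.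
set (t := y / (x + m)).
assert (q : 0 < 1 + t ^ 2) by (simpl; nra).
assert (sq : sqrt (1 + t ^ 2) * sqrt (1 + t ^ 2) = 1 + t ^ 2) by (apply sqrt_sqrt; lra).
assert (sp : 0 < sqrt (1 + t ^ 2)) by (apply sqrt_lt_R0; assumption).
assert (ct : cos (atan t) = / sqrt (1 + t ^ 2)).
{ rewrite cos_atan; replace (t²) with (t ^ 2) by (unfold Rsqr; ring); field; lra. }
assert (st : sin (atan t) = t / sqrt (1 + t ^ 2)).
{ rewrite sin_atan; replace (t²) with (t ^ 2) by (unfold Rsqr; ring); reflexivity. }
assert (tm : 1 + t ^ 2 = 2 * m / (x + m)).
{ unfold t; simpl; apply Rmult_eq_reg_r with ((x + m) * (x + m)); [|nra].
  field_simplify; [|lra|lra]; nra. }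
rewrite cos_2a, sin_2a, ct, st.
replace (/ sqrt (1 + t ^ 2) * / sqrt (1 + t ^ 2)) with (/ (1 + t ^ 2)) by (rewrite <- sq at 1; field; lra).
replace (t / sqrt (1 + t ^ 2) * (t / sqrt (1 + t ^ 2))) with (t * t / (1 + t ^ 2)) by (rewrite <- sq at 1; field; lra).
replace (2 * (t / sqrt (1 + t ^ 2)) * / sqrt (1 + t ^ 2)) with (2 * t / (1 + t ^ 2)) by (rewrite <- sq at 1; field; lra).
assert (tt : t * t = 2 * m / (x + m) - 1) by (simpl in tm; lra).
apply Cx_ext; simpl; rewrite ?tt; simpl in tm; rewrite tm; fold x; fold y; unfold t.
- field_simplify; lra.
- field; lra.
Qed.

Lemma carg_bound z : - PI < carg z < PI.
Proof. unfold carg; pose proof (atan_bound (im z / (re z + Cmod z))); lra. Qed.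

Definition kern (t : R) (z : Cx) : Cx := Cmul (RtoC (1 + t)) (Cmul z (Cinv (Cadd z (RtoC t)))).

Fixpoint combC (l : list (R * R)) (z : Cx) : Cx :=
  match l with
  | nil => C0
  | (w, t) :: l' => Cadd (Cmul (RtoC w) (kern t z)) (combC l' z)
  end.

Fixpoint wsum (l : list (R * R)) : R :=
  match l with nil => 0 | (w, _) :: l' => w + wsum l' end.

Definition weights_ok (l : list (R * R)) : Prop := List.Forall (fun p => 0 <= fst p /\ 0 < snd p) l.

Lemma in_D_add_pos z t : in_D z -> 0 < t -> Cadd z (RtoC t) <> C0.
Proof.
intros h tp e; apply h; split.
- apply (f_equal im) in e; simpl in e; lra.
- apply (f_equal re) in e; simpl in e; lra.
Qed.

Lemma Cdiff_kern t z : in_D z -> 0 < t -> Cdiff (kern t) z.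
Proof.
intros h tp; unfold kern.
apply Cdiff_mul; [apply Cdiff_const|apply Cdiff_mul; [apply Cdiff_id|]].
apply (Cdiff_comp Cinv (fun z => Cadd z (RtoC t))).
- apply Cdiff_add; [apply Cdiff_id|apply Cdiff_const].
- apply Cdiff_inv, in_D_add_pos; assumption.
Qed.

Lemma Cdiff_combC l z : weights_ok l -> in_D z -> Cdiff (combC l) z.
Proof.
induction 1 as [|[w t] l [hw ht] _ IH]; intros hz; simpl; [apply Cdiff_const|].
apply Cdiff_add; [|apply IH; assumption].
apply Cdiff_mul; [apply Cdiff_const|apply Cdiff_kern; assumption].
Qed.

(** The bound is free of t. The hypothesis says that adding t does not cancel z; with (1 + t)^2 <= 2
    (1 + t^2) it bounds the square of the modulus, and the added 1 allows passing from the square to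
    the modulus. *)
Lemma kern_bound t z k : 0 < t -> 0 < k -> in_D z ->
  k * (Cnorm2 z + t * t) <= Cnorm2 (Cadd z (RtoC t)) ->
  Cmod (kern t z) <= 1 + 2 * (1 + Cnorm2 z) / k.
Proof.
intros tp kp hz H.
assert (nz := in_D_add_pos z t hz tp).
pose proof (Cnorm2_pos _ nz) as n1; pose proof (Cnorm2_nonneg z) as n0.
set (N := Cnorm2 z) in *; set (D := Cnorm2 (Cadd z (RtoC t))) in *.
assert (B0 : 0 < 2 * (1 + N) / k) by (apply Rdiv_lt_0_compat; lra).
assert (E : Cnorm2 (kern t z) = (1 + t) * (1 + t) * (N / D)).
{ unfold kern; rewrite !Cnorm2_mul.
  assert (i : Cnorm2 (Cinv (Cadd z (RtoC t))) = / D).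
  { unfold D; apply Rmult_eq_reg_r with (Cnorm2 (Cadd z (RtoC t))); [|unfold D in n1; lra].
    rewrite <- Cnorm2_mul, Cinv_l by assumption.
    rewrite Rinv_l by (unfold D in n1; lra); unfold Cnorm2; simpl; ring. }
  rewrite i; unfold N, Rdiv; replace (Cnorm2 (RtoC (1 + t))) with ((1 + t) * (1 + t)) by (unfold Cnorm2; simpl; ring); ring. }
assert (le : Cnorm2 (kern t z) <= 2 * (1 + N) / k).
{ rewrite E.
  apply Rmult_le_reg_r with (k * D); [apply Rmult_lt_0_compat; assumption|].
  replace ((1 + t) * (1 + t) * (N / D) * (k * D)) with ((1 + t) * (1 + t) * N * k) by (field; lra).
  replace (2 * (1 + N) / k * (k * D)) with (2 * (1 + N) * D) by (field; lra).
  apply Rle_trans with (2 * (1 + N) * (k * (N + t * t))); [|apply Rmult_le_compat_l; lra].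
  assert (a : (1 + t) * (1 + t) * N <= 2 * (1 + N) * (N + t * t)).
  { apply Rle_trans with (2 * (1 + t * t) * N); [apply Rmult_le_compat_r; [assumption|]|].
    { pose proof (Rle_0_sqr (t - 1)) as sq; unfold Rsqr in sq; lra. }
    pose proof (Rle_0_sqr t) as st; pose proof (Rle_0_sqr N) as sN; unfold Rsqr in st, sN; lra. }
  replace (2 * (1 + N) * (k * (N + t * t))) with (2 * (1 + N) * (N + t * t) * k) by ring.
  apply Rmult_le_compat_r; lra. }
apply Cmod_le_sqr; [lra|]; nra.
Qed.

Lemma combC_bound l z B : weights_ok l -> wsum l = 1 -> (forall t, 0 < t -> Cmod (kern t z) <= B) ->
  Cmod (combC l z) <= B.
Proof.
intros hw h1 HB.
assert (G : Cmod (combC l z) <= wsum l * B).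
{ clear h1; induction hw as [|[w t] l [a b] _ IH]; simpl; [rewrite Cmod_0; lra|].
  eapply Rle_trans; [apply Cmod_triangle|]; rewrite Cmod_mul, Cmod_RtoC; simpl in a, b.
  rewrite Rabs_right by lra; rewrite Rmult_plus_distr_r; apply Rplus_le_compat; [|assumption].
  apply Rmult_le_compat_l; [assumption|apply HB; assumption]. }
rewrite h1 in G; lra.
Qed.

(** The uniformity in l is what makes the differences F - [combC l] a family with common bounds, as
    the propagation argument requires. *)
Lemma combC_strip_bound X c : 0 <= c < PI -> exists M, 0 < M /\ forall l, weights_ok l -> wsum l = 1 ->
  forall w, Rabs (re w) <= X -> Rabs (im w) <= c -> Cmod (combC l (cexp w)) <= M.
Proof.
intros hc.
assert (cm : -1 < cos c).
{ destruct (Req_dec c 0) as [->|nz]; [rewrite cos_0; lra|].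
  rewrite <- cos_PI; apply cos_decreasing_1; lra. }
(* For z of modulus r and argument at most c in absolute value, |z + t|^2 >= r^2 + t^2 + 2 r t cos c
   >= k (r^2 + t^2), the last step by r^2 + t^2 >= 2 r t. *)
set (k := Rmin 1 (1 + cos c)).
assert (kp : 0 < k) by (apply Rmin_pos; lra).
exists (1 + 2 * (1 + exp X * exp X) / k); split.
{ pose proof (exp_pos X); assert (0 < 2 * (1 + exp X * exp X) / k) by (apply Rdiv_lt_0_compat; nra); lra. }
intros l hw h1 w hx hy; apply combC_bound; auto; intros t tp.
assert (wi : - PI < im w < PI) by (apply Rabs_le_between in hy; lra).
assert (cw : cos c <= cos (im w)).
{ destruct (Rle_dec 0 (im w)) as [p|n].
  - rewrite Rabs_right in hy by lra; apply cos_decr_1; lra.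
  - rewrite Rabs_left in hy by lra; rewrite <- (cos_neg (im w)); apply cos_decr_1; lra. }
assert (xX : exp (re w) <= exp X).
{ apply Rabs_le_between in hx; destruct (Rle_lt_or_eq_dec (re w) X) as [a|a]; [lra|apply Rlt_le, exp_increasing, a|rewrite a; lra]. }
assert (nw : Cnorm2 (cexp w) = exp (re w) * exp (re w)) by (rewrite <- Cmod_sqr, Cmod_cexp; reflexivity).
pose proof (exp_pos (re w)) as ep.
eapply Rle_trans.
- apply (kern_bound t (cexp w) k tp kp (in_D_cexp w wi)).
  assert (e : Cnorm2 (Cadd (cexp w) (RtoC t)) = Cnorm2 (cexp w) + 2 * t * (exp (re w) * cos (im w)) + t * t)
    by (unfold Cnorm2, cexp; simpl; ring).
  rewrite e, nw; set (r := exp (re w)) in *.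
  assert (k1 : k <= 1) by apply Rmin_l; assert (k2 : k <= 1 + cos c) by apply Rmin_r.
  assert (rt : 0 < r * t) by (apply Rmult_lt_0_compat; assumption).
  assert (a : 0 <= (r * t) * (cos (im w) - cos c)) by (apply Rmult_le_pos; lra).
  assert (b : 0 <= (r * t) * (cos c - (k - 1))) by (apply Rmult_le_pos; lra).
  assert (d : 0 <= (1 - k) * ((r - t) * (r - t)))
    by (apply Rmult_le_pos; [lra|exact (Rle_0_sqr (r - t))]).
  lra.
- apply Rplus_le_compat_l; unfold Rdiv; apply Rmult_le_compat_r; [apply Rlt_le, Rinv_0_lt_compat, kp|].
  rewrite nw; nra.
Qed.

Lemma Ccont_bounded_rect (q : Cx -> Cx) x0 x1 y0 y1 : x0 < x1 -> y0 < y1 ->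
  rect_cont q x0 x1 y0 y1 ->
  exists M, 0 < M /\ forall x y, x0 <= x <= x1 -> y0 <= y <= y1 -> Cmod (q (Ipt x y)) <= M.
Proof.
intros hx hy H; set (a := x1 - x0); set (b := y1 - y0).
assert (B : exists M, 0 < M /\ forall x y, x0 <= x <= x0 + 1 * a -> y0 <= y <= y0 + 1 * b -> Cmod (q (Ipt x y)) <= M).
{ apply (bisection x0 y0 a b (fun u v t => exists M, 0 < M /\ forall x y, u <= x <= u + t * a -> v <= y <= v + t * b -> Cmod (q (Ipt x y)) <= M));
    [unfold a; lra|unfold b; lra| |].
  - intros x y t tp _ [M1 [p1 H1]] [M2 [p2 H2]] [M3 [p3 H3]] [M4 [p4 H4]].
    exists (M1 + M2 + M3 + M4); split; [lra|intros u v hu hv].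
    destruct (Rle_dec u (x + t / 2 * a)) as [A|A], (Rle_dec v (y + t / 2 * b)) as [B|B].
    + specialize (H1 u v ltac:(lra) ltac:(lra)); lra.
    + specialize (H3 u v ltac:(lra) ltac:(lra)); lra.
    + specialize (H2 u v ltac:(lra) ltac:(lra)); lra.
    + specialize (H4 u v ltac:(lra) ltac:(lra)); lra.
  - intros u v hu hv.
    destruct (H u v ltac:(unfold a in *; lra) ltac:(unfold b in *; lra) 1 Rlt_0_1) as [d [dp Hd]].
    exists (d / (a + b)); split; [apply Rdiv_lt_0_compat; unfold a, b; lra|].
    intros x y t [tp td] _ ux vy.
    exists (Cmod (q (Ipt u v)) + 1); pose proof (Cmod_nonneg (q (Ipt u v))); split; [lra|].
    intros x' y' hx' hy'.
    assert (tab : t * (a + b) < d).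
    { assert (0 < a + b) by (unfold a, b; lra).
      apply Rmult_lt_compat_r with (r := a + b) in td; [|assumption].
      replace (d / (a + b) * (a + b)) with d in td by (field; lra); exact td. }
    assert (near : Cmod (Csub (Ipt x' y') (Ipt u v)) < d).
    { eapply Rle_lt_trans; [apply Cmod_le_re_im|simpl].
      assert (Rabs (x' + - u) <= t * a) by (apply Rabs_le; clear - ux hx'; lra).
      assert (Rabs (y' + - v) <= t * b) by (apply Rabs_le; clear - vy hy'; lra).
      lra. }
    specialize (Hd _ near).
    replace (q (Ipt x' y')) with (Cadd (q (Ipt u v)) (Csub (q (Ipt x' y')) (q (Ipt u v)))) by ring.
    eapply Rle_trans; [apply Cmod_triangle|lra]. }
destruct B as [M [Mp HM]]; exists M; split; [assumption|intros x y h1 h2; apply HM; unfold a, b; lra].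
Qed.

(** In the coordinate w with z = [cexp w] the slit plane is the strip |im w| < PI and the positive
    half-line is the real axis, so [controlled_strip] carries the real approximation to every
    smaller strip. *)
Theorem strip_approx (F : Cx -> Cx) : holomorphic_on_D F ->
  (forall B delta, 1 <= B -> 0 < delta -> exists l, weights_ok l /\ wsum l = 1 /\
     forall x, / B <= x <= B -> Cmod (Csub (F (RtoC x)) (combC l (RtoC x))) <= delta) ->
  forall X c eps, 0 <= c < PI -> 0 < eps -> exists l, weights_ok l /\ wsum l = 1 /\
    forall w, Rabs (re w) <= X -> Rabs (im w) <= c ->
      Cmod (Csub (F (cexp w)) (combC l (cexp w))) <= eps.
Proof.
intros HF Happ X c eps hc he.
(* [controlled_strip] only looks upwards from the real axis; s = -1 reflects w to -w and so covers
   the lower half of the strip. *)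
set (KK := fun K : Cx -> Cx => exists l s, weights_ok l /\ wsum l = 1 /\ (s = 1 \/ s = -1) /\
   K = (fun w => Csub (F (cexp (Cmul (RtoC s) w))) (combC l (cexp (Cmul (RtoC s) w))))).
assert (sI : forall s x y, Cmul (RtoC s) (Ipt x y) = Ipt (s * x) (s * y)) by (intros; cx).
assert (dlin : forall s z, Cdiff (fun w => cexp (Cmul (RtoC s) w)) z).
{ intros s z; apply (Cdiff_comp cexp (fun w => Cmul (RtoC s) w)); [|apply Cdiff_cexp].
  apply Cdiff_mul; [apply Cdiff_const|apply Cdiff_id]. }
assert (Kd : forall K, KK K -> forall x y, - PI < y < PI -> Cdiff K (Ipt x y)).
{ intros K (l & s & hw & h1 & hs & ->) x y hy.
  assert (D : in_D (cexp (Cmul (RtoC s) (Ipt x y)))).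
  { apply in_D_cexp; rewrite sI; simpl; destruct hs; subst s; lra. }
  apply Cdiff_sub.
  - apply (Cdiff_comp F (fun w => cexp (Cmul (RtoC s) w))); [apply dlin|apply HF, D].
  - apply (Cdiff_comp (combC l) (fun w => cexp (Cmul (RtoC s) w))); [apply dlin|apply Cdiff_combC; assumption]. }
assert (Kb : forall X c, 0 <= c < PI -> exists M, 0 < M /\ forall K, KK K ->
  forall x y, - X <= x <= X -> 0 <= y <= c -> Cmod (K (Ipt x y)) <= M).
{ intros X' c' hc'.
  destruct (combC_strip_bound (Rabs X' + 1) c' hc') as [M1 [p1 H1]].
  set (c2 := (c' + PI) / 2).
  pose proof (Rabs_pos X') as aX.
  destruct (Ccont_bounded_rect (fun w => F (cexp w)) (- (Rabs X' + 1)) (Rabs X' + 1) (- c2) c2) as [M2 [p2 H2]].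
  - lra.
  - unfold c2; lra.
  - apply Ccont_rect; intros x y hx hy; apply (Cdiff_comp F cexp); [apply Cdiff_cexp|].
    apply HF, in_D_cexp; simpl; unfold c2 in hy; lra.
  - exists (M1 + M2); split; [lra|intros K (l & s & hw & h1 & hs & ->) x y hx hy].
    rewrite sI; eapply Rle_trans; [apply Cmod_sub_triangle|].
    pose proof (Rle_abs X').
    rewrite (Rplus_comm M1); apply Rplus_le_compat.
    + apply H2; unfold c2; destruct hs; subst s; lra.
    + apply H1; auto; simpl; apply Rabs_le; destruct hs; subst s; lra. }
destruct (controlled_strip KK Kd Kb c hc X eps he) as (Y & delta & dp & HY).
(* For |x| <= Y the point exp x lies between exp(-|Y|) and exp |Y|. Only here, with Y and delta
   fixed, is the combination chosen. *)
destruct (Happ (exp (Rabs Y)) delta) as (l & hw & h1 & Hl); auto.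
{ destruct (Rabs_pos Y) as [p|e]; [|rewrite <- e, exp_0; lra].
  rewrite <- exp_0 at 1; apply Rlt_le, exp_increasing, p. }
exists l; repeat split; auto; intros w hx hy.
assert (real : forall s x, (s = 1 \/ s = -1) -> - Y <= x <= Y ->
   Cmod (Csub (F (cexp (Cmul (RtoC s) (Ipt x 0)))) (combC l (cexp (Cmul (RtoC s) (Ipt x 0))))) <= delta).
{ intros s x hs hx'; rewrite sI.
  replace (cexp (Ipt (s * x) (s * 0))) with (RtoC (exp (s * x))).
  2:{ apply Cx_ext; unfold cexp; simpl; rewrite Rmult_0_r, ?cos_0, ?sin_0; ring. }
  assert (sx : - Rabs Y <= s * x <= Rabs Y) by (pose proof (Rle_abs Y); destruct hs; subst s; lra).
  assert (mono : forall u v, u <= v -> exp u <= exp v).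
  { intros u v [k|k]; [apply Rlt_le, exp_increasing, k|rewrite k; lra]. }
  apply Hl; rewrite <- exp_Ropp; split; apply mono; lra. }
assert (hx' : - X <= re w <= X) by (apply Rabs_le_between; assumption).
apply Rabs_le_between in hy.
destruct (Rle_dec 0 (im w)) as [p|n].
- assert (K1 : KK (fun w => Csub (F (cexp (Cmul (RtoC 1) w))) (combC l (cexp (Cmul (RtoC 1) w)))))
    by (exists l, 1; auto).
  specialize (HY _ K1 (fun x hx => real 1 x (or_introl eq_refl) hx) (re w) (im w) hx' ltac:(lra)).
  cbv beta in HY; rewrite sI in HY; replace (Ipt (1 * re w) (1 * im w)) with w in HY by cx; exact HY.
- assert (K1 : KK (fun w => Csub (F (cexp (Cmul (RtoC (-1)) w))) (combC l (cexp (Cmul (RtoC (-1)) w)))))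
    by (exists l, (-1); auto).
  specialize (HY _ K1 (fun x hx => real (-1) x (or_intror eq_refl) hx) (- re w) (- im w) ltac:(lra) ltac:(lra)).
  cbv beta in HY; rewrite sI in HY; replace (Ipt (-1 * - re w) (-1 * - im w)) with w in HY by cx; exact HY.
Qed.

End IdentityTheorem.

(** * Riemann integrals along closed curves *)

Module ContourIntegrals.
From Coquelicot Require Import Rcomplements Hierarchy Continuity Derive.
Import ComplexNumbers IdentityTheorem.
Local Open Scope R_scope.

Lemma RI01_ext g h v : (forall t, g t = h t) -> RI01 g v -> RI01 h v.
Proof.
intros E H eps he; destruct (H eps he) as [d [dp Hd]]; exists d; split; [assumption|].
intros k x xi h0 h1 hx.
rewrite (csum_ext k _ (fun i => Cmul (g (xi i)) (RtoC (x (S i) - x i)))); [apply Hd; assumption|].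
intros i _; rewrite E; reflexivity.
Qed.

Lemma RI01_eq g v w : v = w -> RI01 g v -> RI01 g w.
Proof. intros ->; auto. Qed.

Lemma RI01_add g h v w : RI01 g v -> RI01 h w -> RI01 (fun t => Cadd (g t) (h t)) (Cadd v w).
Proof.
intros Hg Hh eps he.
destruct (Hg (eps / 2) ltac:(lra)) as [d [dp Hd]], (Hh (eps / 2) ltac:(lra)) as [e [ep He]].
exists (Rmin d e); split; [apply Rmin_pos; assumption|intros k x xi h0 h1 hx].
assert (hxd : forall i, (i < k)%nat -> x i < x (S i) /\ x (S i) - x i < d /\ x i <= xi i <= x (S i)).
{ intros i hi; destruct (hx i hi) as (a & b & c); repeat split; try tauto; eapply Rlt_le_trans; [exact b|apply Rmin_l]. }
assert (hxe : forall i, (i < k)%nat -> x i < x (S i) /\ x (S i) - x i < e /\ x i <= xi i <= x (S i)).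
{ intros i hi; destruct (hx i hi) as (a & b & c); repeat split; try tauto; eapply Rlt_le_trans; [exact b|apply Rmin_r]. }
specialize (Hd k x xi h0 h1 hxd); specialize (He k x xi h0 h1 hxe).
rewrite (csum_ext k _ (fun i => Cadd (Cmul (g (xi i)) (RtoC (x (S i) - x i))) (Cmul (h (xi i)) (RtoC (x (S i) - x i)))))
  by (intros; ring).
rewrite csum_add.
match goal with |- Cmod (Csub (Cadd ?a ?b) _) < _ =>
  replace (Csub (Cadd a b) (Cadd v w)) with (Cadd (Csub a v) (Csub b w)) by ring end.
eapply Rle_lt_trans; [apply Cmod_triangle|lra].
Qed.

Lemma RI01_mul_l c g v : RI01 g v -> RI01 (fun t => Cmul c (g t)) (Cmul c v).
Proof.
intros Hg eps he; pose proof (Cmod_nonneg c) as cn.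
destruct (Hg (eps / (Cmod c + 1))) as [d [dp Hd]]; [apply Rdiv_lt_0_compat; lra|].
exists d; split; [assumption|intros k x xi h0 h1 hx; specialize (Hd k x xi h0 h1 hx)].
rewrite (csum_ext k _ (fun i => Cmul c (Cmul (g (xi i)) (RtoC (x (S i) - x i))))) by (intros; ring).
rewrite csum_mul_l.
match goal with |- Cmod (Csub (Cmul c ?a) _) < _ =>
  replace (Csub (Cmul c a) (Cmul c v)) with (Cmul c (Csub a v)) by ring; set (S := Csub a v) in * end.
rewrite Cmod_mul; pose proof (Cmod_nonneg S).
apply Rle_lt_trans with ((Cmod c + 1) * Cmod S); [apply Rmult_le_compat_r; lra|].
apply Rmult_lt_compat_l with (r := Cmod c + 1) in Hd; [|lra].
replace ((Cmod c + 1) * (eps / (Cmod c + 1))) with eps in Hd by (field; lra); exact Hd.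
Qed.

Lemma RI01_zero : RI01 (fun _ => C0) C0.
Proof.
intros eps he; exists 1; split; [lra|intros k x xi _ _ _].
rewrite (csum_ext k _ (fun _ => C0)) by (intros; ring).
rewrite csum_0; replace (Csub C0 C0) with C0 by ring; rewrite Cmod_0; assumption.
Qed.

Lemma RI01_csum k (g : nat -> R -> Cx) v : (forall i, (i < k)%nat -> RI01 (g i) (v i)) ->
  RI01 (fun t => csum k (fun i => g i t)) (csum k v).
Proof.
induction k; intros H; simpl; [apply RI01_zero|].
apply RI01_add; [apply IHk; intros; apply H; lia|apply H; lia].
Qed.

Lemma csum_telescope k (x : nat -> R) : csum k (fun i => RtoC (x (S i) - x i)) = RtoC (x k - x O).
Proof.
induction k; simpl; [apply Cx_ext; simpl; ring|rewrite IHk; apply Cx_ext; simpl; ring].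
Qed.

Lemma csum_telescopeC k (G : nat -> Cx) : csum k (fun i => Csub (G (S i)) (G i)) = Csub (G k) (G O).
Proof. induction k; simpl; [ring|rewrite IHk; ring]. Qed.

(** Both integrals are compared on one tagged partition, the uniform one with N steps, fine enough
    for both meshes; each Riemann sum may err by a third of the supposed excess. *)
Lemma RI01_le g h v w M : RI01 g v -> RI01 h w ->
  (forall t, 0 <= t <= 1 -> Cmod (Csub (g t) (h t)) <= M) -> Cmod (Csub v w) <= M.
Proof.
intros Hg Hh HM; apply Rnot_lt_le; intros hlt.
set (eta := (Cmod (Csub v w) - M) / 3).
destruct (Hg eta ltac:(unfold eta; lra)) as [d [dp Hd]], (Hh eta ltac:(unfold eta; lra)) as [e [ep He]].
set (m := Rmin d e); assert (mp : 0 < m) by (apply Rmin_pos; assumption).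
destruct (archimed_cor1 m mp) as [N [hN Np]].
assert (Nr : 0 < INR N) by (apply lt_0_INR; assumption).
set (x := fun i => INR i / INR N).
assert (xS : forall i, x (S i) - x i = / INR N) by (intros i; unfold x; rewrite S_INR; field; lra).
assert (Np' : 0 < / INR N) by (apply Rinv_0_lt_compat; assumption).
assert (x0 : x O = 0) by (unfold x; simpl; field; lra).
assert (x1 : x N = 1) by (unfold x; field; lra).
assert (md : m <= d) by apply Rmin_l; assert (me : m <= e) by apply Rmin_r.
specialize (Hd N x x x0 x1 ltac:(intros i hi; specialize (xS i); repeat split; lra)).
specialize (He N x x x0 x1 ltac:(intros i hi; specialize (xS i); repeat split; lra)).
set (Sg := csum N (fun i => Cmul (g (x i)) (RtoC (x (S i) - x i)))) in *.
set (Sh := csum N (fun i => Cmul (h (x i)) (RtoC (x (S i) - x i)))) in *.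
assert (B : Cmod (Csub Sg Sh) <= M).
{ unfold Sg, Sh; rewrite <- csum_sub.
  eapply Rle_trans; [apply csum_mod|].
  eapply Rle_trans; [apply (re_csum_le N _ (fun i => RtoC (M * (x (S i) - x i))))|].
  - intros i hi; simpl.
    replace (Csub _ _) with (Cmul (Csub (g (x i)) (h (x i))) (RtoC (x (S i) - x i))) by ring.
    rewrite Cmod_mul, Cmod_RtoC, Rabs_right by (rewrite xS; lra).
    apply Rmult_le_compat_r; [rewrite xS; lra|apply HM].
    unfold x; split; [apply Rmult_le_pos; [apply pos_INR|lra]|].
    apply Rmult_le_reg_r with (INR N); [assumption|].
    replace (INR i / INR N * INR N) with (INR i) by (field; lra).
    rewrite Rmult_1_l; apply le_INR; lia.
  - rewrite (csum_ext N _ (fun i => Cmul (RtoC M) (RtoC (x (S i) - x i)))) by (intros; apply RtoC_mul).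
    rewrite csum_mul_l, csum_telescope, x0, x1; simpl; lra. }
assert (Cmod (Csub v w) <= Cmod (Csub Sg v) + (M + Cmod (Csub Sh w))).
{ replace (Csub v w) with (Csub (Cadd (Csub Sg Sh) (Csub Sh w)) (Csub Sg v)) by ring.
  eapply Rle_trans; [apply Cmod_sub_triangle|].
  pose proof (Cmod_triangle (Csub Sg Sh) (Csub Sh w)); lra. }
unfold eta in *; lra.
Qed.

Definition curve_diff (G : R -> Cx) (t : R) (d : Cx) : Prop :=
  derivable_pt_lim (fun s => re (G s)) t (re d) /\ derivable_pt_lim (fun s => im (G s)) t (im d).

Definition curve_C0 (g : R -> Cx) : Prop :=
  forall t, continuity_pt (fun s => re (g s)) t /\ continuity_pt (fun s => im (g s)) t.

(** Mean value theorem and uniform continuity, applied to real and imaginary parts separately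
    because the mean value theorem fails for complex values. *)
Lemma RI01_primitive (G g : R -> Cx) : (forall t, curve_diff G t (g t)) -> curve_C0 g ->
  RI01 g (Csub (G 1) (G 0)).
Proof.
intros HG Hg eps he.
assert (real : forall (U u : R -> R), (forall t, derivable_pt_lim U t (u t)) -> (forall t, continuity_pt u t) ->
   exists d, 0 < d /\ forall a b s, 0 <= a -> b <= 1 -> a < b -> b - a < d -> a <= s <= b ->
     Rabs (u s * (b - a) - (U b - U a)) <= eps / 4 * (b - a)).
{ intros U u HU Hu.
  destruct (Heine u (fun t => 0 <= t <= 1) (compact_P3 0 1) (fun t _ => Hu t) (mkposreal (eps / 4) ltac:(lra))) as [d Hd].
  exists d; split; [apply cond_pos|intros a b s ha hb ab hd hs].
  destruct (MVT_cor2 U u a b ab (fun t _ => HU t)) as [c [Hc hc]].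
  rewrite Hc; replace (u s * (b - a) - u c * (b - a)) with ((u s - u c) * (b - a)) by ring.
  rewrite Rabs_mult, (Rabs_right (b - a)) by lra.
  apply Rmult_le_compat_r; [lra|apply Rlt_le].
  apply (Hd s c); [lra|lra|apply Rabs_def1; lra]. }
destruct (real _ _ (fun t => proj1 (HG t)) (fun t => proj1 (Hg t))) as [d [dp Hd]].
destruct (real _ _ (fun t => proj2 (HG t)) (fun t => proj2 (Hg t))) as [e [ep He]].
exists (Rmin d e); split; [apply Rmin_pos; assumption|intros k x xi h0 h1 hx].
assert (md : Rmin d e <= d) by apply Rmin_l; assert (me : Rmin d e <= e) by apply Rmin_r.
assert (mono : forall i j, (i <= j <= k)%nat -> x i <= x j).
{ intros i j hij; induction j as [|j IH]; [replace i with O by lia; lra|].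
  destruct (Nat.eq_dec i (S j)) as [->|ne]; [lra|].
  destruct (hx j ltac:(lia)) as (a & _); specialize (IH ltac:(lia)); lra. }
replace (Csub (G 1) (G 0)) with (csum k (fun i => Csub (G (x (S i))) (G (x i))))
  by (rewrite (csum_telescopeC k (fun i => G (x i))), h0, h1; reflexivity).
rewrite <- csum_sub.
eapply Rle_lt_trans; [apply csum_mod|].
apply Rle_lt_trans with (re (csum k (fun i => RtoC (eps / 2 * (x (S i) - x i))))).
- apply re_csum_le; intros i hi; simpl.
  destruct (hx i hi) as (a & b & c).
  assert (x0 : 0 <= x i) by (rewrite <- h0; apply mono; lia).
  assert (x1 : x (S i) <= 1) by (rewrite <- h1; apply mono; lia).
  eapply Rle_trans; [apply Cmod_le_re_im|simpl].
  specialize (Hd (x i) (x (S i)) (xi i) x0 x1 a ltac:(lra) c).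
  specialize (He (x i) (x (S i)) (xi i) x0 x1 a ltac:(lra) c).
  replace (re (g (xi i)) * (x (S i) - x i) - im (g (xi i)) * 0 + - (re (G (x (S i))) + - re (G (x i))))
    with (re (g (xi i)) * (x (S i) - x i) - (re (G (x (S i))) - re (G (x i)))) by ring.
  replace (re (g (xi i)) * 0 + im (g (xi i)) * (x (S i) - x i) + - (im (G (x (S i))) + - im (G (x i))))
    with (im (g (xi i)) * (x (S i) - x i) - (im (G (x (S i))) - im (G (x i)))) by ring.
  lra.
- rewrite (csum_ext k _ (fun i => Cmul (RtoC (eps / 2)) (RtoC (x (S i) - x i)))) by (intros; apply RtoC_mul).
  rewrite csum_mul_l, csum_telescope, h0, h1; simpl; lra.
Qed.

Lemma curve_diff_mul G H t d e : curve_diff G t d -> curve_diff H t e ->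
  curve_diff (fun s => Cmul (G s) (H s)) t (Cadd (Cmul d (H t)) (Cmul (G t) e)).
Proof.
intros [g1 g2] [h1 h2]; split; simpl.
- replace (re d * re (H t) - im d * im (H t) + (re (G t) * re e - im (G t) * im e)) with
    ((re d * re (H t) + re (G t) * re e) - (im d * im (H t) + im (G t) * im e)) by ring.
  apply derivable_pt_lim_minus; apply derivable_pt_lim_mult; assumption.
- replace (re d * im (H t) + im d * re (H t) + (re (G t) * im e + im (G t) * re e)) with
    ((re d * im (H t) + re (G t) * im e) + (im d * re (H t) + im (G t) * re e)) by ring.
  apply derivable_pt_lim_plus; apply derivable_pt_lim_mult; assumption.
Qed.

Lemma curve_diff_add_const G t d c : curve_diff G t d -> curve_diff (fun s => Cadd (G s) c) t d.
Proof.
intros [g1 g2]; split; simpl.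
- replace (re d) with (re d + 0) by ring; apply derivable_pt_lim_plus; [assumption|apply derivable_pt_lim_const].
- replace (im d) with (im d + 0) by ring; apply derivable_pt_lim_plus; [assumption|apply derivable_pt_lim_const].
Qed.

Lemma curve_diff_mul_l G t d c : curve_diff G t d -> curve_diff (fun s => Cmul c (G s)) t (Cmul c d).
Proof.
intros [g1 g2].
assert (K : curve_diff (fun _ => c) t C0) by (split; apply derivable_pt_lim_const).
pose proof (curve_diff_mul _ _ _ _ _ K (conj g1 g2)) as h.
replace (Cmul c d) with (Cadd (Cmul C0 (G t)) (Cmul c d)) by ring; exact h.
Qed.

Lemma curve_diff_inv G t d : curve_diff G t d -> G t <> C0 ->
  curve_diff (fun s => Cinv (G s)) t (Copp (Cmul d (Cmul (Cinv (G t)) (Cinv (G t))))).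
Proof.
intros [g1 g2] nz; pose proof (Cnorm2_pos _ nz) as np; unfold Cnorm2 in np.
assert (N : derivable_pt_lim (fun s => Cnorm2 (G s)) t
   ((re d * re (G t) + re (G t) * re d) + (im d * im (G t) + im (G t) * im d))).
{ apply derivable_pt_lim_plus; apply derivable_pt_lim_mult; assumption. }
split; simpl.
- match goal with |- derivable_pt_lim _ _ ?l => replace l with
   ((re d * Cnorm2 (G t) - ((re d * re (G t) + re (G t) * re d) + (im d * im (G t) + im (G t) * im d)) * re (G t)) / Rsqr (Cnorm2 (G t))) end.
  + apply (derivable_pt_lim_div (fun s => re (G s)) (fun s => Cnorm2 (G s)) t (re d)); [assumption|assumption|unfold Cnorm2; lra].
  + unfold Cnorm2, Rsqr; field; lra.
- match goal with |- derivable_pt_lim _ _ ?l => replace l with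
   (((- im d) * Cnorm2 (G t) - ((re d * re (G t) + re (G t) * re d) + (im d * im (G t) + im (G t) * im d)) * (- im (G t))) / Rsqr (Cnorm2 (G t))) end.
  + apply (derivable_pt_lim_div (fun s => - im (G s)) (fun s => Cnorm2 (G s)) t (- im d));
      [|assumption|unfold Cnorm2; lra].
    apply (derivable_pt_lim_opp (fun s => im (G s))); assumption.
  + unfold Cnorm2, Rsqr; field; lra.
Qed.

Lemma curve_diff_C0 G g : (forall t, curve_diff G t (g t)) -> curve_C0 G.
Proof.
intros H t; split; apply derivable_continuous_pt; eexists; apply (H t).
Qed.

Lemma curve_C0_mul G H : curve_C0 G -> curve_C0 H -> curve_C0 (fun t => Cmul (G t) (H t)).
Proof.
intros hG hH t; destruct (hG t), (hH t); split; simpl.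
- apply (continuity_pt_minus (fun t => re (G t) * re (H t)) (fun t => im (G t) * im (H t)));
   apply (continuity_pt_mult (fun t => _ (G t)) (fun t => _ (H t))); assumption.
- apply (continuity_pt_plus (fun t => re (G t) * im (H t)) (fun t => im (G t) * re (H t)));
   apply (continuity_pt_mult (fun t => _ (G t)) (fun t => _ (H t))); assumption.
Qed.

Lemma curve_C0_add G H : curve_C0 G -> curve_C0 H -> curve_C0 (fun t => Cadd (G t) (H t)).
Proof.
intros hG hH t; destruct (hG t), (hH t); split; simpl.
- apply (continuity_pt_plus (fun t => re (G t)) (fun t => re (H t))); assumption.
- apply (continuity_pt_plus (fun t => im (G t)) (fun t => im (H t))); assumption.
Qed.

Lemma curve_C0_const c : curve_C0 (fun _ => c).
Proof. intros t; split; apply continuity_pt_const; intros a b; reflexivity. Qed.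

Lemma curve_C0_bounded G : curve_C0 G -> exists M, 0 < M /\ forall t, 0 <= t <= 1 -> Cmod (G t) <= M.
Proof.
intros H.
assert (r : forall u : R -> R, (forall t, continuity_pt u t) -> exists M, forall t, 0 <= t <= 1 -> Rabs (u t) <= M).
{ intros u hu.
  destruct (continuity_ab_maj u 0 1 ltac:(lra) (fun c _ => hu c)) as [a [ha _]].
  destruct (continuity_ab_min u 0 1 ltac:(lra) (fun c _ => hu c)) as [b [hb _]].
  exists (Rabs (u a) + Rabs (u b)); intros t ht; specialize (ha t ht); specialize (hb t ht).
  pose proof (Rle_abs (u a)); pose proof (Rle_abs (- u b)); rewrite Rabs_Ropp in *.
  pose proof (Rabs_pos (u a)); pose proof (Rabs_pos (u b)).
  apply Rabs_le; lra. }
destruct (r _ (fun t => proj1 (H t))) as [M1 H1], (r _ (fun t => proj2 (H t))) as [M2 H2].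
exists (Rabs M1 + Rabs M2 + 1); split; [pose proof (Rabs_pos M1); pose proof (Rabs_pos M2); lra|].
intros t ht; specialize (H1 t ht); specialize (H2 t ht).
pose proof (Rle_abs M1); pose proof (Rle_abs M2).
eapply Rle_trans; [apply Cmod_le_re_im|lra].
Qed.

(** Makes [clog] a primitive of 1/z along every curve in the slit plane; both components reduce to
    algebra through |z|^2 = x^2 + y^2. *)
Lemma curve_diff_log G t d : curve_diff G t d -> in_D (G t) ->
  curve_diff (fun s => clog (G s)) t (Cmul d (Cinv (G t))).
Proof.
intros [g1 g2] hD; pose proof (in_D_denom _ hD) as dn.
pose proof (Cmod_pos _ (in_D_neq0 _ hD)) as mp; pose proof (Cmod_sqr (G t)) as ms.
pose proof (Cnorm2_pos _ (in_D_neq0 _ hD)) as np.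
assert (N : derivable_pt_lim (fun s => Cnorm2 (G s)) t
   ((re d * re (G t) + re (G t) * re d) + (im d * im (G t) + im (G t) * im d))).
{ apply derivable_pt_lim_plus; apply derivable_pt_lim_mult; assumption. }
set (x := re (G t)) in *; set (y := im (G t)) in *; set (a := re d) in *; set (b := im d) in *.
set (m := Cmod (G t)) in *.
assert (M : derivable_pt_lim (fun s => Cmod (G s)) t ((x * a + y * b) / m)).
{ replace ((x * a + y * b) / m) with (/ (2 * sqrt (Cnorm2 (G t))) * ((a * x + x * a) + (b * y + y * b)))
    by (fold (Cmod (G t)); fold m; field; lra).
  apply (derivable_pt_lim_comp (fun s => Cnorm2 (G s)) sqrt); [exact N|apply derivable_pt_lim_sqrt, np]. }
assert (E : m * m = x * x + y * y) by exact ms.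
split; unfold clog, carg; simpl.
- match goal with |- derivable_pt_lim _ _ ?l => replace l with (/ m * ((x * a + y * b) / m)) end.
  + apply (derivable_pt_lim_comp (fun s => Cmod (G s)) ln); [exact M|apply derivable_pt_lim_ln, mp].
  + unfold Cnorm2; fold x y a b; rewrite <- E; field; lra.
- match goal with |- derivable_pt_lim _ _ ?l => replace l with
    (2 * (/ (1 + (y / (x + m)) ^ 2) * ((b * (x + m) - (a + (x * a + y * b) / m) * y) / Rsqr (x + m)))) end.
  + apply derivable_pt_lim_scal.
    apply (derivable_pt_lim_comp (fun s => im (G s) / (re (G s) + Cmod (G s))) atan).
    * apply (derivable_pt_lim_div (fun s => im (G s)) (fun s => re (G s) + Cmod (G s))); [exact g2| |fold x m; lra].
      apply (derivable_pt_lim_plus (fun s => re (G s)) (fun s => Cmod (G s))); assumption.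
    * apply derivable_pt_lim_atan.
  + assert (y2 : y * y = m * m - x * x) by lra.
    assert (q : 1 + (y / (x + m)) ^ 2 = 2 * m / (x + m)).
    { replace ((y / (x + m)) ^ 2) with (y * y / ((x + m) * (x + m))) by (field; lra).
      rewrite y2; field; lra. }
    rewrite q; unfold Cnorm2; fold x y a b; rewrite <- E.
    unfold Rsqr.
    replace (2 * (/ (2 * m / (x + m)) * ((b * (x + m) - (a + (x * a + y * b) / m) * y) / ((x + m) * (x + m)))))
      with ((m * b * (x + m) - m * a * y - x * a * y - (y * y) * b) / (m * m * (x + m))) by (field; lra).
    rewrite y2; field; lra.
Qed.

(** * Integrals of products of simple poles *)

Definition prodinv (ls : list Cx) (z : Cx) : Cx :=
  fold_right (fun l p => Cmul (Cinv (Csub z l)) p) C1 ls.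

Fixpoint Cpow (z : Cx) (k : nat) : Cx := match k with O => C1 | S k' => Cmul z (Cpow z k') end.

Lemma prodinv_cons l ls z : prodinv (l :: ls) z = Cmul (Cinv (Csub z l)) (prodinv ls z).
Proof. reflexivity. Qed.

Lemma Cpow_S z k : Cpow z (S k) = Cmul z (Cpow z k).
Proof. reflexivity. Qed.

Lemma Cpow_0 z : Cpow z O = C1.
Proof. reflexivity. Qed.

Section Contour.
Variables gamma gamma' : R -> Cx.
Hypothesis gper : gamma 1 = gamma 0.
Hypothesis gdiff : forall t, curve_diff gamma t (gamma' t).
Hypothesis gC0 : curve_C0 gamma'.
Hypothesis gD : forall t, in_D (gamma t).

(** The clause of [admissible_contour] about one eigenvalue, and all that is known of the contour
    near it. *)
Definition encircled (l : Cx) : Prop := (forall t, gamma t <> l) /\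
  RI01 (fun t => Cmul (gamma' t) (Cinv (Csub (gamma t) l))) two_pi_i.

Lemma encircled_inv_diff l : encircled l -> forall t,
  curve_diff (fun s => Cinv (Csub (gamma s) l)) t
    (Copp (Cmul (gamma' t) (Cmul (Cinv (Csub (gamma t) l)) (Cinv (Csub (gamma t) l))))).
Proof.
intros [nl _] t; apply (curve_diff_inv (fun s => Csub (gamma s) l)).
- apply curve_diff_add_const, gdiff.
- apply Csub_neq0, nl.
Qed.

Lemma encircled_inv_C0 l : encircled l -> curve_C0 (fun s => Cinv (Csub (gamma s) l)).
Proof. intros H; eapply curve_diff_C0; apply encircled_inv_diff, H. Qed.

Lemma Cpow_diff l k : encircled l -> forall t,
  curve_diff (fun s => Cpow (Cinv (Csub (gamma s) l)) (S k)) t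
    (Cmul (RtoC (- INR (S k))) (Cmul (gamma' t) (Cpow (Cinv (Csub (gamma t) l)) (S (S k))))).
Proof.
intros H t; induction k as [|k IH].
- pose proof (encircled_inv_diff l H t) as h.
  pose proof (curve_diff_mul _ (fun _ => C1) _ _ C0 h ltac:(split; apply derivable_pt_lim_const)) as h2.
  simpl Cpow in *; match type of h2 with curve_diff _ _ ?d => match goal with |- curve_diff _ _ ?e =>
    replace e with d; [exact h2|] end end.
  replace (RtoC (- INR 1)) with (Copp C1) by cx; ring.
- pose proof (curve_diff_mul _ _ _ _ _ (encircled_inv_diff l H t) IH) as h2.
  match type of h2 with curve_diff _ _ ?d => match goal with |- curve_diff _ _ ?e =>
    replace e with d; [exact h2|] end end.
  rewrite (S_INR (S k)).
  replace (RtoC (- (INR (S k) + 1))) with (Csub (RtoC (- INR (S k))) C1) by cx.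
  cbn [Cpow]; ring.
Qed.

Lemma RI01_inv_pow l k : encircled l ->
  RI01 (fun t => Cmul (gamma' t) (Cpow (Cinv (Csub (gamma t) l)) (S (S k)))) C0.
Proof.
intros H.
pose proof (curve_diff_mul_l) as cm.
set (c := RtoC (/ - INR (S k))).
assert (ck : Cmul c (RtoC (- INR (S k))) = C1).
{ unfold c; rewrite <- RtoC_mul, Rinv_l; [reflexivity|].
  pose proof (lt_0_INR (S k) ltac:(lia)); lra. }
set (G := fun s => Cmul c (Cpow (Cinv (Csub (gamma s) l)) (S k))).
apply (RI01_eq _ (Csub (G 1) (G 0))).
{ unfold G; rewrite gper; ring. }
apply RI01_primitive.
- intros t; pose proof (cm _ _ _ c (Cpow_diff l k H t)) as h.
  match type of h with curve_diff _ _ ?d => match goal with |- curve_diff _ _ ?e =>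
    replace e with d; [exact h|] end end.
  transitivity (Cmul (Cmul c (RtoC (- INR (S k)))) (Cmul (gamma' t) (Cpow (Cinv (Csub (gamma t) l)) (S (S k)))));
   [ring|rewrite ck; ring].
- apply curve_C0_mul; [exact gC0|].
  assert (P : forall n, curve_C0 (fun t => Cpow (Cinv (Csub (gamma t) l)) n)).
  { induction n; simpl; [apply curve_C0_const|apply curve_C0_mul; [apply encircled_inv_C0, H|assumption]]. }
  apply P.
Qed.

(** The integral of a product of n + 1 factors 1/(z - l_j) over encircled points: only a single
    factor leaves a residue, since with two or more the residues sum to zero. *)
Definition winding_value (n : nat) : Cx := match n with O => two_pi_i | _ => C0 end.

(* Splitting 1/((z-a)(z-b)) by partial fractions lowers the number of factors, down to pure
   powers, which have a primitive. *)
Lemma RI01_pow_prodinv ls : (forall l, In l ls -> encircled l) -> forall k a, encircled a ->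
  RI01 (fun t => Cmul (gamma' t) (Cmul (Cpow (Cinv (Csub (gamma t) a)) (S k)) (prodinv ls (gamma t))))
       (winding_value (k + length ls)).
Proof.
induction ls as [|b ls IH]; intros Hls k a Ha.
- rewrite Nat.add_0_r; destruct k as [|k]; simpl winding_value.
  + apply (RI01_ext (fun t => Cmul (gamma' t) (Cinv (Csub (gamma t) a)))); [|apply Ha].
    intros t; simpl; ring.
  + apply (RI01_ext (fun t => Cmul (gamma' t) (Cpow (Cinv (Csub (gamma t) a)) (S (S k)))));
      [|apply RI01_inv_pow, Ha].
    intros t; unfold prodinv; cbn [fold_right]; ring.
- assert (Hb : encircled b) by (apply Hls; left; reflexivity).
  assert (Hls' : forall l, In l ls -> encircled l) by (intros; apply Hls; right; assumption).
  (* A repeated pole is absorbed into the power of 1/(z - a); only distinct poles are split. *)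
  destruct (classic (b = a)) as [->|ne].
  + apply (RI01_eq _ (winding_value (S k + length ls))).
    { simpl; rewrite Nat.add_succ_r; reflexivity. }
    apply (RI01_ext (fun t => Cmul (gamma' t) (Cmul (Cpow (Cinv (Csub (gamma t) a)) (S (S k))) (prodinv ls (gamma t)))));
      [|apply IH; assumption].
    intros t; simpl; ring.
  + assert (nab : Csub a b <> C0) by (apply Csub_neq0; auto).
    assert (pf : forall t, Cmul (Cinv (Csub (gamma t) a)) (Cinv (Csub (gamma t) b)) =
       Cmul (Cinv (Csub a b)) (Csub (Cinv (Csub (gamma t) a)) (Cinv (Csub (gamma t) b)))).
    { intros t; field; repeat split; auto; apply Csub_neq0; [apply Hb|apply Ha]. }
    replace (k + length (b :: ls))%nat with (S (k + length ls)) by (simpl; lia).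
    change (winding_value (S (k + length ls))) with C0.
    induction k as [|k IHk].
    (* With both poles simple, the two halves have the same number of factors, hence the same
       winding value, and cancel. *)
    * apply (RI01_eq _ (Cmul (Cinv (Csub a b)) (Cadd (winding_value (0 + length ls)) (Cmul (Copp C1) (winding_value (0 + length ls)))))); [ring|].
      pose proof (RI01_mul_l (Cinv (Csub a b)) _ _ (RI01_add _ _ _ _ (IH Hls' O a Ha) (RI01_mul_l (Copp C1) _ _ (IH Hls' O b Hb)))) as h.
      eapply RI01_ext; [|exact h]; intros t; cbv beta; rewrite ?Cpow_S, ?Cpow_0, !prodinv_cons.
      transitivity (Cmul (gamma' t) (Cmul (Cmul (Cinv (Csub (gamma t) a)) (Cinv (Csub (gamma t) b))) (prodinv ls (gamma t)))); [rewrite pf; ring|ring].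
    * apply (RI01_eq _ (Cmul (Cinv (Csub a b)) (Cadd (winding_value (S k + length ls)) (Cmul (Copp C1) C0)))); [simpl; ring|].
      pose proof (RI01_mul_l (Cinv (Csub a b)) _ _ (RI01_add _ _ _ _ (IH Hls' (S k) a Ha) (RI01_mul_l (Copp C1) _ _ IHk))) as h.
      eapply RI01_ext; [|exact h]; intros t; cbv beta; rewrite ?Cpow_S, ?Cpow_0, !prodinv_cons.
      set (P := Cpow (Cinv (Csub (gamma t) a)) k).
      transitivity (Cmul (gamma' t) (Cmul (Cmul (Cmul (Cinv (Csub (gamma t) a)) P) (Cmul (Cinv (Csub (gamma t) a)) (Cinv (Csub (gamma t) b)))) (prodinv ls (gamma t)))); [rewrite pf; ring|ring].
Qed.

Lemma RI01_prodinv l ls : encircled l -> (forall m, In m ls -> encircled m) ->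
  RI01 (fun t => Cmul (gamma' t) (prodinv (l :: ls) (gamma t))) (winding_value (length ls)).
Proof.
intros Hl Hls; eapply RI01_ext; [|exact (RI01_pow_prodinv ls Hls O l Hl)].
intros t; cbv beta; rewrite ?Cpow_S, ?Cpow_0, prodinv_cons; ring.
Qed.

Lemma RI01_inv_shift s : 0 <= s ->
  RI01 (fun t => Cmul (gamma' t) (Cinv (Cadd (gamma t) (RtoC s)))) C0.
Proof.
intros hs.
assert (D : forall t, in_D (Cadd (gamma t) (RtoC s))).
{ intros t [h1 h2]; apply (gD t); simpl in *; split; lra. }
assert (gd : forall t, curve_diff (fun u => Cadd (gamma u) (RtoC s)) t (gamma' t)).
{ intros t; apply curve_diff_add_const, gdiff. }
set (G := fun t => clog (Cadd (gamma t) (RtoC s))).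
apply (RI01_eq _ (Csub (G 1) (G 0))); [unfold G; rewrite gper; ring|].
apply RI01_primitive.
- intros t; exact (curve_diff_log _ _ _ (gd t) (D t)).
- apply curve_C0_mul; [exact gC0|].
  eapply curve_diff_C0; intros t; apply (curve_diff_inv _ _ _ (gd t)), in_D_neq0, D.
Qed.

(** * The resolvent as a rational function on the contour *)

Variable n : nat.
Variable X : Mat.
Variable Rs : R -> Mat.
Hypothesis HRs : forall t, meq n (mmul n (msub (mscale (gamma t) mid) X) (Rs t)) mid.

Definition shift (l : Cx) : Mat := msub X (mscale l mid).

(** Newton expansion of N (z - X)^{-1}: the sum of the terms N (X - l_1) ... (X - l_k) / ((z - l_1)
    ... (z - l_(k+1))), with N carrying the matrix product accumulated so far. *)
Fixpoint resf (N : Mat) (ls : list Cx) (z : Cx) : Mat :=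
  match ls with
  | nil => fun _ _ => C0
  | l :: ls' => mscale (Cinv (Csub z l)) (madd N (resf (mmul n N (shift l)) ls' z))
  end.

Fixpoint shift_prod (N : Mat) (ls : list Cx) : Mat :=
  match ls with nil => N | l :: ls' => shift_prod (mmul n N (shift l)) ls' end.

Lemma mmul_assoc A B C i j : mmul n (mmul n A B) C i j = mmul n A (mmul n B C) i j.
Proof.
unfold mmul.
rewrite (csum_ext n _ (fun k => csum n (fun l => Cmul (Cmul (A i l) (B l k)) (C k j))))
  by (intros; rewrite <- csum_mul_r; reflexivity).
rewrite csum_swap; apply csum_ext; intros l hl.
rewrite <- csum_mul_l; apply csum_ext; intros; ring.
Qed.

(** One step of the expansion: N (z - X) R = N rearranges to (z - l) N R = N + N (X - l) R. *)
Lemma shift_resolvent l t : gamma t <> l -> forall N i j, (i < n)%nat -> (j < n)%nat ->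
  mmul n N (Rs t) i j =
  Cmul (Cinv (Csub (gamma t) l)) (Cadd (N i j) (mmul n (mmul n N (shift l)) (Rs t) i j)).
Proof.
intros nl N i j hi hj.
assert (nz : Csub (gamma t) l <> C0) by (apply Csub_neq0; assumption).
assert (E : mmul n N (mmul n (msub (mscale (gamma t) mid) X) (Rs t)) i j = N i j).
{ transitivity (csum n (fun k => Cmul (mid j k) (N i k))).
  - apply csum_ext; intros k hk; rewrite (HRs t k j hk hj).
    unfold mid; rewrite (Nat.eqb_sym j k); ring.
  - apply csum_delta; assumption. }
rewrite <- mmul_assoc in E.
assert (S : Cadd (N i j) (mmul n (mmul n N (shift l)) (Rs t) i j) = Cmul (Csub (gamma t) l) (mmul n N (Rs t) i j)).
{ rewrite <- E; unfold mmul at 1 3.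
  rewrite <- csum_add; unfold mmul at 3; rewrite <- csum_mul_l; apply csum_ext; intros k hk.
  transitivity (Cmul (Cadd (mmul n N (msub (mscale (gamma t) mid) X) i k) (mmul n N (shift l) i k)) (Rs t k j)); [ring|].
  transitivity (Cmul (Cmul (Csub (gamma t) l) (N i k)) (Rs t k j)); [f_equal|ring].
  unfold mmul, shift; rewrite <- csum_add.
  rewrite (csum_ext n _ (fun m => Cmul (Csub (gamma t) l) (Cmul (mid k m) (N i m)))).
  - rewrite csum_mul_l, csum_delta by assumption; reflexivity.
  - intros m hm; unfold msub, mscale, mid; rewrite (Nat.eqb_sym k m); ring. }
rewrite S; field; assumption.
Qed.

(** The expansion stops because the matrix in front of the last remainder is the full product, which
    is zero. *)
Lemma resf_correct ls : (forall l, In l ls -> encircled l) -> forall N t,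
  meq n (shift_prod N ls) (fun _ _ => C0) -> meq n (mmul n N (Rs t)) (resf N ls (gamma t)).
Proof.
induction ls as [|l ls IH]; intros Hls N t HN i j hi hj.
- simpl in *; unfold mmul; rewrite (csum_ext n _ (fun _ => C0)); [apply csum_0|].
  intros k hk; rewrite HN by assumption; ring.
- simpl in HN; rewrite (shift_resolvent l t) by (auto; apply Hls; left; reflexivity).
  simpl; unfold mscale, madd; do 2 f_equal.
  apply IH; auto; intros; apply Hls; right; assumption.
Qed.

Lemma prodinv_app_cons ls l z : prodinv (ls ++ l :: nil) z = Cmul (prodinv ls z) (Cinv (Csub z l)).
Proof. induction ls; simpl; [ring|rewrite IHls; ring]. Qed.

(** [pre] collects the poles already met. Every term with two or more poles integrates to 0, so only
    the leading coefficient, reached with [pre] empty, survives. *)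
Lemma RI01_resf ls : (forall l, In l ls -> encircled l) -> forall pre N i j,
  (forall l, In l pre -> encircled l) ->
  RI01 (fun t => Cmul (gamma' t) (Cmul (prodinv pre (gamma t)) (resf N ls (gamma t) i j)))
       (match pre, ls with nil, _ :: _ => Cmul two_pi_i (N i j) | _, _ => C0 end).
Proof.
induction ls as [|l ls IH]; intros Hls pre N i j Hpre.
- apply (RI01_eq _ C0); [destruct pre; reflexivity|].
  eapply RI01_ext; [|exact RI01_zero]; intros t; simpl; ring.
- assert (Hl : encircled l) by (apply Hls; left; reflexivity).
  assert (Hls' : forall m, In m ls -> encircled m) by (intros; apply Hls; right; assumption).
  assert (Hp' : forall m, In m (pre ++ l :: nil) -> encircled m).
  { intros m hm; apply in_app_iff in hm; destruct hm as [hm|[<-|[]]]; auto. }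
  pose proof (IH Hls' (pre ++ l :: nil) (mmul n N (shift l)) i j Hp') as h1.
  assert (h1' : RI01 (fun t => Cmul (gamma' t) (Cmul (prodinv (pre ++ l :: nil) (gamma t)) (resf (mmul n N (shift l)) ls (gamma t) i j))) C0).
  { eapply RI01_eq; [|exact h1]; destruct pre; reflexivity. }
  assert (h2 : RI01 (fun t => Cmul (gamma' t) (prodinv (pre ++ l :: nil) (gamma t))) (winding_value (length pre))).
  { destruct pre as [|m pre]; [exact (RI01_prodinv l nil Hl (fun m hm => match hm with end))|].
    apply (RI01_eq _ (winding_value (length (pre ++ l :: nil)))); [rewrite length_app, Nat.add_comm; reflexivity|].
    apply (RI01_prodinv m (pre ++ l :: nil)); [apply Hpre; left; reflexivity|].
    intros u hu; apply Hp'; right; exact hu. }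
  pose proof (RI01_add _ _ _ _ (RI01_mul_l (N i j) _ _ h2) h1') as h3.
  apply (RI01_eq _ (Cadd (Cmul (N i j) (winding_value (length pre))) C0)).
  { destruct pre; simpl; ring. }
  eapply RI01_ext; [|exact h3].
  intros t; cbv beta; rewrite prodinv_app_cons; simpl; unfold mscale, madd; ring.
Qed.

Variable ls : list Cx.
Hypothesis Hls : forall l, In l ls -> encircled l.
Hypothesis Hann : meq n (shift_prod mid ls) (fun _ _ => C0).

Lemma resolvent_eq t : meq n (Rs t) (resf mid ls (gamma t)).
Proof.
intros i j hi hj; rewrite <- (resf_correct ls Hls mid t Hann i j hi hj).
unfold mmul; rewrite csum_delta by assumption; reflexivity.
Qed.

(** Normalization of the calculus: the constant function 1 gives the identity matrix, derived from
    the winding at the eigenvalues alone. *)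
Lemma RI01_resolvent i j : (i < n)%nat -> (j < n)%nat ->
  RI01 (fun t => Cmul (gamma' t) (Rs t i j)) (Cmul two_pi_i (mid i j)).
Proof.
intros hi hj.
pose proof (RI01_resf ls Hls nil mid i j (fun l h => match h with end)) as h.
assert (h2 : RI01 (fun t => Cmul (gamma' t) (Rs t i j)) (match ls with nil => C0 | _ :: _ => Cmul two_pi_i (mid i j) end)).
{ eapply RI01_ext; [|exact h]; intros t; cbv beta; rewrite (resolvent_eq t i j hi hj); simpl; ring. }
eapply RI01_eq; [|exact h2]; pose proof Hann as Ha; clear h h2; destruct ls as [|l l']; [|reflexivity].
(* An empty list would make the identity matrix vanish, impossible since the index i exists. *)
exfalso; specialize (Ha i i hi hi); simpl in Ha; unfold mid in Ha; rewrite Nat.eqb_refl in Ha.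
exact (C1_neq_C0 Ha).
Qed.

Lemma resf_C0 l : (forall m, In m l -> encircled m) -> forall N i j, curve_C0 (fun t => resf N l (gamma t) i j).
Proof.
induction l as [|m l IH]; intros H N i j; simpl; [apply curve_C0_const|].
unfold mscale, madd.
apply curve_C0_mul; [apply encircled_inv_C0, H; left; reflexivity|].
apply curve_C0_add; [apply curve_C0_const|apply IH; intros; apply H; right; assumption].
Qed.

(** [Rs] is given pointwise, without continuity; the rational form provides it, hence the bound that
    the final error estimate uses. *)
Lemma resolvent_bounded i j : (i < n)%nat -> (j < n)%nat ->
  exists M, 0 < M /\ forall t, 0 <= t <= 1 -> Cmod (Cmul (Rs t i j) (gamma' t)) <= M.
Proof.
intros hi hj.
destruct (curve_C0_bounded _ (curve_C0_mul _ _ (resf_C0 ls Hls mid i j) gC0)) as [M [Mp HM]].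
exists M; split; [assumption|intros t ht]; rewrite (resolvent_eq t i j hi hj); apply HM, ht.
Qed.

(* With B = (X + s)^-1 one has (z + s)^-1 (z - X)^-1 = B ((z - X)^-1 - (z + s)^-1), and the last
   term integrates to 0 since the logarithm is a primitive on the slit plane. *)
Lemma RI01_kern_resolvent s B i j : 0 < s ->
  meq n (mmul n B (madd X (mscale (RtoC s) mid))) mid -> (i < n)%nat -> (j < n)%nat ->
  RI01 (fun t => Cmul (Cmul (kern s (gamma t)) (Rs t i j)) (gamma' t))
       (Cmul two_pi_i (Cmul (RtoC (1 + s)) (Csub (mid i j) (Cmul (RtoC s) (B i j))))).
Proof.
intros sp HB hi hj.
assert (nz : forall t, Cadd (gamma t) (RtoC s) <> C0) by (intros; apply in_D_add_pos; auto).
assert (E : forall t, Cmul (Cinv (Cadd (gamma t) (RtoC s))) (Rs t i j) =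
   csum n (fun k => Cmul (B i k) (Csub (Rs t k j) (Cmul (mid k j) (Cinv (Cadd (gamma t) (RtoC s))))))).
{ intros t; set (c := Cadd (gamma t) (RtoC s)) in *.
  assert (T1 : mmul n (mmul n B (madd X (mscale (RtoC s) mid))) (Rs t) i j = Rs t i j).
  { unfold mmul at 1; rewrite (csum_ext n _ (fun k => Cmul (mid i k) (Rs t k j))).
    - exact (csum_delta n (fun k => Rs t k j) i hi).
    - intros k hk; rewrite HB by assumption; reflexivity. }
  rewrite mmul_assoc in T1.
  rewrite <- T1; unfold mmul at 1; rewrite <- csum_mul_l; apply csum_ext; intros k hk.
  assert (T2 : mmul n (madd X (mscale (RtoC s) mid)) (Rs t) k j = Csub (Cmul c (Rs t k j)) (mid k j)).
  { rewrite <- (HRs t k j hk hj).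
    replace (Cmul c (Rs t k j)) with (csum n (fun m => Cmul (mid k m) (Cmul c (Rs t m j))))
      by (apply csum_delta; assumption).
    unfold mmul; rewrite <- csum_sub; apply csum_ext; intros m hm.
    unfold madd, msub, mscale, c; ring. }
  rewrite T2; unfold c; field; apply nz. }
pose proof (RI01_csum n (fun k t => Cmul (B i k) (Cadd (Cmul (gamma' t) (Rs t k j))
    (Cmul (Copp (mid k j)) (Cmul (gamma' t) (Cinv (Cadd (gamma t) (RtoC s))))))) 
    (fun k => Cmul (B i k) (Cadd (Cmul two_pi_i (mid k j)) (Cmul (Copp (mid k j)) C0)))) as h.
assert (h' := h (fun k hk => RI01_mul_l (B i k) _ _ (RI01_add _ _ _ _ (RI01_resolvent k j hk hj)
   (RI01_mul_l (Copp (mid k j)) _ _ (RI01_inv_shift s (Rlt_le _ _ sp)))))).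
pose proof (RI01_mul_l (RtoC (1 + s)) _ _ (RI01_add _ _ _ _ (RI01_resolvent i j hi hj)
   (RI01_mul_l (Copp (RtoC s)) _ _ h'))) as H.
eapply RI01_eq; [|eapply RI01_ext; [|exact H]].
- replace (csum n (fun k => Cmul (B i k) (Cadd (Cmul two_pi_i (mid k j)) (Cmul (Copp (mid k j)) C0))))
    with (Cmul two_pi_i (B i j)); [ring|].
  rewrite <- (csum_delta n (fun k => B i k) j hj), <- csum_mul_l; apply csum_ext; intros k hk.
  unfold mid; rewrite (Nat.eqb_sym j k); ring.
- intros t; cbv beta.
  replace (kern s (gamma t)) with (Cmul (RtoC (1 + s)) (Csub C1 (Cmul (RtoC s) (Cinv (Cadd (gamma t) (RtoC s))))))
    by (unfold kern; field; apply nz).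
  transitivity (Cmul (RtoC (1 + s)) (Csub (Cmul (gamma' t) (Rs t i j))
     (Cmul (RtoC s) (Cmul (gamma' t) (Cmul (Cinv (Cadd (gamma t) (RtoC s))) (Rs t i j)))))); [|ring].
  rewrite E.
  match goal with |- Cmul _ (Cadd _ (Cmul _ ?L)) = Cmul _ (Csub _ (Cmul _ (Cmul _ ?Q))) =>
    replace L with (Cmul (gamma' t) Q); [ring|] end.
  rewrite <- csum_mul_l; apply csum_ext; intros k hk; ring.
Qed.
End Contour.

End ContourIntegrals.

(** * Inner products, quadratic forms and rank-one decompositions *)

Module Vectors.
Import ComplexNumbers.
Local Open Scope R_scope.

Fixpoint rsum (k : nat) (g : nat -> R) : R :=
  match k with O => 0 | S k' => rsum k' g + g k' end.

Lemma re_csum k g : re (csum k g) = rsum k (fun i => re (g i)).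
Proof. induction k; simpl; [reflexivity|rewrite IHk; reflexivity]. Qed.
Lemma csum_RtoC k g : csum k (fun i => RtoC (g i)) = RtoC (rsum k g).
Proof. induction k; simpl; [reflexivity|rewrite IHk; symmetry; apply RtoC_add]. Qed.
Lemma rsum_ext k g h : (forall i, (i < k)%nat -> g i = h i) -> rsum k g = rsum k h.
Proof.
induction k; intros H; simpl; [reflexivity|rewrite IHk by (intros; apply H; lia); rewrite H by lia; reflexivity].
Qed.
Lemma rsum_le k g h : (forall i, (i < k)%nat -> g i <= h i) -> rsum k g <= rsum k h.
Proof.
induction k; intros H; simpl; [lra|apply Rplus_le_compat; [apply IHk; intros; apply H; lia|apply H; lia]].
Qed.
Lemma rsum_add k g h : rsum k (fun i => g i + h i) = rsum k g + rsum k h.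
Proof. induction k; simpl; [ring|rewrite IHk; ring]. Qed.
Lemma rsum_scal k c g : rsum k (fun i => c * g i) = c * rsum k g.
Proof. induction k; simpl; [ring|rewrite IHk; ring]. Qed.
Lemma rsum_nonneg k g : (forall i, (i < k)%nat -> 0 <= g i) -> 0 <= rsum k g.
Proof.
induction k; intros H; simpl; [lra|apply Rplus_le_le_0_compat; [apply IHk; intros; apply H; lia|apply H; lia]].
Qed.
Lemma rsum_term_le k g i : (forall j, (j < k)%nat -> 0 <= g j) -> (i < k)%nat -> g i <= rsum k g.
Proof.
induction k; intros H hi; [lia|simpl].
assert (0 <= g k) by (apply H; lia).
assert (0 <= rsum k g) by (apply rsum_nonneg; intros; apply H; lia).
destruct (Nat.eq_dec i k) as [->|ne]; [lra|].
assert (g i <= rsum k g) by (apply IHk; [intros; apply H; lia|lia]); lra.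
Qed.

Definition ip (n : nat) (u w : nat -> Cx) : Cx := csum n (fun i => Cmul (Cconj (u i)) (w i)).
Definition mv (n : nat) (M : Mat) (x : nat -> Cx) : nat -> Cx := fun i => csum n (fun j => Cmul (M i j) (x j)).

Lemma quad_ip n M x : quad n M x = ip n x (mv n M x).
Proof. reflexivity. Qed.

Lemma ip_ext n u u' w w' : (forall i, (i < n)%nat -> u i = u' i) -> (forall i, (i < n)%nat -> w i = w' i) ->
  ip n u w = ip n u' w'.
Proof. intros H K; apply csum_ext; intros i hi; rewrite H, K by assumption; reflexivity. Qed.
Lemma mv_ext n M M' x x' : meq n M M' -> (forall i, (i < n)%nat -> x i = x' i) ->
  forall i, (i < n)%nat -> mv n M x i = mv n M' x' i.
Proof. intros H K i hi; apply csum_ext; intros j hj; rewrite H, K by assumption; reflexivity. Qed.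

Lemma Cconj_mul z w : Cconj (Cmul z w) = Cmul (Cconj z) (Cconj w). Proof. cx. Qed.
Lemma Cconj_add z w : Cconj (Cadd z w) = Cadd (Cconj z) (Cconj w). Proof. cx. Qed.
Lemma Cconj_sub z w : Cconj (Csub z w) = Csub (Cconj z) (Cconj w). Proof. cx. Qed.
Lemma Cconj_conj z : Cconj (Cconj z) = z. Proof. cx. Qed.
Lemma Cconj_RtoC x : Cconj (RtoC x) = RtoC x. Proof. cx. Qed.
Lemma Cnorm2_conj_mul z : Cmul (Cconj z) z = RtoC (Cnorm2 z). Proof. unfold Cnorm2; cx. Qed.

Lemma ip_conj n u w : Cconj (ip n u w) = ip n w u.
Proof.
unfold ip; rewrite <- csum_conj; apply csum_ext; intros; rewrite Cconj_mul, Cconj_conj; ring.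
Qed.
Lemma re_ip_sym n u w : re (ip n u w) = re (ip n w u).
Proof. rewrite <- (ip_conj n w u); reflexivity. Qed.
Lemma ip_add_r n u w w' : ip n u (fun i => Cadd (w i) (w' i)) = Cadd (ip n u w) (ip n u w').
Proof. unfold ip; rewrite <- csum_add; apply csum_ext; intros; ring. Qed.
Lemma ip_sub_r n u w w' : ip n u (fun i => Csub (w i) (w' i)) = Csub (ip n u w) (ip n u w').
Proof. unfold ip; rewrite <- csum_sub; apply csum_ext; intros; ring. Qed.
Lemma ip_mul_r n u c w : ip n u (fun i => Cmul c (w i)) = Cmul c (ip n u w).
Proof. unfold ip; rewrite <- csum_mul_l; apply csum_ext; intros; ring. Qed.
Lemma ip_add_l n u u' w : ip n (fun i => Cadd (u i) (u' i)) w = Cadd (ip n u w) (ip n u' w).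
Proof. unfold ip; rewrite <- csum_add; apply csum_ext; intros; rewrite Cconj_add; ring. Qed.
Lemma ip_sub_l n u u' w : ip n (fun i => Csub (u i) (u' i)) w = Csub (ip n u w) (ip n u' w).
Proof. unfold ip; rewrite <- csum_sub; apply csum_ext; intros; rewrite Cconj_sub; ring. Qed.
Lemma ip_mul_l n u c w : ip n (fun i => Cmul c (u i)) w = Cmul (Cconj c) (ip n u w).
Proof. unfold ip; rewrite <- csum_mul_l; apply csum_ext; intros; rewrite Cconj_mul; ring. Qed.
Lemma ip_self n u : ip n u u = RtoC (rsum n (fun i => Cnorm2 (u i))).
Proof. unfold ip; rewrite <- csum_RtoC; apply csum_ext; intros; apply Cnorm2_conj_mul. Qed.
Lemma ip_self_nonneg n u : 0 <= re (ip n u u).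
Proof. rewrite ip_self; simpl; apply rsum_nonneg; intros; apply Cnorm2_nonneg. Qed.
Lemma ip_self_pos n u : nonzero_vec n u -> 0 < re (ip n u u).
Proof.
intros [i [hi nz]]; rewrite ip_self; simpl.
eapply Rlt_le_trans; [exact (Cnorm2_pos _ nz)|].
apply (rsum_term_le n (fun i => Cnorm2 (u i)) i); [intros; apply Cnorm2_nonneg|assumption].
Qed.
Lemma ip_adj n M u w : ip n u (mv n M w) = ip n (mv n (madj M) u) w.
Proof.
unfold ip, mv.
rewrite (csum_ext n _ (fun i => csum n (fun j => Cmul (Cconj (u i)) (Cmul (M i j) (w j)))))
  by (intros; symmetry; apply csum_mul_l).
rewrite csum_swap; apply csum_ext; intros j hj.
rewrite <- csum_conj, <- csum_mul_r; apply csum_ext; intros i hi.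
unfold madj; rewrite Cconj_mul, Cconj_conj; ring.
Qed.
Lemma mv_id n x i : (i < n)%nat -> mv n mid x i = x i.
Proof. intros hi; exact (csum_delta n x i hi). Qed.
Lemma mv_add n A B x i : mv n (madd A B) x i = Cadd (mv n A x i) (mv n B x i).
Proof. unfold mv, madd; rewrite <- csum_add; apply csum_ext; intros; ring. Qed.
Lemma mv_sub n A B x i : mv n (msub A B) x i = Csub (mv n A x i) (mv n B x i).
Proof. unfold mv, msub; rewrite <- csum_sub; apply csum_ext; intros; ring. Qed.
Lemma mv_scale n c A x i : mv n (mscale c A) x i = Cmul c (mv n A x i).
Proof. unfold mv, mscale; rewrite <- csum_mul_l; apply csum_ext; intros; ring. Qed.
Lemma mv_vec_add n A x y i : mv n A (fun k => Cadd (x k) (y k)) i = Cadd (mv n A x i) (mv n A y i).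
Proof. unfold mv; rewrite <- csum_add; apply csum_ext; intros; ring. Qed.
Lemma mv_vec_sub n A x y i : mv n A (fun k => Csub (x k) (y k)) i = Csub (mv n A x i) (mv n A y i).
Proof. unfold mv; rewrite <- csum_sub; apply csum_ext; intros; ring. Qed.
Lemma mv_vec_mul n A c x i : mv n A (fun k => Cmul c (x k)) i = Cmul c (mv n A x i).
Proof. unfold mv; rewrite <- csum_mul_l; apply csum_ext; intros; ring. Qed.
Lemma mv_mul n A B x i : mv n (mmul n A B) x i = mv n A (mv n B x) i.
Proof.
unfold mv, mmul.
rewrite (csum_ext n _ (fun j => csum n (fun k => Cmul (Cmul (A i k) (B k j)) (x j))))
  by (intros; symmetry; apply csum_mul_r).
rewrite csum_swap; apply csum_ext; intros k hk.
rewrite <- csum_mul_l; apply csum_ext; intros; ring.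
Qed.

Lemma quad_ext n A B x : meq n A B -> quad n A x = quad n B x.
Proof. intros H; apply ip_ext; [reflexivity|apply mv_ext; [assumption|reflexivity]]. Qed.
Lemma quad_vec_ext n A x y : (forall i, (i < n)%nat -> x i = y i) -> quad n A x = quad n A y.
Proof. intros H; rewrite !quad_ip; apply ip_ext; [assumption|apply mv_ext; [intros i j _ _; reflexivity|assumption]]. Qed.
Lemma quad_add n A B x : quad n (madd A B) x = Cadd (quad n A x) (quad n B x).
Proof. rewrite !quad_ip, <- ip_add_r; apply ip_ext; intros; [reflexivity|apply mv_add]. Qed.
Lemma quad_sub n A B x : quad n (msub A B) x = Csub (quad n A x) (quad n B x).
Proof. rewrite !quad_ip, <- ip_sub_r; apply ip_ext; intros; [reflexivity|apply mv_sub]. Qed.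
Lemma quad_scale n c A x : quad n (mscale c A) x = Cmul c (quad n A x).
Proof. rewrite !quad_ip, <- ip_mul_r; apply ip_ext; intros; [reflexivity|apply mv_scale]. Qed.
Lemma quad_adj n A x : quad n (madj A) x = Cconj (quad n A x).
Proof.
rewrite !quad_ip, ip_adj, ip_conj; apply ip_ext; [|reflexivity].
apply mv_ext; [|reflexivity]; intros i j _ _; unfold madj; apply Cconj_conj.
Qed.
Lemma quad_id n x : quad n mid x = ip n x x.
Proof. rewrite quad_ip; apply ip_ext; [reflexivity|intros; apply mv_id; assumption]. Qed.
Lemma re_quad_ReM n A x : re (quad n (ReM A) x) = re (quad n A x).
Proof. unfold ReM; rewrite quad_scale, quad_add, quad_adj; simpl; field. Qed.

Lemma hermitian_ReM n A : hermitian n (ReM A).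
Proof.
intros i j _ _; unfold ReM, mscale, madd, madj; apply Cx_ext; simpl; field.
Qed.
Lemma hermitian_sub n A B : hermitian n A -> hermitian n B -> hermitian n (msub A B).
Proof.
intros hA hB i j hi hj; unfold msub, madj; rewrite (hA i j hi hj), (hB i j hi hj).
unfold madj; rewrite Cconj_sub; reflexivity.
Qed.
Lemma hermitian_scale n c A : hermitian n A -> hermitian n (mscale (RtoC c) A).
Proof.
intros hA i j hi hj; unfold mscale, madj; rewrite (hA i j hi hj); unfold madj; rewrite Cconj_mul, Cconj_RtoC; reflexivity.
Qed.
Lemma hermitian_ext n A B : meq n A B -> hermitian n A -> hermitian n B.
Proof.
intros E H i j hi hj; unfold madj; rewrite <- (E i j hi hj), <- (E j i hj hi); apply H; assumption.
Qed.
Lemma hermitian_quad_real n A x : hermitian n A -> im (quad n A x) = 0.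
Proof.
intros H; pose proof (quad_adj n A x) as e; rewrite <- (quad_ext n A (madj A) x H) in e.
apply (f_equal im) in e; simpl in e; lra.
Qed.
Lemma hermitian_ip n A u w : hermitian n A -> ip n u (mv n A w) = ip n (mv n A u) w.
Proof.
intros H; rewrite ip_adj; apply ip_ext; [|reflexivity].
apply mv_ext; [|reflexivity]; intros i j hi hj; symmetry; apply H; assumption.
Qed.

Definition col (U : Mat) (i : nat) : nat -> Cx := fun k => U k i.
(** Spectral decompositions are written as sums of these rank-one positive matrices, since a linear
    map can be applied to such a sum term by term and positivity can be used on each term. *)
Definition proj (U : Mat) (i : nat) : Mat := fun a b => Cmul (U a i) (Cconj (U b i)).

Lemma mv_proj n U i x a : mv n (proj U i) x a = Cmul (U a i) (ip n (col U i) x).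
Proof. unfold mv, proj, ip, col; rewrite <- csum_mul_l; apply csum_ext; intros; ring. Qed.
Lemma hermitian_proj n U i : hermitian n (proj U i).
Proof. intros a b _ _; unfold proj, madj; rewrite Cconj_mul, Cconj_conj; ring. Qed.
Lemma quad_proj n U i x : quad n (proj U i) x = RtoC (Cnorm2 (ip n (col U i) x)).
Proof.
rewrite quad_ip.
rewrite (ip_ext n x x _ (fun a => Cmul (ip n (col U i) x) (col U i a)));
  [|reflexivity|intros; rewrite mv_proj; unfold col; ring].
rewrite ip_mul_r, <- (ip_conj n (col U i) x), <- Cnorm2_conj_mul; ring.
Qed.
Lemma psd_proj n U i : psd n (proj U i).
Proof. split; [apply hermitian_proj|intros x; rewrite quad_proj; apply Cnorm2_nonneg]. Qed.

Definition msum (k : nat) (M : nat -> Mat) : Mat := fun a b => csum k (fun l => M l a b).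

Lemma quad_msum n k c M x : quad n (msum k (fun l => mscale (RtoC (c l)) (M l))) x =
  csum k (fun l => Cmul (RtoC (c l)) (quad n (M l) x)).
Proof.
induction k as [|k IH].
- unfold msum, quad; simpl.
  rewrite (csum_ext n _ (fun _ => C0)); [apply csum_0|intros i _].
  rewrite (csum_ext n _ (fun _ => C0)) by (intros; ring); rewrite csum_0; ring.
- simpl; rewrite <- IH, <- quad_scale, <- quad_add; apply quad_ext; intros i j _ _; reflexivity.
Qed.

Lemma hermitian_msum n k c M : (forall l, (l < k)%nat -> hermitian n (M l)) ->
  hermitian n (msum k (fun l => mscale (RtoC (c l)) (M l))).
Proof.
intros H i j hi hj; unfold msum, madj; rewrite <- csum_conj; apply csum_ext; intros l hl.
apply (hermitian_scale n (c l) (M l) (H l hl)); assumption.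
Qed.

Lemma mmul_rdiag n U d i j : (j < n)%nat -> mmul n U (rdiag d) i j = Cmul (U i j) (RtoC (d j)).
Proof.
intros hj; unfold mmul.
rewrite (csum_ext n _ (fun k => Cmul (mid j k) (Cmul (U i k) (RtoC (d k))))).
- exact (csum_delta n (fun k => Cmul (U i k) (RtoC (d k))) j hj).
- intros k hk; unfold rdiag, mid; rewrite (Nat.eqb_sym j k); destruct (Nat.eqb k j); ring.
Qed.

Lemma udu_msum n U d : meq n (mmul n (mmul n U (rdiag d)) (madj U))
  (msum n (fun l => mscale (RtoC (d l)) (proj U l))).
Proof.
intros i j hi hj; unfold mmul at 1, msum; apply csum_ext; intros l hl.
rewrite mmul_rdiag by assumption; unfold mscale, proj, madj; ring.
Qed.

Lemma quad_udu n U d x : quad n (mmul n (mmul n U (rdiag d)) (madj U)) x =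
  RtoC (rsum n (fun l => d l * Cnorm2 (ip n (col U l) x))).
Proof.
rewrite (quad_ext _ _ _ _ (udu_msum n U d)), quad_msum, <- csum_RtoC; apply csum_ext; intros l hl.
rewrite quad_proj, RtoC_mul; reflexivity.
Qed.

Lemma quad_rdiag n d x : quad n (rdiag d) x = RtoC (rsum n (fun l => d l * Cnorm2 (x l))).
Proof.
rewrite <- csum_RtoC; unfold quad; apply csum_ext; intros i hi.
rewrite (csum_ext n _ (fun j => Cmul (mid i j) (Cmul (RtoC (d i)) (x j)))).
- rewrite (csum_delta n (fun j => Cmul (RtoC (d i)) (x j)) i hi), RtoC_mul, <- Cnorm2_conj_mul; ring.
- intros j hj; unfold rdiag, mid; destruct (Nat.eqb i j); ring.
Qed.

Lemma hermitian_rdiag n d : hermitian n (rdiag d).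
Proof.
intros i j _ _; unfold madj, rdiag; rewrite (Nat.eqb_sym j i).
destruct (Nat.eqb_spec i j) as [->|]; [rewrite Cconj_RtoC; reflexivity|cx].
Qed.

End Vectors.

(** * Polynomials nonnegative on the half-line *)

Module Loewner.
From HB Require Import structures.
From mathcomp Require Import all_boot all_order all_algebra archimedean boolp reals.
From mathcomp Require Import complex polyrcf polyorder Rstruct ring lra zify.
Import Defs ComplexNumbers Vectors IdentityTheorem ContourIntegrals.
Set Implicit Arguments.
Unset Strict Implicit.
Unset Printing Implicit Defensive.
Import Order.TTheory GRing.Theory Num.Theory.
Local Open Scope ring_scope.

Section Lukacs.
Variable R : rcfType.
Implicit Types p q r : {poly R}.

(** The index bounds the degree of every generator, not just of the sum, so no terms of high degree
    can cancel: the duality argument feeds each generator separately into an inequality of limited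
    degree. The bit b is the exponent of X. *)
Inductive sosx : nat -> {poly R} -> Prop :=
| sosx0 d : sosx d 0
| sosxD d p q : sosx d p -> sosx d q -> sosx d (p + q)
| sosxG d (b : bool) (c : R) r : 0 <= c -> ((size r).-1.*2 + b <= d)%N ->
    sosx d (c *: ('X ^+ b * r ^+ 2)).

(** Products of generators are generators, the case of two odd ones being X r^2 X r'^2 = (X r
    r')^2. *)
Lemma sosxM d e p q : sosx d p -> sosx e q -> sosx (d + e) (p * q).
Proof.
move=> dp; elim: dp e q => {d p}
  [d e q _|d p p' _ IHp _ IHp' e q eq|d b c r c0 dr e q eq].
- by rewrite mul0r; exact: sosx0.
- by rewrite mulrDl; apply: sosxD; [exact: IHp|exact: IHp'].
elim: eq => {e q} [e|e q q' _ IHq _ IHq'|e b' c' r' c'0 er'].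
- by rewrite mulr0; exact: sosx0.
- by rewrite mulrDr; exact: sosxD.
rewrite -scalerAl -scalerAr scalerA.
have sM : ((size (r * r')%R).-1 <= (size r).-1 + (size r').-1)%N.
  have [->|r0] := eqVneq r 0; first by rewrite mul0r size_poly0.
  have [->|r'0] := eqVneq r' 0; first by rewrite mulr0 size_poly0.
  rewrite size_mul //; move: r0 r'0; rewrite -!size_poly_gt0.
  by case: (size r) => // a _; case: (size r') => // a' _; rewrite addSn addnS.
have cc : 0 <= c * c' by exact: mulr_ge0.
case: b b' dr er' => [] [] dr er'; rewrite ?expr0 ?expr1 ?mul1r.
- have -> : 'X * r ^+ 2 * ('X * r' ^+ 2) = 'X ^+ false * ('X * (r * r')) ^+ 2.
    by rewrite expr0; ring.
  apply: sosxG => //; rewrite addn0.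
  have [->|rr0] := eqVneq (r * r') 0; first by rewrite mulr0 size_poly0.
  rewrite mulrC size_mulX //=; rewrite -(prednK (n := size (r * r'))) ?size_poly_gt0 //.
  by move: sM dr er'; rewrite -!muln2; lia.
- have -> : 'X * r ^+ 2 * r' ^+ 2 = 'X ^+ true * (r * r') ^+ 2 by rewrite expr1; ring.
  by apply: sosxG => //; move: sM dr er'; rewrite -!muln2; lia.
- have -> : r ^+ 2 * ('X * r' ^+ 2) = 'X ^+ true * (r * r') ^+ 2 by rewrite expr1; ring.
  by apply: sosxG => //; move: sM dr er'; rewrite -!muln2; lia.
- have -> : r ^+ 2 * r' ^+ 2 = 'X ^+ false * (r * r') ^+ 2 by rewrite expr0; ring.
  by apply: sosxG => //; move: sM dr er'; rewrite -!muln2; lia.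
Qed.

Lemma poly_ge0_closure p a :
  (forall d, 0 < d -> exists2 t, `|t - a| < d & 0 <= p.[t]) -> 0 <= p.[a].
Proof.
move=> H; rewrite leNgt; apply/negP => pa.
have [d d0 Hd] := poly_cont a p (e := - p.[a]) ltac:(by rewrite oppr_gt0).
have [t td pt] := H d d0; have := Hd t td.
by rewrite ltr_norml => /andP[_]; lra.
Qed.


(** The remainder modulo the quadratic is real of degree at most 1 and vanishes at a nonreal point,
    so both its coefficients are zero. *)
Lemma root_complex_dvdp p a b : b != 0 -> root (map_poly (real_complex R) p) (a +i* b)%C ->
  ('X - a%:P) ^+ 2 + (b ^+ 2)%:P %| p.
Proof.
move=> b0 pz; set Q := _ + _.
have sQ : size Q = 3%N.
  rewrite size_polyDl; first by rewrite size_exp_XsubC.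
  by rewrite size_exp_XsubC (leq_ltn_trans (size_polyC_leq1 _)).
have Q0 : Q != 0 by rewrite -size_poly_eq0 sQ.
have Qz : root (map_poly (real_complex R) Q) (a +i* b)%C.
  rewrite /root rmorphD rmorphXn rmorphB /= map_polyX !map_polyC /= !hornerE.
  by apply/eqP; simpc; congr (_ +i* _)%C; ring.
have sr : (size (p %% Q)%R <= 2)%N by rewrite -ltnS -sQ ltn_modp.
have rz : (map_poly (real_complex R) (p %% Q)).[(a +i* b)%C] = 0.
  move: pz; rewrite [X in root (map_poly _ X)](divp_eq p Q) /root rmorphD rmorphM /= hornerD hornerM.
  by rewrite (rootP Qz) mulr0 add0r => /eqP.
apply/modp_eq0P.
have rE : p %% Q = ((p %% Q)`_0)%:P + (p %% Q)`_1 *: 'X.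
  apply/polyP => i; rewrite coefD coefC coefZ coefX.
  case: i => [|[|i]] /=; rewrite ?mulr0 ?addr0 ?mulr1 ?add0r //.
  by apply/(nth_default 0)/(leq_trans sr).
move: rz; rewrite rE rmorphD /= map_polyZ map_polyX map_polyC /= !hornerE.
simpc => -[] e1 e2.
have c1 : (p %% Q)`_1 = 0 by apply/eqP; move/eqP: e2; rewrite mulf_eq0 (negPf b0) orbF.
by move: e1; rewrite c1 mul0r addr0 => ->; rewrite polyC0 scale0r addr0.
Qed.

(** Lukacs's theorem by strong induction on the size, removing one complex root at a time with a
    factor from the cone: a nonreal root gives (X - a)^2 + b^2, a real root a <= 0 gives X + (-a),
    and a root a > 0 must be double and gives (X - a)^2. *)
Lemma nonneg_sosx p : (forall t, 0 < t -> 0 <= p.[t]) -> sosx (size p).-1 p.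
Proof.
have [n] := ubnP (size p); elim: n p => // n IHn p; rewrite ltnS => sp p0.
have [sp1|sp1] := leqP (size p) 1.
  rewrite (size1_polyC sp1); set c := p`_0.
  have c0 : 0 <= c by have := p0 1 ltr01; rewrite (size1_polyC sp1) hornerC.
  have -> : c%:P = c *: ('X ^+ false * 1 ^+ 2) by rewrite expr0 expr1n mulr1 -alg_polyC.
  by apply: sosxG => //; rewrite size_poly1.
have pN0 : p != 0 by rewrite -size_poly_gt0 (ltn_trans _ sp1).
have step Q q e : p = q * Q -> size Q = e.+1 -> (0 < e)%N -> sosx e Q ->
    (forall t, 0 < t -> 0 <= q.[t]) -> sosx (size p).-1 p.
  move=> pE sQ e0 sosQ q0.
  have qN0 : q != 0 by apply: contraNneq pN0 => q0'; rewrite pE q0' mul0r.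
  have QN0 : Q != 0 by rewrite -size_poly_gt0 sQ.
  have spE : size p = (size q + e)%N by rewrite pE size_mul // sQ addnS.
  have sq : (0 < size q)%N by rewrite size_poly_gt0.
  have -> : (size p).-1 = ((size q).-1 + e)%N by rewrite spE; lia.
  by rewrite pE; apply: sosxM => //; apply: IHn => //; lia.
have gen (b : bool) r d : ((size r).-1.*2 + b <= d)%N -> sosx d ('X ^+ b * r ^+ 2).
  by move=> h; rewrite -[X in sosx _ X]scale1r; apply: sosxG.
have [z pz] : exists z, root (map_poly (real_complex R) p) z.
  by apply/closed_rootP; rewrite size_map_poly; case: (size p) sp1 => [|[]].
case: z pz => a b pz; have [b0|b0] := eqVneq b 0; last first.
  have /dvdpP [q pE] := root_complex_dvdp b0 pz.
  apply: (step _ q 2 pE) => //.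
  - rewrite size_polyDl; first by rewrite size_exp_XsubC.
    by rewrite size_exp_XsubC (leq_ltn_trans (size_polyC_leq1 _)).
  - have -> : ('X - a%:P) ^+ 2 + (b ^+ 2)%:P =
      'X ^+ false * ('X - a%:P) ^+ 2 + 'X ^+ false * (b%:P) ^+ 2.
      by rewrite expr0 !mul1r polyC_exp.
    apply: sosxD; apply: gen; first by rewrite size_XsubC.
    by rewrite size_polyC; case: (b != 0).
  - move=> t t0; have := p0 t t0; rewrite pE hornerM pmulr_lge0 //.
    by rewrite !hornerE ltr_wpDl ?sqr_ge0 // exprn_even_gt0.
have pa : root p a.
  move: pz; rewrite b0 -[(a +i* 0)%C]/(real_complex R a) /root horner_map.
  by rewrite fmorph_eq0.
have /factor_theorem [q pE] := pa.
have [a0|a0] := leP a 0.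
  apply: (step _ q 1 pE); rewrite ?size_XsubC //.
  - have -> : 'X - a%:P = 1 *: ('X ^+ true * 1 ^+ 2) + (- a) *: ('X ^+ false * 1 ^+ 2) :> {poly R}.
      by rewrite expr0 expr1 expr1n !mulr1 scale1r -alg_polyC scaleNr.
    by apply: sosxD; apply: sosxG; rewrite ?oppr_ge0 // size_poly1.
  - move=> t t0; have := p0 t t0; rewrite pE hornerM pmulr_lge0 //.
    by rewrite hornerXsubC; lra.
have sgnq t : 0 < t -> 0 <= q.[t] * (t - a).
  by move=> t0; have := p0 t t0; rewrite pE hornerM hornerXsubC.
(* q is nonnegative to the right of a and nonpositive to the left, so it vanishes at a. *)
have qa : root q a.
  rewrite /root eq_le; apply/andP; split; last first.
    apply: poly_ge0_closure => d d0; exists (a + d / 2).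
      by rewrite addrAC subrr add0r gtr0_norm; lra.
    have := sgnq (a + d / 2); rewrite addrAC subrr add0r pmulr_lge0; last lra.
    by apply; lra.
  rewrite -oppr_ge0 -hornerN; apply: poly_ge0_closure => d d0.
  (* The minimum with a keeps the point positive, where the sign of p is known. *)
  exists (a - Num.min d a / 2).
    rewrite addrAC subrr add0r normrN gtr0_norm; last by rewrite divr_gt0 // lt_min d0.
    have : Num.min d a <= d by rewrite ge_min lexx.
    by lra.
  have m0 : 0 < Num.min d a by rewrite lt_min d0.
  have ma : Num.min d a <= a by rewrite ge_min lexx orbT.
  have := sgnq (a - Num.min d a / 2); rewrite addrAC subrr add0r mulrN -mulNr -hornerN.
  by rewrite pmulr_lge0 ?divr_gt0 //; apply; lra.
have /factor_theorem [q2 qE] := qa.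
apply: (step (('X - a%:P) ^+ 2) q2 2); rewrite ?size_exp_XsubC //.
- by rewrite pE qE expr2 mulrA.
- by rewrite -[X in sosx _ X]mul1r; apply: (gen false); rewrite size_XsubC.
have pos t : 0 < t -> t != a -> 0 <= q2.[t].
  move=> t0 ta; have := p0 t t0; rewrite pE qE -mulrA -expr2 hornerM horner_exp hornerXsubC.
  by rewrite pmulr_lge0 // exprn_even_gt0 //= subr_eq0.
move=> t t0; have [->|ta] := eqVneq t a; last exact: pos.
apply: poly_ge0_closure => d d0; exists (a + d / 2).
  by rewrite addrAC subrr add0r gtr0_norm; lra.
by apply: pos; [lra|rewrite -subr_eq0 addrAC subrr add0r gt_eqF // divr_gt0].
Qed.

End Lukacs.

(** * Divided differences and duality with the Cauchy kernels *)

Section Duality.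
Variable R : rcfType.
Variable f : R -> R.
Implicit Types (p q r : {poly R}) (x y : nat -> R).

Definition increasing_upto (M : nat) x :=
  forall i j, (i < j)%N -> (j < M)%N -> x i < x j.

(** The divided difference of h at the nodes x_0, ..., x_(M-1), in Lagrange form. *)
Definition divdiff (M : nat) (h : R -> R) x :=
  \sum_(i < M) h (x i) / \prod_(j < M | j != i) (x i - x j).

(** The consequence of matrix monotonicity that the duality works with: 2N nodes and a square p^2 of
    degree at most 2N - 2. *)
Definition divdiff_nonneg := forall N x p,
  increasing_upto N.*2 x -> 0 < x 0%N -> (size p <= N)%N ->
  0 <= divdiff N.*2 (fun t => f t * p.[t] ^+ 2) x.

Hypothesis fpos : forall t, 0 < t -> 0 < f t.
Hypothesis fdd : divdiff_nonneg.

(** Serves to send an extra node e to 0. For e at most half of every x_i, passing from x_i - e to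
    x_i costs at most e T, since |e b / (x (x - e))| <= 2 e |b| / x^2. *)
Lemma limit0_sum M (b x : 'I_M -> R) : (forall i, 0 < x i) ->
  (forall e, 0 < e -> (forall i, e < x i) -> 0 <= \sum_i b i / (x i - e)) ->
  0 <= \sum_i b i / x i.
Proof.
move=> x0 H; set S := \sum_i b i / x i.
pose T := \sum_i `|b i| * (x i)^-1 ^+ 2 *+ 2.
have T0 : 0 <= T by apply: sumr_ge0 => i _; rewrite mulrn_wge0 // mulr_ge0 ?sqr_ge0.
pose m := \big[Num.min/1]_i (x i).
have m0 : 0 < m by rewrite /m; elim/big_ind: _ => // u v u0 v0; rewrite lt_min u0.
have mx i : m <= x i by rewrite /m (bigD1 i) //= ge_min lexx.
have key e : 0 < e -> e <= m / 2 -> 0 <= S + e * T.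
  move=> e0 em.
  have ex i : e < x i by apply: le_lt_trans em _; have := mx i; have := x0 i; lra.
  apply: le_trans (H e e0 ex) _.
  rewrite /S /T mulr_sumr -big_split /=; apply: ler_sum => i _.
  have xi := x0 i; have exi := ex i; have xe : 0 < x i - e by rewrite subr_gt0.
  have e2 : e <= x i / 2 by apply: le_trans em _; have := mx i; lra.
  have -> : b i / (x i - e) = b i / x i + e * (b i / (x i * (x i - e))).
    by field; rewrite !gt_eqF.
  rewrite lerD2l ler_pM2l //; apply: le_trans (ler_norm _) _.
  rewrite normrM normfV -mulrnAr ler_wpM2l //.
  rewrite gtr0_norm ?mulr_gt0 // -mulr_natr exprVn -[2%:R]invrK -invfM.
  rewrite lef_pV2 ?posrE ?mulr_gt0 ?exprn_gt0 ?invr_gt0 //.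
  by rewrite expr2 -mulrA ler_pM2l //; lra.
rewrite leNgt; apply/negP => S0.
pose e := Num.min (m / 2) (- S / (T + 1) / 2).
have T1 : 0 < T + 1 by lra.
have e0 : 0 < e by rewrite lt_min !divr_gt0 ?oppr_gt0.
have := key e e0; rewrite ge_min lexx => /(_ isT).
have : e * (T + 1) <= - S / 2.
  by rewrite -ler_pdivlMr // mulrAC ge_min lexx orbT.
nra.
Qed.

(** Serves to send an extra node Y to infinity, [e Y] being its contribution. Multiplied by Y^2,
    with Y^2/(x - Y) = -Y - x Y/(Y - x), the hypothesis becomes S Y <= T + K for all large Y, which
    forces S <= 0. *)
Lemma limitoo_sum M (b x : 'I_M -> R) (e : R -> R) K : (forall i, 0 < x i) ->
  (forall Y, 1 <= Y -> (forall i, x i *+ 2 <= Y) ->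
      0 <= \sum_i b i / (x i - Y) + e Y /\ e Y <= K / Y ^+ 2) ->
  \sum_i b i <= 0.
Proof.
move=> x0 H; set S := \sum_i b i.
pose T := \sum_i `|b i| * (x i *+ 2).
have T0 : 0 <= T by apply: sumr_ge0 => i _; rewrite mulr_ge0 // mulrn_wge0 // ltW.
pose m := 1 + \sum_i (x i *+ 2).
have x20 i : 0 <= x i *+ 2 by rewrite mulrn_wge0 // ltW.
have m1 : 1 <= m by rewrite lerDl sumr_ge0.
have mx i : x i *+ 2 <= m.
  rewrite /m (bigD1 i) //= addrCA lerDl addr_ge0 ?ler01 //.
  by apply: sumr_ge0 => j _; exact: x20.
have key Y : m <= Y -> S * Y <= T + K.
  move=> mY; have Y1 : 1 <= Y by exact: le_trans mY.
  have Y0 : 0 < Y by lra.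
  have xY i : x i *+ 2 <= Y by exact: le_trans (mx i) mY.
  have [h1 h2] := H Y Y1 xY.
  have h3 : 0 <= Y ^+ 2 * (\sum_i b i / (x i - Y)) + K.
    have : 0 <= Y ^+ 2 * (\sum_i b i / (x i - Y) + K / Y ^+ 2).
      by rewrite mulr_ge0 ?sqr_ge0 //; lra.
    by rewrite mulrDr [_ * (K / _)]mulrC divfK ?expf_neq0 ?gt_eqF.
  have h4 : Y ^+ 2 * (\sum_i b i / (x i - Y)) <= T - S * Y.
    rewrite mulr_sumr /S mulr_suml /T -sumrB; apply: ler_sum => i _.
    have xi := x0 i; have xYi := xY i; have xYi0 : 0 < Y - x i by lra.
    have n1 : Y - x i != 0 by rewrite gt_eqF.
    have n2 : x i - Y != 0 by rewrite -opprB oppr_eq0.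
    have -> : Y ^+ 2 * (b i / (x i - Y)) = - (b i * (x i * Y / (Y - x i))) - b i * Y.
      by field; rewrite n1.
    rewrite lerD2r; apply: le_trans (ler_norm _) _.
    rewrite normrN normrM ler_wpM2l // gtr0_norm ?divr_gt0 ?mulr_gt0 //.
    by rewrite ler_pdivrMr // mulrnAl -mulrnAr ler_pM2l //; lra.
  by lra.
rewrite leNgt; apply/negP => S0.
have c0 : 0 <= (`|T + K| + 1) / S 
  by apply: divr_ge0; [apply: addr_ge0; [exact: normr_ge0|exact: ler01]|exact: ltW].
have := key (m + (`|T + K| + 1) / S); rewrite lerDl c0 => /(_ isT).
rewrite mulrDr [S * (_ / _)]mulrC divfK ?gt_eqF //.
have : 0 < S * m by rewrite mulr_gt0 //; lra.
have := ler_norm (T + K); lra.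
Qed.


Lemma divdiff_mono a b : 0 < a -> a < b -> f a <= f b.
Proof.
move=> a0 ab; pose x (k : nat) := if k is 0%N then a else b.
have := @fdd 1 x 1; rewrite /divdiff size_poly1 => H.
have {H} := H _ a0 isT; rewrite !big_ord_recl !big_ord0 /=.
rewrite !(big_mkcond (fun j => j != _)) !big_ord_recl !big_ord0 /= !hornerE /=.
rewrite ?(expr1n, mulr1, mul1r, addr0) => H.
have {H} : 0 <= f a / (a - b) + f b / (b - a).
  by apply: H => -[|[|i]] [|[|j]].
have -> : f a / (a - b) + f b / (b - a) = (f b - f a) / (b - a).
  have n1 : b - a != 0 by rewrite gt_eqF // subr_gt0.
  have n2 : a - b != 0 by rewrite -opprB oppr_eq0.
  by field; rewrite n1 n2.
by rewrite pmulr_lge0 ?subr_ge0 // invr_gt0 subr_gt0.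
Qed.

Lemma divdiff_div0 N x p : increasing_upto N.*2.+1 x -> 0 < x 0%N ->
  (size p <= N.+1)%N -> 0 <= divdiff N.*2.+1 (fun t => f t * p.[t] ^+ 2 / t) x.
Proof.
move=> xi x0 sp.
have xp (i : 'I_N.*2.+1) : 0 < x i.
  case: i => -[|i] //= iM; apply: lt_trans x0 _; exact: xi.
pose b (i : 'I_N.*2.+1) := f (x i) * p.[x i] ^+ 2 / \prod_(j < N.*2.+1 | j != i) (x i - x j).
have -> : divdiff N.*2.+1 (fun t => f t * p.[t] ^+ 2 / t) x = \sum_i b i / x i.
  by apply: eq_bigr => i _; rewrite /b mulrAC.
apply: limit0_sum => // e e0 ex.
pose y k := if k is k'.+1 then x k' else e.
have yi : increasing_upto N.+1.*2 y.
  move=> [|i] [|j] //= ij; rewrite doubleS ltnS => jN; last exact: xi.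
  exact: (ex (Ordinal jN)).
have := fdd yi e0 sp; rewrite /divdiff doubleS big_ord_recl /=.
set t0 := (X in 0 <= X + _ -> _) => H.
have t00 : t0 <= 0.
  rewrite /t0; apply: mulr_ge0_le0; first by rewrite mulr_ge0 ?sqr_ge0 // ltW ?fpos.
  rewrite invr_le0.
  rewrite big_mkcond big_ord_recl /= mul1r.
  rewrite (eq_bigr (fun j : 'I_N.*2.+1 => - (x j - e))); last by move=> j _; rewrite opprB.
  rewrite prodrN card_ord /= exprS -signr_odd odd_double mulr1 mulN1r oppr_le0.
  by apply: prodr_ge0 => j _; rewrite subr_ge0; apply: ltW; exact: (ex j).
have {H} : 0 <= \sum_(i < N.*2.+1) f (x i) * p.[x i] ^+ 2 /
    \prod_(j < N.*2.+2 | j != lift ord0 i) (x i - y j).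
  move: H; rewrite -/t0; set S := (X in _ + X) => H; change (0 <= S); lra.
congr (0 <= _); apply: eq_bigr => i _; rewrite /b -[RHS]mulrA; congr (_ * _).
rewrite -invfM; congr (_ ^-1); rewrite big_mkcond big_ord_recl /= mulrC; congr (_ * _).
rewrite [in RHS]big_mkcond; apply: eq_bigr => j _ /=.
by rewrite (inj_eq lift_inj).
Qed.

(** With nodes a, b, Y and p = X - Y the term of Y vanishes, which leaves (f b / b)(Y - b) <= (f a /
    a)(Y - a); Y tends to infinity. *)
Lemma divdiff_antitone_div a b : 0 < a -> a < b -> f b / b <= f a / a.
Proof.
move=> a0 ab; have b0 : 0 < b by exact: lt_trans ab.
have key Y : b < Y -> (f b / b) * (Y - b) <= (f a / a) * (Y - a).
  move=> bY; pose x (k : nat) := if k is 0%N then a else if k is 1%N then b else Y.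
  have := @divdiff_div0 1 x ('X - Y%:P); rewrite /divdiff size_XsubC => H.
  have {H} := H _ a0 isT; rewrite !big_ord_recl !big_ord0 /=.
  rewrite !(big_mkcond (fun j => j != _)) !big_ord_recl !big_ord0 /= !hornerE /=.
  rewrite ?subrr ?expr0n /= ?(mulr0, mul0r, mulr1, mul1r, addr0, add0r) => H.
  have {H} : 0 <= f a * (a - Y) ^+ 2 / a / ((a - b) * (a - Y)) +
                 f b * (b - Y) ^+ 2 / b / ((b - a) * (b - Y)).
    by rewrite !expr2 !mulrA; apply: H => -[|[|[|i]]] [|[|[|j]]] //= _ _; exact: lt_trans bY.
  have n1 : Y - b != 0 by rewrite gt_eqF // subr_gt0.
  have n2 : Y - a != 0 by rewrite gt_eqF // subr_gt0; apply: lt_trans bY.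
  have n3 : b - a != 0 by rewrite gt_eqF // subr_gt0.
  have n4 : a - Y != 0 by rewrite -opprB oppr_eq0.
  have n5 : b - Y != 0 by rewrite -opprB oppr_eq0.
  have n6 : a - b != 0 by rewrite -opprB oppr_eq0.
  have n7 : a != 0 by rewrite gt_eqF.
  have n8 : b != 0 by rewrite gt_eqF.
  have -> : f a * (a - Y) ^+ 2 / a / ((a - b) * (a - Y)) +
                 f b * (b - Y) ^+ 2 / b / ((b - a) * (b - Y)) =
            ((f a / a) * (Y - a) - (f b / b) * (Y - b)) / (b - a).
    by field; rewrite n3 n4 n5 n6 n7 n8.
  by rewrite pmulr_lge0 ?subr_ge0 // invr_gt0 subr_gt0.
rewrite leNgt; apply/negP; set D := f b / b; set E := f a / a => ED.
(* The inequality [key] reads (D - E) Y <= D b - E a; this Y exceeds b and violates it. *)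
have := key (b + 1 + `|D * b - E * a| / (D - E)); rewrite -/D -/E.
have d0 : 0 < D - E by rewrite subr_gt0.
have c0 : 0 <= `|D * b - E * a| / (D - E) by rewrite divr_ge0 // ltW.
have cE : `|D * b - E * a| / (D - E) * (D - E) = `|D * b - E * a| by rewrite divfK // gt_eqF.
move: c0 cE; set c := _ / _ => c0 cE.
have n0 := ler_norm (D * b - E * a).
have bb : 0 < (D - E) * b by rewrite mulr_gt0.
have -> : b < b + 1 + c by lra.
move=> /(_ isT); lra.
Qed.

Lemma horner_bound p N Y : (size p <= N.+1)%N -> 1 <= Y ->
  `|p.[Y]| <= (\sum_(i < size p) `|p`_i|) * Y ^+ N.
Proof.
move=> sp Y1; have Y0 : 0 <= Y by exact: le_trans Y1.
rewrite horner_coef mulr_suml; apply: le_trans (ler_norm_sum _ _ _) _.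
apply: ler_sum => i _; rewrite normrM normrX (ger0_norm Y0) ler_wpM2l //.
by apply: ler_weXn2l => //; rewrite -ltnS (leq_trans (ltn_ord i)).
Qed.

(** An extra node Y above all x_i makes 2 (N + 1) nodes. Since f(Y) <= f(1) Y, the term of Y is of
    order Y^-2, while the others are of order 1/Y with coefficient minus the sum in question, so
    they decide the sign. *)
Lemma divdiff_infty N x p : increasing_upto N.*2.+1 x -> 0 < x 0%N ->
  (size p <= N)%N -> divdiff N.*2.+1 (fun t => f t * p.[t] ^+ 2) x <= 0.
Proof.
move=> xi x0 sp.
(* For N = 0 the polynomial is zero. Otherwise N is renamed, so from here on p has degree at most N
   and there are 2N + 3 nodes. *)
case: N xi sp => [|N] xi sp.
  move: sp; rewrite leqn0 size_poly_eq0 => /eqP ->.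
  by rewrite /divdiff big1 // => i _; rewrite horner0 expr0n mulr0 mul0r.
set M := N.+1.*2.+1 in xi *.
have xp (i : 'I_M) : 0 < x i.
  case: i => -[|i] //= iM; apply: lt_trans x0 _; exact: xi.
pose S := \sum_(i < size p) `|p`_i|.
(* The numerator at Y is at most f(1) S^2 Y^(M-2) and the denominator at least (Y/2)^M. *)
pose K := f 1 * S ^+ 2 * 2 ^+ M.
pose e Y := f Y * p.[Y] ^+ 2 / \prod_(j < M) (Y - x j).
apply: (@limitoo_sum _ _ (fun i : 'I_M => x i) e K) => // Y Y1 xY.
have Y0 : 0 < Y by lra.
have xY0 (j : 'I_M) : x j < Y by have := xY j; have := xp j; lra.
split.
  pose y k := if (k < M)%N then x k else Y.
  have yE (i : 'I_M) : y i = x i by rewrite /y ltn_ord.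
  have yM : y M = Y by rewrite /y ltnn.
  have yi : increasing_upto N.+2.*2 y.
    move=> i j ij; rewrite doubleS -/M ltnS leq_eqVlt => /orP[/eqP jM|jM].
      by rewrite jM yM; rewrite jM in ij; rewrite (yE (Ordinal ij)); exact: xY0.
    by rewrite /y jM (ltn_trans ij jM); exact: xi.
  have y0 : 0 < y 0%N by rewrite /y.
  have := fdd yi y0 (leqW sp); rewrite /divdiff doubleS -/M big_ord_recr /= yM.
  have eE : f Y * p.[Y] ^+ 2 / \prod_(j < M.+1 | j != ord_max) (Y - y j) = e Y.
    rewrite /e; congr (_ / _); rewrite big_mkcond big_ord_recr /= eqxx mulr1.
    apply: eq_bigr => j _; rewrite yE -val_eqE /= ltn_eqF //.
  rewrite eE; congr (0 <= _ + _); apply: eq_bigr => i _; rewrite yE -[RHS]mulrA.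
  congr (_ * _); rewrite -invfM; congr (_ ^-1).
  rewrite big_mkcond big_ord_recr /= yM -val_eqE /= gtn_eqF //; congr (_ * _).
  by rewrite [in RHS]big_mkcond; apply: eq_bigr => j _; rewrite yE -!val_eqE.
have fY : f Y <= f 1 * Y.
  move: Y1; rewrite le_eqVlt => /orP[/eqP <-|Y1]; first by rewrite mulr1.
  by have := divdiff_antitone_div ltr01 Y1; rewrite divr1 ler_pdivrMr.
have pY : p.[Y] ^+ 2 <= (S * Y ^+ N) ^+ 2.
  rewrite -real_normK ?num_real // ler_sqr ?nnegrE //; first exact: horner_bound.
  by apply: mulr_ge0; [apply: sumr_ge0|rewrite exprn_ge0 // ltW].
have PY : (Y / 2) ^+ M <= \prod_(j < M) (Y - x j).
  rewrite -[X in _ ^+ X]card_ord -prodr_const; apply: ler_prod => j _.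
  by have := xY j; have := xp j; lra.
have Y20 : 0 < (Y / 2) ^+ M by rewrite exprn_gt0 // divr_gt0.
have f1 : 0 < f 1 by apply: fpos.
have fY0 : 0 < f Y by apply: fpos.
apply: (@le_trans _ _ (f 1 * Y * (S * Y ^+ N) ^+ 2 / (Y / 2) ^+ M)).
  apply: ler_pM.
  - by rewrite mulr_ge0 ?sqr_ge0 // ltW.
  - by rewrite invr_ge0; apply: prodr_ge0 => j _; rewrite subr_ge0 ltW.
  - by apply: ler_pM => //; rewrite ?sqr_ge0 // ltW.
  - by rewrite lef_pV2 // posrE (lt_le_trans _ PY).
have Yn0 : Y != 0 by rewrite gt_eqF.
rewrite le_eqVlt; apply/orP; left; apply/eqP.
have -> : (Y / 2) ^+ M = Y * (Y ^+ N) ^+ 2 * Y ^+ 2 / 2 ^+ M.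
  rewrite expr_div_n; congr (_ / _).
  by rewrite -exprM -exprS -exprD /M; congr (_ ^+ _); lia.
rewrite /K; have n2 : 2 ^+ M != 0 :> R by rewrite expf_neq0 // pnatr_eq0.
have YN : Y ^+ N != 0 by rewrite expf_neq0.
move: (Y ^+ N) YN (2 ^+ M) n2 => a a0 c c0.
by field; rewrite Yn0 a0 c0.
Qed.

(** After clearing denominators the hypothesis says that Q is nonnegative on the half-line, of
    degree at most 2N. The functional L sends Q to the sum of the c_i f(x_i) and is nonnegative on
    every generator supplied by [nonneg_sosx]; so f inherits each linear inequality that all kernels
    satisfy. *)
Theorem cauchy_duality N x (c : nat -> R) : increasing_upto N.*2.+1 x -> 0 < x 0%N ->
  (forall t, 0 < t -> 0 <= \sum_(i < N.*2.+1) c i * (x i / (x i + t))) ->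
  0 <= \sum_(i < N.*2.+1) c i * f (x i).
Proof.
move=> xi x0 Hc; set M := N.*2.+1 in xi Hc *.
have xp (i : 'I_M) : 0 < x i.
  case: i => -[|i] //= iM; apply: lt_trans x0 _; exact: xi.
have xinj (i j : 'I_M) : i != j -> x i - x j != 0.
  rewrite subr_eq0 -val_eqE neq_ltn => /orP[] ij.
    by rewrite lt_eqF // xi.
  by rewrite gt_eqF // xi.
pose P (i : 'I_M) : {poly R} := \prod_(j < M | j != i) ('X + (x j)%:P).
pose Q : {poly R} := \sum_(i < M) (c i * x i) *: P i.
(* Evaluation at -x_i isolates c_i in Q, all other P_k vanishing there. *)
pose L q := \sum_(i < M) f (x i) * q.[- x i] / x i / \prod_(j < M | j != i) (x i - x j).
have hP (i : 'I_M) t : (P i).[t] = \prod_(j < M | j != i) (t + x j).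
  by rewrite horner_prod; apply: eq_bigr => j _; rewrite !hornerE.
have sP (i : 'I_M) : size (P i) = M.
  have -> : P i = \prod_(j <- enum (predC1 i)) ('X - (- x j)%:P).
    by rewrite big_enum; apply: eq_big => // j _; rewrite polyCN opprK.
  by rewrite size_prod_XsubC -cardE cardC1 card_ord.
have PN (i : 'I_M) : (P i).[- x i] = \prod_(j < M | j != i) (x i - x j).
  rewrite hP (eq_bigr (fun j : 'I_M => - (x i - x j))); last by move=> j _; rewrite opprB addrC.
  (* The 2N factors -(x_i - x_j) are even in number, so no sign appears. *)
  by rewrite prodrN cardC1 card_ord /M /= -signr_odd odd_double mul1r.
have Pz (i k : 'I_M) : k != i -> (P k).[- x i] = 0.
  by move=> ki; rewrite hP (bigD1 i) 1?eq_sym //= addNr mul0r.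
have Dn0 (i : 'I_M) : \prod_(j < M | j != i) (x i - x j) != 0.
  by apply/prodf_neq0 => j ji; apply: xinj; rewrite eq_sym.
have LQ : L Q = \sum_(i < M) c i * f (x i).
  apply: eq_bigr => i _; have -> : Q.[- x i] = c i * x i * \prod_(j < M | j != i) (x i - x j).
    rewrite /Q horner_sum (bigD1 i) //= big1 ?addr0 ?hornerZ ?PN // => k ki.
    by rewrite hornerZ Pz ?mulr0.
  have := xp i; have := Dn0 i; move: (\prod_(_ < _ | _) _) => D D0 xi0.
  by field; rewrite D0 gt_eqF.
have sQ : ((size Q).-1 <= N.*2)%N.
  suff : (size Q <= M)%N by rewrite /M; lia.
  apply: (leq_trans (size_sum _ _ _)); apply/bigmax_leqP => i _.
  by rewrite (leq_trans (size_scale_leq _ _)) // sP.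
have Q0 t : 0 < t -> 0 <= Q.[t].
  move=> t0; have -> : Q.[t] = \prod_(j < M) (t + x j) * \sum_(i < M) c i * (x i / (x i + t)).
    rewrite /Q horner_sum mulr_sumr; apply: eq_bigr => i _.
    rewrite hornerZ hP [in RHS](bigD1 i) //= (addrC (x i)).
    have : t + x i != 0 by rewrite gt_eqF // addr_gt0.
    by move: (\prod_(_ < _ | _) _) => D D0; field.
  rewrite mulr_ge0 ?Hc //; apply: prodr_ge0 => j _; rewrite addr_ge0 // ltW //.
have LD p q : L (p + q) = L p + L q.
  by rewrite -big_split; apply: eq_bigr => i _; rewrite hornerD mulrDr !mulrDl.
rewrite -LQ; move: (nonneg_sosx Q0); move: (size Q).-1 sQ => e eN sosQ.
elim: sosQ eN => {e Q LQ Q0}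
    [d _|d p q _ IHp _ IHq dN|d b a r a0 dr dN].
- by rewrite /L big1 // => i _; rewrite horner0 mulr0 !mul0r.
- by rewrite LD; apply: addr_ge0; [exact: IHp|exact: IHq].
pose r' := r \Po (- 'X).
have rE t : r.[- t] = r'.[t] by rewrite horner_comp !hornerE.
have sr : size r' = size r by rewrite size_comp_poly2 // size_polyN size_polyX.
(* The bound 2N splits by parity: X r^2 needs r of size at most N, the case of [divdiff_infty], and
   r^2 allows size N + 1, the case of [divdiff_div0]. Evaluating X at -x_i supplies the minus sign
   that turns the nonpositive difference around. *)
case: b dr => dr.
  have -> : L (a *: ('X ^+ true * r ^+ 2)) = - (a * divdiff M (fun t => f t * r'.[t] ^+ 2) x).
    rewrite /L /divdiff mulr_sumr -sumrN; apply: eq_bigr => i _.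
    rewrite hornerZ hornerM !horner_exp rE expr1 hornerX.
    have := xp i; have := Dn0 i; move: (\prod_(_ < _ | _) _) => D D0 xi0.
    by field; rewrite D0 gt_eqF.
  rewrite oppr_ge0 mulr_ge0_le0 //; apply: divdiff_infty => //.
  by rewrite sr; move: dr dN; lia.
have -> : L (a *: ('X ^+ false * r ^+ 2)) = a * divdiff M (fun t => f t * r'.[t] ^+ 2 / t) x.
  rewrite /L /divdiff mulr_sumr; apply: eq_bigr => i _.
  rewrite hornerZ hornerM !horner_exp rE expr0.
  have := xp i; have := Dn0 i; move: (\prod_(_ < _ | _) _) => D D0 xi0.
  by field; rewrite D0 gt_eqF.
rewrite mulr_ge0 //; apply: divdiff_div0 => //.
by rewrite sr; move: dr dN; lia.
Qed.

End Duality.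

(** * Divided differences realized by rank-one perturbations *)

Lemma big_double (T : Type) (idx : T) (op : Monoid.com_law idx) N (F : nat -> T) :
  \big[op/idx]_(i < N.*2) F i = op (\big[op/idx]_(k < N) F k.*2) (\big[op/idx]_(k < N) F k.*2.+1).
Proof.
elim: N => [|N IH]; first by rewrite !big_ord0 Monoid.mulm1.
rewrite doubleS !big_ord_recr /= IH -!Monoid.mulmA; congr (op _ _).
exact: Monoid.mulmCA.
Qed.

(** p equals its Lagrange interpolant, the difference having N roots and degree below N; dividing by
    the nodal polynomial gives partial fractions. *)
Lemma lagrange_partial_fractions (F : fieldType) N (la : 'I_N -> F) (p : {poly F}) x :
  injective la -> (size p <= N)%N -> (forall k, x != la k) ->
  \sum_k p.[la k] / \prod_(j | j != k) (la k - la j) / (x - la k) =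
  p.[x] / \prod_k (x - la k).
Proof.
move=> inj sp xla.
have D0 k : \prod_(j | j != k) (la k - la j) != 0.
  by apply/prodf_neq0 => j jk; rewrite subr_eq0 (inj_eq inj) eq_sym.
have x0 k : x - la k != 0 by rewrite subr_eq0.
pose L := \sum_k (p.[la k] / \prod_(j | j != k) (la k - la j)) *:
   \prod_(j | j != k) ('X - (la j)%:P).
have hL k t : (\prod_(j | j != k) ('X - (la j)%:P)).[t] = \prod_(j | j != k) (t - la j).
  by rewrite horner_prod; apply: eq_bigr => j _; rewrite hornerXsubC.
have sL : (size L <= N)%N.
  apply: leq_trans (size_sum _ _ _) _; apply/bigmax_leqP => k _.
  apply: leq_trans (size_scale_leq _ _) _.
  have -> : \prod_(j | j != k) ('X - (la j)%:P) = \prod_(j <- enum (predC1 k)) ('X - (la j)%:P).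
    by rewrite big_enum; apply: eq_big.
  by rewrite size_prod_XsubC -cardE cardC1 card_ord; case: (N) k => [[]|].
have pL : p = L.
  apply/eqP; rewrite -subr_eq0; apply/negPn/negP => pL0.
  have := max_poly_roots pL0 (rs := [seq la k | k <- enum 'I_N]).
  rewrite size_map size_enum_ord map_inj_uniq // enum_uniq => /(_ _ isT) H.
  have : (N < size (p - L)%R)%N.
    apply: H; apply/allP => _ /mapP [k _ ->]; rewrite /root hornerD hornerN subr_eq0 eq_sym.
    rewrite /L horner_sum; apply/eqP; etransitivity; first exact: (bigD1 k).
    rewrite /= [X in _ + X]big1 ?addr0 => [|i ik]; first by rewrite hornerZ hL divfK.
    have Z : \prod_(j | j != i) (la k - la j) = 0.
      by rewrite (bigD1 k) 1?eq_sym //= subrr mul0r.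
    by rewrite hornerZ hL Z mulr0.
  rewrite ltnNge; case/negP; apply: leq_trans (size_polyD _ _) _.
  by rewrite size_polyN geq_max sp sL.
rewrite [in RHS]pL /L horner_sum mulr_suml; apply: eq_bigr => k _.
rewrite hornerZ hL -!mulrA; congr (_ * (_ * _)).
rewrite [X in _ / X](bigD1 k) //= invfM mulrCA divff ?mulr1 //.
by apply/prodf_neq0 => j _.
Qed.

Section Cauchy.
Variables (R : rcfType) (N : nat) (y : nat -> R).
Hypothesis yi : increasing_upto N.*2 y.

(** The even nodes [la] and the odd nodes [mu] interlace: la_0 < mu_0 < la_1 < mu_1 < ... They
    become the spectra of a diagonal matrix and of its rank-one perturbation. *)
Let la (k : 'I_N) := y k.*2.
Let mu (k : 'I_N) := y k.*2.+1.

Let lt_la (j k : 'I_N) : (j < k)%N -> la j < la k.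
Proof. by move=> jk; apply: yi; have := ltn_ord k; lia. Qed.
Let lt_mu (j k : 'I_N) : (j < k)%N -> mu j < mu k.
Proof. by move=> jk; apply: yi; have := ltn_ord k; lia. Qed.
Let lt_lamu (j k : 'I_N) : (j <= k)%N -> la j < mu k.
Proof. by move=> jk; apply: yi; have := ltn_ord k; lia. Qed.
Let lt_mula (j k : 'I_N) : (j < k)%N -> mu j < la k.
Proof. by move=> jk; apply: yi; have := ltn_ord k; lia. Qed.

Let la_inj : injective la.
Proof.
move=> j k /eqP jk; apply: val_inj; case: (ltngtP j k) => // h.
  by move: jk; rewrite (lt_eqF (lt_la h)).
by move: jk; rewrite (gt_eqF (lt_la h)).
Qed.
Let mu_inj : injective mu.
Proof.
move=> j k /eqP jk; apply: val_inj; case: (ltngtP j k) => // h.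
  by move: jk; rewrite (lt_eqF (lt_mu h)).
by move: jk; rewrite (gt_eqF (lt_mu h)).
Qed.
Let mula i k : mu i - la k != 0.
Proof.
rewrite subr_eq0; case: (leqP k i) => h; first by rewrite gt_eqF // lt_lamu.
by rewrite lt_eqF // lt_mula.
Qed.
Let lamu i k : la k - mu i != 0. Proof. by rewrite -opprB oppr_eq0. Qed.

Let Dla k := \prod_(j | j != k) (la k - la j).
Let Dmu i := \prod_(j | j != i) (mu i - mu j).
Let Ela i := \prod_k (mu i - la k).
Let Emu k := \prod_i (la k - mu i).
(** With v_k^2 = V k the matrix diag(la) + v v^T has the eigenvalues [mu]; W i normalizes its
    eigenvectors. *)
Let V k := - Emu k / Dla k.
Let W i := Ela i / Dmu i.

Let Dla0 k : Dla k != 0.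
Proof. by apply/prodf_neq0 => j jk; rewrite subr_eq0 (inj_eq la_inj) eq_sym. Qed.
Let Dmu0 k : Dmu k != 0.
Proof. by apply/prodf_neq0 => j jk; rewrite subr_eq0 (inj_eq mu_inj) eq_sym. Qed.
Let Ela0 k : Ela k != 0. Proof. exact/prodf_neq0. Qed.
Let Emu0 k : Emu k != 0. Proof. exact/prodf_neq0. Qed.

(** By interlacing, la_k - mu_j and la_k - la_j have the same sign for every j other than k. *)
Let V_gt0 k : 0 < V k.
Proof.
rewrite /V /Emu (bigD1 k) //= -mulNr opprB -mulrA mulr_gt0 ?subr_gt0 ?lt_lamu //.
rewrite /Dla -prodfV -big_split /=; apply: prodr_gt0 => j jk.
case: (ltngtP j k) => h.
- by rewrite divr_gt0 ?subr_gt0 ?lt_la ?lt_mula.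
- by rewrite -mulrNN -invrN !opprB divr_gt0 ?subr_gt0 ?lt_la ?lt_lamu // ltnW.
- by rewrite -val_eqE /= h eqxx in jk.
Qed.

Let W_gt0 i : 0 < W i.
Proof.
rewrite /W /Ela (bigD1 i) //= -mulrA mulr_gt0 ?subr_gt0 ?lt_lamu //.
rewrite /Dmu -prodfV -big_split /=; apply: prodr_gt0 => j ji.
case: (ltngtP j i) => h.
- by rewrite divr_gt0 ?subr_gt0 ?lt_mu ?lt_lamu // ltnW.
- by rewrite -mulrNN -invrN !opprB divr_gt0 ?subr_gt0 ?lt_mu ?lt_mula.
- by rewrite -val_eqE /= h eqxx in ji.
Qed.

Let v k := Num.sqrt (V k).
Let w i := Num.sqrt (W i).
Let v2 k : v k ^+ 2 = V k. Proof. by rewrite sqr_sqrtr // ltW. Qed.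
Let w2 k : w k ^+ 2 = W k. Proof. by rewrite sqr_sqrtr // ltW. Qed.
Let v0 k : v k != 0. Proof. by rewrite gt_eqF // sqrtr_gt0. Qed.

(** Secular equation of the perturbation. The interpolated polynomial is the difference of the monic
    polynomials with roots [la] and [mu], hence of degree below N. *)
Let I1 i : \sum_k V k / (mu i - la k) = 1.
Proof.
pose P := \prod_k ('X - (la k)%:P) - \prod_k ('X - (mu k)%:P).
have sP : (size P <= N)%N.
  have s1 (z : 'I_N -> R) : size (\prod_k ('X - (z k)%:P)) = N.+1.
    by rewrite size_prod_XsubC /index_enum -enumT size_enum_ord.
  have m1 (z : 'I_N -> R) : \prod_k ('X - (z k)%:P) \is monic by exact: monic_prod_XsubC.
  apply/leq_sizeP => j; rewrite leq_eqVlt => /orP[/eqP <-|jN].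
    have := m1 la; have := m1 mu; rewrite !monicE /lead_coef !s1 /= => /eqP e1 /eqP e2.
    by rewrite coefB e1 e2 subrr.
  by rewrite coefB !nth_default ?subrr // s1.
have xn k : mu i != la k by rewrite -subr_eq0.
have := lagrange_partial_fractions la_inj sP xn.
have hP (z : 'I_N -> R) t : (\prod_k ('X - (z k)%:P)).[t] = \prod_k (t - z k).
  by rewrite horner_prod; apply: eq_bigr => k _; rewrite hornerXsubC.
have Pmu : P.[mu i] = Ela i.
  by rewrite hornerD hornerN !hP [X in _ - X](bigD1 i) //= subrr mul0r subr0.
rewrite Pmu -/(Ela i) divff // => <-; apply: eq_bigr => k _; congr (_ / _ / _).
by rewrite hornerD hornerN !hP (bigD1 k) //= subrr mul0r add0r.
Qed.

(** Orthogonality of the columns of [U], by interpolating the polynomial whose roots are all of [mu]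
    except mu_i. *)
Let I2 i j : \sum_k V k / (mu i - la k) / (mu j - la k) = if i == j then (W i)^-1 else 0.
Proof.
pose Q := \prod_(l | l != i) ('X - (mu l)%:P).
have sQ : (size Q <= N)%N.
  have -> : Q = \prod_(j <- enum (predC1 i)) ('X - (mu j)%:P) by rewrite big_enum; apply: eq_big.
  rewrite size_prod_XsubC -cardE cardC1 card_ord prednK //.
  exact: leq_ltn_trans (leq0n i) (ltn_ord i).
have hQ t : Q.[t] = \prod_(l | l != i) (t - mu l).
  by rewrite horner_prod; apply: eq_bigr => l _; rewrite hornerXsubC.
have xn k : mu j != la k by rewrite -subr_eq0.
have := lagrange_partial_fractions la_inj sQ xn; rewrite -/(Ela j).
have -> : \sum_k Q.[la k] / \prod_(l | l != k) (la k - la l) / (mu j - la k) =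
    \sum_k V k / (mu i - la k) / (mu j - la k).
  apply: eq_bigr => k _; congr (_ / _); rewrite -/(Dla k) hQ /V.
  have -> : Emu k = (la k - mu i) * \prod_(l | l != i) (la k - mu l) by rewrite /Emu (bigD1 i).
  move: (\prod_(_ < _ | _) _) (Dla0 k) (mula i k) (lamu i k) => a d0 h1 h2.
  by field; rewrite d0 h1 .
move=> ->; rewrite hQ; case: eqP => [<-|/eqP ij].
  by rewrite /W invf_div.
by rewrite (bigD1 j) 1?eq_sym //= subrr mul0r mul0r.
Qed.

(** A scaled Cauchy matrix: column i is the unit eigenvector of diag(la) + v v^T for mu_i. *)
Let U : 'M[R]_N := \matrix_(k, i) (v k * w i / (mu i - la k)).

Let UU : U^T *m U = 1%:M.
Proof.
apply/matrixP => i j; rewrite !mxE.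
transitivity (w i * w j * \sum_k V k / (mu i - la k) / (mu j - la k)).
  rewrite mulr_sumr; apply: eq_bigr => k _; rewrite !mxE -v2.
  by move: (mula i k) (mula j k) => h1 h2; field; rewrite h1 h2.
rewrite I2; case: eqP => [<-|_]; last by rewrite mulr0.
by rewrite -expr2 w2 divff // gt_eqF.
Qed.

Let UBU : U *m diag_mx (\row_i mu i) *m U^T = diag_mx (\row_k la k) + (\col_k v k) *m (\row_k v k).
Proof.
have E : U *m diag_mx (\row_i mu i) = (diag_mx (\row_k la k) + (\col_k v k) *m (\row_k v k)) *m U.
  rewrite mulmxDl mul_diag_mx mul_mx_diag; apply/matrixP => k i; rewrite -mulmxA !mxE big_ord1 !mxE.
  have -> : \sum_j (\row_k0 v k0) 0 j * U j i = w i.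
    transitivity (w i * \sum_j V j / (mu i - la j)); last by rewrite I1 mulr1.
    rewrite mulr_sumr; apply: eq_bigr => j _; rewrite !mxE -v2.
    by move: (mula i j) => h; field.
  by move: (mula i k) => h; field.
by rewrite E -mulmxA (mulmx1C UU) mulmx1.
Qed.

Variable p : {poly R}.
Hypothesis sp : (size p <= N)%N.

(** Chosen so that its squared entries and those of U^T xi are, up to sign, the weights of g at the
    even and odd nodes in the divided difference of g p^2. *)
Let xi k := p.[la k] / (v k * Dla k).

(** The divided difference becomes the value at [xi] of the form of g(B) - g(A), where A = diag(la)
    lies below B = A + v v^T; for g = f this is a quantity that matrix monotonicity makes
    nonnegative. *)
Theorem rank_one_realization : exists (U : 'M[R]_N) (v xi : 'I_N -> R),
  [/\ U^T *m U = 1%:M,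
      U *m diag_mx (\row_i y i.*2.+1) *m U^T =
        diag_mx (\row_k y k.*2) + (\col_k v k) *m (\row_k v k) &
      forall g : R -> R, divdiff N.*2 (fun t => g t * p.[t] ^+ 2) y =
        \sum_(i < N) g (y i.*2.+1) * (\sum_(k < N) U k i * xi k) ^+ 2 -
        \sum_(k < N) g (y k.*2) * xi k ^+ 2].
Proof.
exists U, v, xi; split; [exact: UU|exact: UBU|move=> g].
have Uxi i : \sum_k U k i * xi k = w i * (p.[mu i] / Ela i).
  have xn k : mu i != la k by rewrite -subr_eq0.
  rewrite -(lagrange_partial_fractions la_inj sp xn) mulr_sumr; apply: eq_bigr => k _.
  rewrite !mxE /xi -/(Dla k).
  by move: (mula i k) (v0 k) (Dla0 k) => h1 h2 h3; field; rewrite h1 h2 h3.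
pose G (i : nat) := g (y i) * p.[y i] ^+ 2 / \prod_(j < N.*2) (if (j : nat) != i then y i - y j else 1).
have -> : divdiff N.*2 (fun t => g t * p.[t] ^+ 2) y = \sum_(i < N.*2) G i.
  by apply: eq_bigr => i _; rewrite /G [in LHS]big_mkcond.
have dblS (F : nat -> R) : \sum_(i < N.*2) F i = \sum_(k < N) F k.*2 + \sum_(k < N) F k.*2.+1.
  exact: big_double.
have dblP (F : nat -> R) : \prod_(i < N.*2) F i = \prod_(k < N) F k.*2 * \prod_(k < N) F k.*2.+1.
  exact: big_double.
rewrite dblS [LHS]addrC; congr (_ + _).
  apply: eq_bigr => i _; rewrite Uxi exprMn w2 /G.
  rewrite (dblP (fun j => if j != i.*2.+1 then y i.*2.+1 - y j else 1)).
  have -> : \prod_(k < N) (if k.*2 != i.*2.+1 then y i.*2.+1 - y k.*2 else 1) = Ela i.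
    apply: eq_bigr => k _; rewrite ifT //; apply/eqP; lia.
  have -> : \prod_(k < N) (if k.*2.+1 != i.*2.+1 then y i.*2.+1 - y k.*2.+1 else 1) = Dmu i.
    rewrite /Dmu [RHS]big_mkcond; apply: eq_bigr => k _; rewrite -val_eqE /=.
    by rewrite ?eqSS (inj_eq double_inj).
  rewrite -/(mu i) /W.
  by move: (Ela0 i) (Dmu0 i) => h1 h2; field; rewrite h1 h2.
rewrite -sumrN; apply: eq_bigr => k _; rewrite /xi expr_div_n exprMn v2 /G.
rewrite (dblP (fun j => if j != k.*2 then y k.*2 - y j else 1)).
have -> : \prod_(i < N) (if i.*2.+1 != k.*2 then y k.*2 - y i.*2.+1 else 1) = Emu k.
  apply: eq_bigr => i _; rewrite ifT //; apply/eqP; lia.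
have -> : \prod_(j < N) (if j.*2 != k.*2 then y k.*2 - y j.*2 else 1) = Dla k.
  rewrite /Dla [RHS]big_mkcond; apply: eq_bigr => j _; rewrite -val_eqE /=.
  by rewrite (inj_eq double_inj).
rewrite -/(la k) /V.
by move: (Emu0 k) (Dla0 k) => h1 h2; field; rewrite ?oppr_eq0 h1 h2.
Qed.

End Cauchy.

(** * Approximation by convex combinations of kernels on compact intervals *)

Section Approximation.
Variable R : realType.
Implicit Types (l : seq (R * R)) (x : R).

Definition comb l x := \sum_(wt <- l) wt.1 * ((1 + wt.2) * x / (x + wt.2)).

Definition convex_weights l :=
  all (fun wt => (0 <= wt.1) && (0 < wt.2)) l && (\sum_(wt <- l) wt.1 == 1).

Lemma comb_bound l x : convex_weights l -> 0 < x -> 0 < comb l x <= 1 + x.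
Proof.
move=> /andP[/allP lp /eqP l1] x0; apply/andP; split; last first.
  rewrite -[1 + x]mul1r -l1 mulr_suml /comb big_seq [leRHS]big_seq.
  apply: ler_sum => -[w t] /lp /andP[/= w0 t0].
  rewrite ler_wpM2l // ler_pdivrMr ?addr_gt0 //; nra.
rewrite lt_neqAle; apply/andP; split; last first.
  rewrite /comb big_seq; apply: sumr_ge0 => -[w t] /lp /andP[/= w0 t0].
  by rewrite !mulr_ge0 ?invr_ge0 // ?ltW // addr_gt0.
apply/eqP => /esym /eqP; rewrite /comb big_seq psumr_eq0; last first.
  move=> -[w t] /lp /andP[/= w0 t0].
  by rewrite !mulr_ge0 ?invr_ge0 // ?ltW // addr_gt0.
move=> /allP H; move: l1; rewrite big_seq big1; first by move/esym/eqP; rewrite oner_eq0.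
move=> [w t] il; have := H _ il; rewrite il /= => /eqP.
have /andP[/= w0 t0] := lp _ il.
move/eqP; rewrite mulf_eq0 => /orP[/eqP //|]; rewrite gt_eqF //.
by rewrite !mulr_gt0 ?invr_gt0 ?addr_gt0.
Qed.

Lemma comb_mono l x y : convex_weights l -> 0 < x -> x <= y -> comb l x <= comb l y.
Proof.
move=> /andP[/allP lp /eqP l1] x0 xy; rewrite /comb big_seq [leRHS]big_seq.
apply: ler_sum => -[w t] /lp /andP[/= w0 t0]; rewrite ler_wpM2l //.
have y0 : 0 < y by exact: lt_le_trans xy.
rewrite ler_pdivrMr ?addr_gt0 // mulrAC ler_pdivlMr ?addr_gt0 //.
rewrite -!mulrA ler_pM2l ?addr_gt0 //; nra.
Qed.

(** Together with [comb_mono] this is the growth that f itself has (f increasing, f(t)/t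
    decreasing); it lets the values on a grid control those in between. *)
Lemma comb_scale l x q : convex_weights l -> 0 < x -> 1 <= q -> comb l (q * x) <= q * comb l x.
Proof.
move=> /andP[/allP lp /eqP l1] x0 q1; rewrite /comb mulr_sumr big_seq [leRHS]big_seq.
have q0 : 0 < q by lra.
apply: ler_sum => -[w t] /lp /andP[/= w0 t0]; rewrite [leRHS]mulrCA ler_wpM2l //.
have -> : q * ((1 + t) * x / (x + t)) = (1 + t) * (q * x) / (x + t) by rewrite !mulrA (mulrC q).
rewrite ler_wpM2l ?mulr_ge0 ?addr_ge0 ?(ltW x0) ?(ltW q0) ?(ltW t0) //.
by rewrite lef_pV2 ?posrE ?addr_gt0 ?mulr_gt0 // lerD2r ler_peMl // ltW.
Qed.

Variable f : R -> R.
Hypothesis fpos : forall t, 0 < t -> 0 < f t.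
Hypothesis f1 : f 1 = 1.
Hypothesis fdd : divdiff_nonneg f.

(** Separation without compactness of the set of combinations: if none is close, a near-minimizer of
    the squared distance D yields a half-space that contains all kernels and misses f, which
    [cauchy_duality] excludes. *)
Lemma approx_finite N (x : nat -> R) (k : nat) eta :
  increasing_upto N.*2.+1 x -> 0 < x 0%N -> (k < N.*2.+1)%N -> x k = 1 -> 0 < eta ->
  exists2 l, convex_weights l & forall i : 'I_N.*2.+1, `|comb l (x i) - f (x i)| <= eta.
Proof.
move=> xi x0 kM xk eta0; set M := N.*2.+1 in xi kM *.
pose D l := \sum_(i < M) (comb l (x i) - f (x i)) ^+ 2.
have xp (i : 'I_M) : 0 < x i.
  case: i => -[|i] //= iM; apply: lt_trans x0 _; exact: xi.
suff [l lc lD] : exists2 l, convex_weights l & D l < eta ^+ 2.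
  exists l => // i; rewrite -ler_sqr ?nnegrE ?(ltW eta0) // real_normK ?num_real //.
  apply: le_trans (ltW lD); rewrite /D (bigD1 i) //= lerDl.
  by apply: sumr_ge0 => j _; exact: sqr_ge0.
have D0 l : 0 <= D l by apply: sumr_ge0 => j _; exact: sqr_ge0.
apply: contrapT => Hno; set e := eta ^+ 2 in Hno; have e0 : 0 < e by rewrite exprn_gt0.
have De l : convex_weights l -> e <= D l.
  by move=> lc; rewrite leNgt; apply/negP => lD; apply: Hno; exists l.
pose B := \sum_(i < M) (1 + x i) ^+ 2.
have B0 : 0 <= B by apply: sumr_ge0 => j _; exact: sqr_ge0.
have Be0 : 0 < B + e by lra.
(* tau is the step taken towards a kernel. With tau (B + e) = e/2, the quadratic term, at most tau^2
   B, and the slack delta = tau e / 2 together cost at most half of e in the separation. *)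
pose tau := e / (B + e) / 2.
have tau0 : 0 < tau by rewrite /tau divr_gt0 // divr_gt0.
have tauB : tau * (B + e) = e / 2.
  by rewrite /tau mulrAC divfK // gt_eqF.
have tau1 : tau <= 1.
  by rewrite -(ler_pM2r Be0) tauB; lra.
pose delta := tau * e / 2.
have delta0 : 0 < delta by rewrite /delta divr_gt0 // mulr_gt0.
(* If every combination could be improved by delta, enough improvements would make D negative. *)
have [l lc lmin] : exists2 l, convex_weights l &
    forall l', convex_weights l' -> D l - delta <= D l'.
  apply: contrapT => Hno'.
  pose l0 : seq (R * R) := [:: (1, 1)].
  have l0c : convex_weights l0.
    by rewrite /convex_weights /= big_seq1 /= ler01 ltr01 eqxx.
  have step n : exists2 l, convex_weights l & D l <= D l0 - n%:R * delta.
    elim: n => [|n [l lc lD]]; first by exists l0 => //; rewrite mul0r subr0.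
    apply: contrapT => Hs; apply: Hno'; exists l => // l' l'c.
    rewrite leNgt; apply/negP => ll'; apply: Hs; exists l' => //.
    by rewrite -natr1 mulrDl; lra.
  have [l lc] := step (Num.bound (D l0 / delta)).
  have := archi_boundP (divr_ge0 (D0 l0) (ltW delta0)).
  by rewrite ltr_pdivrMr // => h1 h2; have := D0 l; lra.
pose v i := comb l (x i); pose c i := v i - f (x i).
pose kt t i : R := (1 + t) * x i / (x i + t).
have ktb t (i : 'I_M) : 0 < t -> 0 <= kt t i <= 1 + x i.
  move=> t0; have xpi := xp i; rewrite /kt; apply/andP; split.
    by rewrite divr_ge0 ?mulr_ge0 ?addr_ge0 ?(ltW t0) ?(ltW xpi).
  rewrite ler_pdivrMr ?addr_gt0 //; nra.
(* Moving l by tau towards the kernel of t cannot lower D by more than delta; expanding the square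
   gives the half-space inequality. *)
have sep t : 0 < t -> e / 2 <= \sum_(i < M) c i * (kt t i - f (x i)).
  move=> t0; pose l' := (tau, t) :: [seq ((1 - tau) * wt.1, wt.2) | wt <- l].
  have l'c : convex_weights l'.
    move/andP: lc => [/allP lp /eqP l1]; apply/andP; split.
      rewrite /= t0 (ltW tau0) /=; apply/allP => _ /mapP[wt /lp /andP[w0 wt0] ->] /=.
      by rewrite wt0 mulr_ge0 // subr_ge0.
    by rewrite big_cons big_map /= -mulr_sumr l1 mulr1 addrC subrK.
  have l'E i : comb l' (x i) = v i + tau * (kt t i - v i).
    rewrite /comb big_cons big_map /=.
    rewrite (eq_bigr (fun wt => (1 - tau) * (wt.1 * ((1 + wt.2) * x i / (x i + wt.2))))); last first.
      by move=> wt _; rewrite [RHS]mulrA.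
    by rewrite -mulr_sumr -/(comb l (x i)) -/(v i) -/(kt t i); ring.
  have DE : D l' = D l + 2 * tau * \sum_(i < M) c i * (kt t i - v i) +
      tau ^+ 2 * \sum_(i < M) (kt t i - v i) ^+ 2.
    rewrite /D !mulr_sumr -!big_split /=; apply: eq_bigr => i _.
    by rewrite l'E -/(v i) /c; ring.
  have SB : \sum_(i < M) (kt t i - v i) ^+ 2 <= B.
    apply: ler_sum => i _; have /andP[k0 k1] := ktb t i t0.
    have /andP[v0 v1] := comb_bound lc (xp i); rewrite -/(v i) in v0 v1.
    rewrite -[leLHS]real_normK ?num_real // ler_sqr ?nnegrE ?addr_ge0 ?(ltW (xp i)) //.
    by rewrite ler_norml; lra.
  have -> : \sum_(i < M) c i * (kt t i - f (x i)) = \sum_(i < M) c i * (kt t i - v i) + D l.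
    by rewrite /D -big_split /=; apply: eq_bigr => i _; rewrite -/(v i) /c; ring.
  have := lmin _ l'c; rewrite DE; have := De l lc.
  move: SB; set S1 := \sum_(i < M) _ ^+ 2; set S2 := \sum_(i < M) _ * _ => SB Dl H.
  have H2 : tau ^+ 2 * S1 <= tau ^+ 2 * B by rewrite ler_pM2l // exprn_gt0.
  have : - (e / 2) * (2 * tau) <= S2 * (2 * tau).
    rewrite /delta in H; have : tau * (tau * (B + e)) = tau * (e / 2) by rewrite tauB.
    have : 0 <= tau ^+ 2 * e by rewrite mulr_ge0 ?sqr_ge0 // ltW.
    rewrite !expr2 in H H2 *; nra.
  rewrite ler_pM2r; first by lra.
  by rewrite mulr_gt0.
pose F := \sum_(i < M) c i * f (x i).
(* At node k, the point 1, f and all kernels equal 1. Subtracting F + e/4 there makes the affine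
   inequality homogeneous: kernels give at least e/4, while f gives -e/4. *)
pose c' i := c i - (if i == k then F + e / 4 else 0).
have c'E (h : nat -> R) : \sum_(i < M) c' i * h i = \sum_(i < M) c i * h i - (F + e / 4) * h k.
  under eq_bigr do rewrite mulrBl.
  rewrite sumrB; congr (_ - _); rewrite (bigD1 (Ordinal kM)) //= eqxx big1 ?addr0 // => i ik.
  by rewrite ifN ?mul0r //; apply: contraNneq ik => ik; apply/eqP/val_inj.
have := @cauchy_duality R f fpos fdd N x c' xi x0; rewrite -/M => dual.
have {dual} : 0 <= \sum_(i < M) c' i * f (x i).
  apply: dual => t t0; rewrite (c'E (fun i => x i / (x i + t))) xk.
  have := sep t t0; have -> : \sum_(i < M) c i * (kt t i - f (x i)) =
     (1 + t) * (\sum_(i < M) c i * (x i / (x i + t))) - F.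
    rewrite mulr_sumr -sumrB; apply: eq_bigr => i _; rewrite /kt; ring.
  set S := \sum_(i < M) _ => H.
  have t1 : 0 < 1 + t by rewrite addr_gt0.
  rewrite -(pmulr_rge0 _ t1) mulrBr mulrCA mul1r divff ?gt_eqF // mulr1; lra.
rewrite (c'E (fun i => f (x i))) xk f1 mulr1 -/F; lra.
Qed.

(** The geometric grid of ratio q = 1 + h has 1 in its middle and covers [1/B, B] by Bernoulli's
    inequality. Between neighbours f and the combination grow by a factor at most q; since h f(B) <=
    delta/2 and the error at the nodes is at most delta/4, everything adds up to delta. *)
Theorem approx_interval (B delta : R) : 1 <= B -> 0 < delta ->
  exists2 l, convex_weights l & forall x, B^-1 <= x -> x <= B -> `|comb l x - f x| <= delta.
Proof.
move=> B1 d0; have B0 : 0 < B by lra.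
have fB0 : 0 < f B by exact: fpos.
pose h := Num.min 1 (delta / f B / 2).
have h0 : 0 < h by rewrite lt_min ltr01 divr_gt0 // divr_gt0.
have h1 : h <= 1 by rewrite ge_min lexx.
have hf : h * f B <= delta / 2.
  by rewrite -ler_pdivlMr // mulrAC ge_min lexx orbT.
pose q := 1 + h; have q1 : 1 < q by rewrite ltrDl.
have q0 : 0 < q by lra.
pose N := Num.bound (B / h).
have qN : B <= q ^+ N.
  have bern n : 1 + n%:R * h <= q ^+ n.
    elim: n => [|n IHn]; first by rewrite mul0r addr0 expr0.
    rewrite exprSr -natr1; apply: (@le_trans _ _ ((1 + n%:R * h) * q)); last by rewrite ler_pM2r.
    rewrite /q; have : 0 <= n%:R * h * h by rewrite !mulr_ge0 // ltW.
    by nra.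
  apply: le_trans (bern N); have := archi_boundP (divr_ge0 (ltW B0) (ltW h0)).
  by rewrite ltr_pdivrMr // -/N; lra.
have qn0 n : 0 < q ^+ n by rewrite exprn_gt0.
pose x k := q ^+ k / q ^+ N.
have xS k : x k.+1 = q * x k by rewrite /x exprS mulrA.
have xi : increasing_upto N.*2.+1 x.
  by move=> i j ij _; rewrite /x ltr_pM2r ?invr_gt0 // ltr_eXn2l.
have x0 : 0 < x 0%N by rewrite divr_gt0.
have NM : (N < N.*2.+1)%N by lia.
have xN : x N = 1 by rewrite /x divff // gt_eqF.
have [l lc lx] := approx_finite xi x0 NM xN (divr_gt0 d0 (ltr0Sn R 3)).
exists l => // y yB By.
have x0y : x 0%N <= y.
  by apply: le_trans yB; rewrite /x expr0 mul1r lef_pV2 ?posrE.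
have yx : y <= x N.*2.
  apply: (le_trans By); rewrite /x -addnn exprD mulfK // gt_eqF //.
have [i iM /andP[xiy yxi]] : exists2 i, (i < N.*2.+1)%N & x i <= y <= q * x i.
  have : forall m, (m <= N.*2)%N -> y <= x m -> exists2 i, (i < N.*2.+1)%N & x i <= y <= q * x i.
    elim=> [_ y0|m IHm mN ym].
      exists 0%N => //; rewrite x0y /=; apply: (le_trans y0); rewrite ler_peMl ?ltW //.
    have [ym'|ym'] := leP y (x m); first by apply: IHm => //; exact: ltnW.
    by exists m; [exact: ltnW|rewrite (ltW ym') -xS].
  by apply; [exact: leqnn|].
have : `|comb l (x i) - f (x i)| <= delta / 4 by exact: (lx (Ordinal iM)).
rewrite ler_norml => /andP[e1 e2].
have xi0 : 0 < x i by rewrite divr_gt0.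
have y0 : 0 < y by exact: lt_le_trans xiy.
have fmono a b : 0 < a -> a <= b -> f a <= f b.
  by move=> a0; rewrite le_eqVlt => /orP[/eqP -> //|]; exact: divdiff_mono.
have fxB : f (x i) <= f B by apply: fmono => //; exact: le_trans By.
have fx0 := fpos xi0.
have fq : f (q * x i) <= q * f (x i).
  have xq : x i < q * x i by rewrite ltr_pMl.
  have qx0 : 0 < q * x i by rewrite mulr_gt0.
  have := divdiff_antitone_div fpos fdd xi0 xq; rewrite ler_pdivrMr //.
  have xn : x i != 0 by rewrite gt_eqF.
  by have -> : f (x i) / x i * (q * x i) = q * f (x i) by field.
have gq := comb_scale lc xi0 (ltW q1).
have fy1 := fmono _ _ xi0 xiy; have fy2 := fmono _ _ y0 yxi.
have gy1 := comb_mono lc xi0 xiy; have gy2 := comb_mono lc y0 yxi.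
have hfx : h * f (x i) <= delta / 2 by apply: le_trans hf; rewrite ler_pM2l.
move: hfx e1 e2 gq fq fy1 fy2 gy1 gy2; rewrite /q.
move: (comb l ((1 + h) * x i)) (f ((1 + h) * x i)) (comb l (x i)) (f (x i)) (comb l y) (f y) => Gq Fq G Fx Gy Fy hfx e1 e2 gq fq *.
have hG : h * (G - Fx) <= delta / 4.
  have [G0|G0] := leP 0 (G - Fx); last first.
    by apply: (@le_trans _ _ 0); [rewrite pmulr_rle0 // ltW|lra].
  by apply: (@le_trans _ _ (1 * (G - Fx))); [rewrite ler_wpM2r|lra].
by rewrite ler_norml; apply/andP; split; lra.
Qed.

End Approximation.

(** * Spectral theorem and Cayley-Hamilton for matrices encoded as functions *)

Notation RC := (complex Rdefinitions.R).

Definition toC (z : Cx) : RC := Complex (re z) (im z).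
Definition ofC (z : RC) : Cx := mkCx (complex.Re z) (complex.Im z).

Lemma toCK : cancel toC ofC. Proof. by case. Qed.
Lemma ofCK : cancel ofC toC. Proof. by case. Qed.
Lemma toC_inj : injective toC. Proof. exact: can_inj toCK. Qed.

Lemma toC0 : toC C0 = 0. Proof. by []. Qed.
Lemma toC_add z w : toC (Cadd z w) = toC z + toC w. Proof. by []. Qed.
Lemma toC_mul z w : toC (Cmul z w) = toC z * toC w. Proof. by []. Qed.
Lemma toC_sub z w : toC (Csub z w) = toC z - toC w. Proof. by []. Qed.
Lemma toC_csum n g : toC (csum n g) = \sum_(i < n) toC (g i).
Proof. by elim: n => [|n IHn]; rewrite ?big_ord0 // big_ord_recr /= toC_add IHn. Qed.

Definition mx_of n (A : Mat) : 'M[RC]_n := \matrix_(i, j) toC (A i j).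
Definition mat_of n (A : 'M[RC]_n) : Mat := fun i j =>
  if (insub i, insub j) is (Some i', Some j') then ofC (A i' j') else C0.

Lemma mx_ofK n (A : 'M[RC]_n) : mx_of n (mat_of A) = A.
Proof. by apply/matrixP => i j; rewrite mxE /mat_of !valK ofCK. Qed.

Lemma mx_of_eq n A B : meq n A B <-> mx_of n A = mx_of n B.
Proof.
split=> [AB|/matrixP AB i j /ssrnat.ltP hi /ssrnat.ltP hj].
  by apply/matrixP => i j; rewrite !mxE AB //; apply/ssrnat.ltP.
by have := AB (Ordinal hi) (Ordinal hj); rewrite !mxE /= => /toC_inj.
Qed.

Lemma mx_of_mul n A B : mx_of n (mmul n A B) = mx_of n A *m mx_of n B.
Proof.
apply/matrixP => i j; rewrite !mxE toC_csum; apply: eq_bigr => k _.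
by rewrite !mxE toC_mul.
Qed.

Lemma mid_eqb i j : mid i j = if i == j then C1 else C0.
Proof. by rewrite /mid; case: eqP => [->|/PeanoNat.Nat.eqb_neq ->]; rewrite ?PeanoNat.Nat.eqb_refl. Qed.

Lemma mx_of_id n : mx_of n mid = 1%:M.
Proof. by apply/matrixP => i j; rewrite !mxE mid_eqb -val_eqE /=; case: eqP. Qed.

Lemma mx_of_adj n A : mx_of n (madj A) = map_mx Num.conj (mx_of n A)^T.
Proof. by apply/matrixP => i j; rewrite !mxE. Qed.

Lemma mx_of_sub_scalar n A l : mx_of n (msub A (mscale l mid)) = mx_of n A - (toC l)%:M.
Proof.
apply/matrixP => i j; rewrite !mxE /msub /mscale toC_sub toC_mul mid_eqb -val_eqE /=.
by case: eqP => _; rewrite ?mulr1 ?mulr0.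
Qed.

Theorem hermitian_spectral n A : hermitian n A -> exists U d, unitary n U /\
  meq n A (mmul n (mmul n U (rdiag d)) (madj U)).
Proof.
move=> /mx_of_eq hA; rewrite mx_of_adj in hA; set M := mx_of n A in hA.
have Mh : M \is hermsymmx.
  by apply/is_hermitianmxP; rewrite expr0 scale1r; exact: hA.
have Dr := hermitian_spectral_diag_real Mh.
have /orthomx_spectralP ME := hermitian_normalmx Mh.
set P := spectralmx M in ME; set sp := spectral_diag M in ME Dr.
have Pu : P \is unitarymx by exact: spectral_unitarymx.
rewrite invmx_unitary // in ME.
pose d k : R := if insub k is Some k' then complex.Re (sp 0 k') else 0%R.
have tK : map_mx Num.conj (map_mx Num.conj P^T)^T = P.
  by apply/matrixP => i j; rewrite !mxE conjCK.
exists (mat_of (map_mx Num.conj P^T)), d; split.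
  apply/mx_of_eq; rewrite mx_of_mul mx_of_adj mx_ofK mx_of_id.
  by rewrite tK; exact/unitarymxP.
apply/mx_of_eq; rewrite !mx_of_mul mx_of_adj mx_ofK -/M {1}ME.
rewrite tK.
congr (_ *m _ *m _); apply/matrixP => i j; rewrite !mxE /rdiag.
have -> : Nat.eqb i j = (i == j).
  by rewrite -val_eqE /=; case: eqP => [->|/PeanoNat.Nat.eqb_neq //]; rewrite PeanoNat.Nat.eqb_refl.
case: eqP => [->|_] //; rewrite mulr1n /d valK.
have /mxOverP /(_ 0 j) := Dr; case: (sp 0 j) => a b; rewrite complex_real /= => /eqP b0.
by rewrite b0.
Qed.

Theorem injective_inverse n A :
  (forall x, nonzero_vec n x -> exists i, (i < n)%coq_nat /\ csum n (fun j => Cmul (A i j) (x j)) <> C0) ->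
  exists B, meq n (mmul n B A) mid /\ meq n (mmul n A B) mid.
Proof.
move=> H; suff U : mx_of n A \in unitmx.
  exists (mat_of (invmx (mx_of n A))); split; apply/mx_of_eq;
    by rewrite mx_of_mul mx_ofK mx_of_id ?mulVmx ?mulmxV.
rewrite -unitmx_tr -row_free_unit -kermx_eq0; apply/negPn/negP => /rowV0Pn [v vk v0].
move/sub_kermxP in vk.
pose x k := if insub k is Some k' then ofC (v 0 k') else C0.
have xE (k : 'I_n) : toC (x k) = v 0 k by rewrite /x valK ofCK.
have [|i [/ssrnat.ltP hi]] := H x.
  have [k vk0] : exists k, v 0 k != 0.
    apply/existsP; apply: contraNT v0 => /existsPn h.
    by apply/eqP/rowP => k; rewrite mxE; apply/eqP; rewrite -[_ == _]negbK.
  exists (k : nat); split; first exact/ssrnat.ltP/ltn_ord.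
  by move/(congr1 toC); rewrite xE => /eqP; rewrite (negPf vk0).
case; apply: toC_inj; rewrite toC_csum.
have /matrixP /(_ 0 (Ordinal hi)) := vk; rewrite !mxE toC0 => vki; rewrite -[RHS]vki.
by apply: eq_bigr => k _; rewrite !mxE toC_mul xE mulrC.
Qed.

Lemma eigenvalue_of_root n A z : root (char_poly (mx_of n A)^T) z -> eigenvalue n A (ofC z).
Proof.
rewrite -eigenvalue_root_char => /eigenvalueP [v vE v0].
pose x k := if insub k is Some k' then ofC (v 0 k') else C0.
have xE (k : 'I_n) : toC (x k) = v 0 k by rewrite /x valK ofCK.
exists x; split.
  have [k vk0] : exists k, v 0 k != 0.
    apply/existsP; apply: contraNT v0 => /existsPn h.
    by apply/eqP/rowP => k; rewrite mxE; apply/eqP; rewrite -[_ == _]negbK.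
  exists (k : nat); split; first exact/ssrnat.ltP/ltn_ord.
  by move/(congr1 toC); rewrite xE => /eqP; rewrite (negPf vk0).
move=> i /ssrnat.ltP hi; apply: toC_inj; rewrite toC_csum toC_mul ofCK.
have -> : toC (x i) = v 0 (Ordinal hi) by rewrite -xE.
have /matrixP /(_ 0 (Ordinal hi)) := vE; rewrite !mxE => vEi; rewrite -[RHS]vEi.
by apply: eq_bigr => k _; rewrite !mxE toC_mul xE mulrC.
Qed.

Lemma mx_of_shift_prod n A N ls : mx_of n (shift_prod n A N ls) =
  foldl (fun M l => M *m (mx_of n A - (toC l)%:M)) (mx_of n N) ls.
Proof.
elim: ls N => [|l ls IH] N //=.
by rewrite IH mx_of_mul /shift mx_of_sub_scalar.
Qed.

Theorem annihilating_eigenvalues n A : exists ls, (forall l, List.In l ls -> eigenvalue n A l) /\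
  meq n (shift_prod n A mid ls) (fun _ _ => C0).
Proof.
case: n => [|n]; first by exists [::]; split=> // i j /ssrnat.ltP.
set M := mx_of n.+1 A.
have [r rE] := closed_field_poly_normal (char_poly M^T).
rewrite (monicP (char_poly_monic _)) scale1r in rE.
have rootr z : z \in r -> root (char_poly M^T) z.
  by move=> zr; rewrite rE root_prod_XsubC.
exists [seq ofC z | z <- r]; split.
  elim: r {rE} rootr => //= z r IH rootr l [<-|hl].
    by apply: eigenvalue_of_root; apply: rootr; rewrite mem_head.
  by apply: IH hl => // w wr; apply: rootr; rewrite inE wr orbT.
apply/mx_of_eq; rewrite mx_of_shift_prod mx_of_id.
have -> : mx_of n.+1 (fun _ _ => C0) = 0 by apply/matrixP => i j; rewrite !mxE.
have CH : char_poly M = char_poly M^T.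
  rewrite /char_poly /char_poly_mx -[RHS]det_tr linearB /= tr_scalar_mx.
  by rewrite map_trmx trmxK.
have := Cayley_Hamilton M; rewrite CH rE rmorph_prod /= => <-.
have gen N : foldl (fun N l => N *m (M - (toC l)%:M)) N [seq ofC z | z <- r] =
    N * \prod_(z <- r) horner_mx M ('X - z%:P).
  elim: r N {rE rootr CH} => [|z r IH] N /=; first by rewrite big_nil mulr1.
  rewrite IH big_cons mulrA ofCK; congr (_ * _ * _).
  by rewrite rmorphB /= horner_mx_X horner_mx_C.
by rewrite gen mul1r.
Qed.

Lemma unitary_mulr n U : unitary n U -> meq n (mmul n U (madj U)) mid.
Proof.
by move=> /mx_of_eq; rewrite mx_of_mul mx_of_id => /mulmx1C h; apply/mx_of_eq; rewrite mx_of_mul mx_of_id.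
Qed.

Notation RR := Rdefinitions.R.

Lemma rsum_bigE n (g : nat -> RR) : rsum n g = \sum_(i < n) g i.
Proof. by elim: n => [|n IHn]; rewrite ?big_ord0 // big_ord_recr /= IHn. Qed.

Lemma Cnorm2_RtoC (x : RR) : Cnorm2 (RtoC x) = x ^+ 2.
Proof. by rewrite /Cnorm2 /= Rmult_0_l Rplus_0_r expr2. Qed.

Definition ext_ord N (v : 'I_N -> RR) (k : nat) : RR := if insub k is Some k' then v k' else 0.

Lemma ext_ordE N (v : 'I_N -> RR) (k : 'I_N) : ext_ord v k = v k.
Proof. by rewrite /ext_ord valK. Qed.

Definition real_mat N (U : 'M[RR]_N) : Mat := fun i j =>
  if (insub i, insub j) is (Some i', Some j') then RtoC (U i' j') else C0.

Lemma real_matE N (U : 'M[RR]_N) (i j : 'I_N) : real_mat U i j = RtoC (U i j).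
Proof. by rewrite /real_mat !valK. Qed.

Lemma mx_of_real_mat N (U : 'M[RR]_N) : mx_of N (real_mat U) = map_mx (real_complex RR) U.
Proof. by apply/matrixP => i j; rewrite !mxE real_matE. Qed.

Lemma mx_of_adj_real_mat N (U : 'M[RR]_N) :
  mx_of N (madj (real_mat U)) = map_mx (real_complex RR) U^T.
Proof.
apply/matrixP => i j; rewrite !mxE /madj real_matE Cconj_RtoC //.
Qed.

Lemma mx_of_rdiag N (d : nat -> RR) :
  mx_of N (rdiag d) = map_mx (real_complex RR) (diag_mx (\row_i d i)).
Proof.
apply/matrixP => i j; rewrite !mxE /rdiag.
have -> : Nat.eqb i j = (i == j).
  by rewrite -val_eqE /=; case: eqP => [->|/PeanoNat.Nat.eqb_neq //]; rewrite PeanoNat.Nat.eqb_refl.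
by case: eqP => [->|_].
Qed.

Lemma herm_fcalc_diag (f : RR -> RR) N (d : nat -> RR) :
  herm_fcalc f N (rdiag d) (rdiag (fun i => f (d i))).
Proof.
have madj1 : mx_of N (madj mid) = 1%:M.
  by rewrite mx_of_adj mx_of_id trmx1 map_mx1.
exists mid, d; split; first by apply/mx_of_eq; rewrite mx_of_mul madj1 mx_of_id mulmx1.
by split; apply/mx_of_eq; rewrite !mx_of_mul madj1 mx_of_id mulmx1 mul1mx.
Qed.

Theorem matrix_monotone_divdiff (f : RR -> RR) : matrix_monotone_class f -> divdiff_nonneg f.
Proof.
move=> [_ [_ fmono]] N y p yi y0 sp.
have [U [v [xi [UU UBU ->]]]] := rank_one_realization yi sp.
have yp k : (k < N.*2)%N -> Rlt 0 (y k).
  case: k => [_|k kN]; first by apply/RltP.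
  by apply/RltP; apply: lt_trans y0 _; apply: yi.
pose la k := y k.*2; pose mu k := y k.*2.+1; pose vn := ext_ord v; pose xn := ext_ord xi.
pose Un := real_mat U.
pose B : Mat := fun i j => Cadd (rdiag la i j) (Cmul (RtoC (vn i)) (RtoC (vn j))).
pose FB := mmul N (mmul N Un (rdiag (fun i => f (mu i)))) (madj Un).
have BE : meq N B (mmul N (mmul N Un (rdiag mu)) (madj Un)).
  apply/mx_of_eq; rewrite !mx_of_mul mx_of_adj_real_mat mx_of_real_mat mx_of_rdiag -!map_mxM.
  rewrite UBU; apply/matrixP => i j; rewrite mxE /B toC_add toC_mul.
  have /matrixP /(_ i j) := mx_of_rdiag N la; rewrite mxE => ->.
  rewrite !mxE big_ord1 !mxE rmorphD rmorphM /vn !ext_ordE //.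
have Uu : unitary N Un.
  apply/mx_of_eq; rewrite mx_of_mul mx_of_adj_real_mat mx_of_real_mat -map_mxM UU.
  by rewrite mx_of_id map_mx1.
have quadB x : quad N B x = Cadd (quad N (rdiag la) x)
    (RtoC (Cnorm2 (csum N (fun i => Cmul (RtoC (vn i)) (x i))))).
  rewrite -Cnorm2_conj_mul -csum_conj -csum_mul_r.
  rewrite (quad_add N (rdiag la) (fun i j => Cmul (RtoC (vn i)) (RtoC (vn j))) x); congr Cadd.
  apply: csum_ext => i _; rewrite Cconj_mul Cconj_RtoC.
  rewrite (csum_ext _ _ (fun j => Cmul (RtoC (vn i)) (Cmul (RtoC (vn j)) (x j)))).
    by rewrite csum_mul_l; cx.
  by move=> j _; cx.
have hermB : hermitian N B.
  move=> i j hi hj; rewrite /madj /B Cconj_add Cconj_mul !Cconj_RtoC.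
  rewrite (hermitian_rdiag N la i j hi hj) /madj; congr Cadd; cx.
have pdA : pd N (rdiag la).
  split; first exact: hermitian_rdiag.
  move=> x [i [hi nz]]; rewrite quad_rdiag /=.
  have laN k : (k < N)%coq_nat -> Rlt 0 (la k).
    by move=> /ssrnat.ltP kN; apply: yp; rewrite ltn_double.
  apply: (Rlt_le_trans _ (la i * Cnorm2 (x i))).
    by apply: Rmult_lt_0_compat; [exact: laN|exact: Cnorm2_pos].
  apply: (rsum_term_le N (fun l => la l * Cnorm2 (x l))%R i) => // j hj.
  by apply: Rmult_le_pos; [exact/Rlt_le/laN|exact: Cnorm2_nonneg].
have pdB : pd N B.
  split=> // x nz; rewrite quadB re_add /=.
  have := proj2 pdA x nz; have := Cnorm2_nonneg (csum N (fun i => Cmul (RtoC (vn i)) (x i))).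
  by move=> h1 h2; apply: Rplus_lt_le_0_compat.
have AB : loewner_le N (rdiag la) B.
  split; first by apply: hermitian_sub => //; exact: hermitian_rdiag.
  move=> x; rewrite quad_sub quadB.
  have := Cnorm2_nonneg (csum N (fun i => Cmul (RtoC (vn i)) (x i))).
  rewrite re_sub re_add /=; Lra.lra.
have fcB : herm_fcalc f N B FB by exists Un, mu.
have [_ H] := fmono N _ _ _ _ pdA pdB AB (herm_fcalc_diag f N la) fcB.
have := H (fun k => RtoC (xn k)); rewrite quad_sub quad_udu quad_rdiag re_sub /=.
move=> /RleP; rewrite !rsum_bigE => {}H; apply: (le_trans H); rewrite le_eqVlt; apply/orP; left; apply/eqP.
have colE (i : 'I_N) : ip N (col Un i) (fun k => RtoC (xn k)) = RtoC (\sum_(k < N) U k i * xi k).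
  rewrite /ip /col (csum_ext _ _ (fun k => RtoC (ext_ord (fun k => U k i * xi k) k))).
    by rewrite csum_RtoC rsum_bigE; congr RtoC; apply: eq_bigr => k _; rewrite ext_ordE.
  move=> k /ssrnat.ltP kN; rewrite -[k]/(nat_of_ord (Ordinal kN)) ext_ordE /Un real_matE /xn ext_ordE.
  by rewrite Cconj_RtoC -RtoC_mul.
congr (_ - _); apply: eq_bigr => i _.
  by rewrite colE Cnorm2_RtoC.
by rewrite Cnorm2_RtoC /xn ext_ordE.
Qed.

Lemma wsumE (l : seq (RR * RR)) : wsum l = \sum_(wt <- l) wt.1.
Proof. by elim: l => [|[w t] l IH]; rewrite ?big_nil // big_cons /= IH. Qed.

Lemma convex_weights_ok (l : seq (RR * RR)) : convex_weights l -> weights_ok l /\ wsum l = 1.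
Proof.
move=> /andP[lp /eqP l1]; split; last by rewrite wsumE.
elim: l lp {l1} => [|[w t] l IH] /=; first by constructor.
move=> /andP[/andP[/RleP w0 /RltP t0] lp]; constructor; [by split|exact: IH].
Qed.

Lemma combC_real (l : seq (RR * RR)) (x : RR) : weights_ok l -> Rlt 0 x ->
  combC l (RtoC x) = RtoC (comb l x).
Proof.
move=> lw x0; rewrite /comb; elim: lw => [|[w t] l' [/= w0 t0] _ IH]; first by rewrite big_nil.
rewrite big_cons IH RtoC_add; congr Cadd; rewrite RtoC_mul; congr Cmul; rewrite /kern.
have xt : Rplus x t <> 0%R.
  by move=> h; have := Rplus_lt_0_compat _ _ x0 t0; rewrite h => /Rlt_irrefl.
by rewrite -RtoC_add -(RtoC_inv _ xt) -!RtoC_mul -RinvE -mulrA.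
Qed.

Theorem monotone_real_approx (f : RR -> RR) (F : Cx -> Cx) :
  matrix_monotone_class f -> analytic_extension f F ->
  forall B delta, Rle 1 B -> Rlt 0 delta -> exists l, weights_ok l /\ wsum l = 1 /\
    forall x, Rle (Rinv B) x /\ Rle x B -> Rle (Cmod (Csub (F (RtoC x)) (combC l (RtoC x)))) delta.
Proof.
move=> fm [_ Ff] B delta /RleP B1 /RltP d0.
have fdd := matrix_monotone_divdiff fm.
have fpos t : 0 < t -> 0 < f t by move=> /RltP t0; apply/RltP; apply: fm.1.
have [l lc H] := approx_interval fpos fm.2.1 fdd B1 d0.
have [lw l1] := convex_weights_ok lc.
exists l; do 2 split => //; move=> x [/RleP xB /RleP Bx].
have B0 : 0 < B by exact: lt_le_trans B1.
rewrite RinvE in xB.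
have x0 : 0 < x by apply: lt_le_trans xB; rewrite invr_gt0.
move/RltP: (x0) => x0'.
rewrite Ff // combC_real // -RtoC_sub Cmod_RtoC Rabs_minus_sym RabsE.
by apply/RleP; exact: H.
Qed.

End Loewner.

Module PositiveMaps.
Import ComplexNumbers Vectors.
Local Open Scope R_scope.

Lemma ip_csum_r n u k (w : nat -> nat -> Cx) :
  ip n u (fun a => csum k (fun l => w l a)) = csum k (fun l => ip n u (w l)).
Proof.
unfold ip; rewrite (csum_ext n _ (fun a => csum k (fun l => Cmul (Cconj (u a)) (w l a))))
  by (intros; symmetry; apply csum_mul_l).
apply csum_swap.
Qed.

Section Orthonormal.
Variables (n : nat) (U : Mat).
Hypothesis hU : unitary n U.

Lemma ip_col m l : (m < n)%nat -> (l < n)%nat -> ip n (col U m) (col U l) = mid m l.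
Proof. intros hm hl; exact (hU m l hm hl). Qed.

Lemma parseval x y : csum n (fun l => Cmul (Cconj (ip n (col U l) x)) (ip n (col U l) y)) = ip n x y.
Proof.
symmetry; transitivity (ip n x (fun a => csum n (fun l => Cmul (ip n (col U l) y) (col U l a)))).
- apply ip_ext; [reflexivity|intros a ha].
  rewrite <- (mv_id n y a ha); unfold mv.
  rewrite (csum_ext n _ (fun b => csum n (fun l => Cmul (Cmul (U a l) (Cconj (U b l))) (y b)))).
  + rewrite csum_swap; apply csum_ext; intros l hl.
    unfold ip; rewrite <- csum_mul_r; apply csum_ext; intros b hb; unfold col; ring.
  + intros b hb; rewrite csum_mul_r, <- (@Loewner.unitary_mulr n U hU a b ha hb); reflexivity.
- rewrite ip_csum_r; apply csum_ext; intros l hl; rewrite ip_mul_r, <- (ip_conj n (col U l) x); ring.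
Qed.

Lemma parseval_norm x : rsum n (fun l => Cnorm2 (ip n (col U l) x)) = re (ip n x x).
Proof.
rewrite <- (parseval x x), re_csum; apply rsum_ext; intros l hl; rewrite Cnorm2_conj_mul; reflexivity.
Qed.

Definition vec_of (c : nat -> Cx) : nat -> Cx := fun a => csum n (fun l => Cmul (c l) (col U l a)).

Lemma coord_vec_of c m : (m < n)%nat -> ip n (col U m) (vec_of c) = c m.
Proof.
intros hm; unfold vec_of; rewrite ip_csum_r.
rewrite (csum_ext n _ (fun l => Cmul (mid m l) (c l))).
- apply csum_delta; assumption.
- intros l hl; rewrite ip_mul_r, ip_col by assumption; ring.
Qed.

Variables (H : Mat) (d : nat -> R).
Hypothesis hH : meq n H (mmul n (mmul n U (rdiag d)) (madj U)).

Lemma quad_spectral x : quad n H x = RtoC (rsum n (fun l => d l * Cnorm2 (ip n (col U l) x))).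
Proof. rewrite (quad_ext n H _ x hH); apply quad_udu. Qed.

Lemma coord_spectral x m : (m < n)%nat ->
  ip n (col U m) (mv n H x) = Cmul (RtoC (d m)) (ip n (col U m) x).
Proof.
intros hm.
transitivity (ip n (col U m) (vec_of (fun l => Cmul (RtoC (d l)) (ip n (col U l) x)))).
- apply ip_ext; [reflexivity|intros a ha].
  rewrite (mv_ext n H _ x x hH (fun _ _ => eq_refl) a ha).
  rewrite (mv_ext n _ _ x x (udu_msum n U d) (fun _ _ => eq_refl) a ha).
  unfold mv, msum, vec_of.
  rewrite (csum_ext n _ (fun j => csum n (fun l => Cmul (mscale (RtoC (d l)) (proj U l) a j) (x j))))
    by (intros; symmetry; apply csum_mul_r).
  rewrite csum_swap; apply csum_ext; intros l hl.
  unfold ip; rewrite <- csum_mul_l, <- csum_mul_r; apply csum_ext; intros j hj.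
  unfold mscale, proj, col; ring.
- apply coord_vec_of; assumption.
Qed.

Lemma spectral_pos : pd n H -> forall l, (l < n)%nat -> 0 < d l.
Proof.
intros [_ hp] l hl.
assert (nz : nonzero_vec n (col U l)).
{ apply NNPP; intros hn.
  assert (e : ip n (col U l) (col U l) = C0).
  { unfold ip; rewrite (csum_ext n _ (fun _ => C0)); [apply csum_0|intros i hi].
    destruct (classic (col U l i = C0)) as [->|ne]; [ring|].
    exfalso; apply hn; exists i; auto. }
  rewrite ip_col in e by assumption; unfold mid in e; rewrite Nat.eqb_refl in e; exact (C1_neq_C0 e). }
specialize (hp _ nz).
rewrite quad_ip, coord_spectral, ip_col in hp by assumption.
unfold mid in hp; rewrite Nat.eqb_refl in hp; simpl in hp; lra.
Qed.
End Orthonormal.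

Lemma weighted_young (a t k : R) (X Y : Cx) : 0 < a -> 0 < t ->
  2 * k * re (Cmul (Cconj X) Y) - k * k * (Cnorm2 Y + t * (Cnorm2 Y / a)) <= a / (a + t) * Cnorm2 X.
Proof.
intros ha ht; set (s := (a + t) / a).
assert (sp : 0 < s) by (apply Rdiv_lt_0_compat; lra).
assert (e1 : a / (a + t) = / s) by (unfold s; field; lra).
assert (e2 : Cnorm2 Y + t * (Cnorm2 Y / a) = s * Cnorm2 Y) by (unfold s; field; lra).
rewrite e1, e2; unfold Cnorm2; simpl; set (x1 := re X); set (x2 := im X); set (y1 := re Y); set (y2 := im Y).
apply Rmult_le_reg_l with s; [assumption|].
replace (s * (/ s * (x1 * x1 + x2 * x2))) with (x1 * x1 + x2 * x2) by (field; lra).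
pose proof (Rle_0_sqr (x1 - k * s * y1)) as q1; pose proof (Rle_0_sqr (x2 - k * s * y2)) as q2.
unfold Rsqr in q1, q2; lra.
Qed.

Definition ImM (A : Mat) : Mat := mscale (mkCx 0 (- (1 / 2))) (msub A (madj A)).

Lemma hermitian_ImM n A : hermitian n (ImM A).
Proof. intros i j _ _; unfold ImM, mscale, msub, madj; apply Cx_ext; simpl; field. Qed.

Lemma ReM_ImM A i j : A i j = Cadd (ReM A i j) (Cmul (mkCx 0 1) (ImM A i j)).
Proof. unfold ReM, ImM, mscale, madd, msub, madj; apply Cx_ext; simpl; field. Qed.

Lemma quad_ImM n A x : quad n (ImM A) x = RtoC (im (quad n A x)).
Proof. unfold ImM; rewrite quad_scale, quad_sub, quad_adj; apply Cx_ext; simpl; field. Qed.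

Section Sector.
Variables (n : nat) (A U : Mat) (d : nat -> R) (alpha : R).
Hypothesis hU : unitary n U.
Hypothesis hH : meq n (ReM A) (mmul n (mmul n U (rdiag d)) (madj U)).
Hypothesis hd : forall l, (l < n)%nat -> 0 < d l.
Hypothesis halpha : 0 <= alpha < PI / 2.
Hypothesis hsec : forall x, Rabs (im (quad n A x)) <= tan alpha * re (quad n A x).

Let h z := re (quad n A z).

Lemma re_quad_spectral z : h z = rsum n (fun l => d l * Cnorm2 (ip n (col U l) z)).
Proof. unfold h; rewrite <- re_quad_ReM, (quad_spectral n U _ d hH); reflexivity. Qed.

Lemma cos_sqr_tan : cos alpha ^ 2 * (1 + tan alpha * tan alpha) = 1.
Proof.
assert (c : 0 < cos alpha) by (apply cos_gt_0; lra).
unfold tan; pose proof (sin2_cos2 alpha) as s; unfold Rsqr in s.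
transitivity (sin alpha * sin alpha + cos alpha * cos alpha); [field; lra|exact s].
Qed.

Lemma tan_nonneg : 0 <= tan alpha.
Proof.
destruct (Req_dec alpha 0) as [->|ne]; [rewrite tan_0; lra|].
apply Rlt_le, tan_gt_0; lra.
Qed.

Let wnorm y := rsum n (fun l => Cnorm2 (ip n (col U l) y) / d l).

(* |<m, K z>| is bounded by polarization, applied to m = H^-1 K z. *)
Lemma wnorm_ImM z : wnorm (mv n (ImM A) z) <= tan alpha * tan alpha * h z.
Proof.
set (kz := mv n (ImM A) z); set (N := wnorm kz); set (tau := tan alpha).
assert (tn : 0 <= tau) by apply tan_nonneg.
set (m := vec_of n U (fun l => Cmul (RtoC (/ d l)) (ip n (col U l) kz))).
assert (cm : forall l, (l < n)%nat -> ip n (col U l) m = Cmul (RtoC (/ d l)) (ip n (col U l) kz)).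
{ intros l hl; apply (coord_vec_of n U hU); assumption. }
assert (mk : re (ip n m kz) = N).
{ rewrite <- (parseval n U hU), re_csum; apply rsum_ext; intros l hl; rewrite cm by assumption.
  rewrite Cconj_mul, Cconj_RtoC; unfold Cnorm2; simpl; field; specialize (hd l hl); lra. }
assert (hm : h m = N).
{ rewrite re_quad_spectral; apply rsum_ext; intros l hl; rewrite cm by assumption.
  rewrite Cnorm2_mul; unfold Cnorm2 at 1; simpl; unfold Rdiv; field; specialize (hd l hl); lra. }
assert (key : forall s, 0 < s -> 4 * s * N <= 2 * tau * (s * s * N + h z)).
{ intros s sp.
  set (p := fun i => Cadd (Cmul (RtoC s) (m i)) (z i)); set (q := fun i => Csub (Cmul (RtoC s) (m i)) (z i)).
  assert (lin : forall M, quad n M p = Cadd (Cadd (Cmul (RtoC (s * s)) (quad n M m)) (quad n M z))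
      (Cmul (RtoC s) (Cadd (ip n m (mv n M z)) (ip n z (mv n M m))))).
  { intros M; rewrite quad_ip.
    rewrite (ip_ext n p p _ (fun i => Cadd (Cmul (RtoC s) (mv n M m i)) (mv n M z i)))
      by (try reflexivity; intros; unfold p; rewrite mv_vec_add, mv_vec_mul; reflexivity).
    unfold p; rewrite ip_add_l, ip_mul_l, !ip_add_r, !ip_mul_r, Cconj_RtoC, !quad_ip, RtoC_mul; ring. }
  assert (lin' : forall M, quad n M q = Csub (Cadd (Cmul (RtoC (s * s)) (quad n M m)) (quad n M z))
      (Cmul (RtoC s) (Cadd (ip n m (mv n M z)) (ip n z (mv n M m))))).
  { intros M; rewrite quad_ip.
    rewrite (ip_ext n q q _ (fun i => Csub (Cmul (RtoC s) (mv n M m i)) (mv n M z i)))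
      by (try reflexivity; intros; unfold q; rewrite mv_vec_sub, mv_vec_mul; reflexivity).
    unfold q; rewrite ip_sub_l, ip_mul_l, !ip_sub_r, !ip_mul_r, Cconj_RtoC, !quad_ip, RtoC_mul; ring. }
  assert (sym : re (ip n z (mv n (ImM A) m)) = N).
  { rewrite (hermitian_ip n (ImM A) z m (hermitian_ImM n A)), re_ip_sym; exact mk. }
  pose proof (f_equal re (lin (ImM A))) as l1; pose proof (f_equal re (lin' (ImM A))) as l2.
  pose proof (f_equal re (lin A)) as l3; pose proof (f_equal re (lin' A)) as l4.
  rewrite quad_ImM in l1, l2; simpl in l1, l2, l3, l4.
  fold kz in l1, l2; rewrite mk, sym in l1, l2.
  pose proof (hsec p) as hp; pose proof (hsec q) as hq; fold (h p) in *; fold (h q) in *.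
  fold (h m) in *; fold (h z) in *; fold (h p) in *; fold (h q) in *; fold tau in hp, hq.
  pose proof (Rle_abs (im (quad n A p))) as ap; pose proof (Rle_abs (- im (quad n A q))) as aq.
  rewrite Rabs_Ropp in aq.
  assert (sumh : h p + h q = 2 * (s * s * N + h z)) by (rewrite <- hm; lra).
  assert (B : tau * h p + tau * h q = 2 * tau * (s * s * N + h z)).
  { transitivity (tau * (h p + h q)); [ring|rewrite sumh; ring]. }
  lra. }
destruct (Rle_lt_or_eq_dec 0 tau tn) as [tp|te].
- specialize (key (/ tau) (Rinv_0_lt_compat _ tp)).
  apply Rmult_le_compat_l with (r := tau) in key; [|lra].
  replace (tau * (4 * / tau * N)) with (4 * N) in key by (field; lra).
  replace (tau * (2 * tau * (/ tau * / tau * N + h z))) with (2 * N + 2 * (tau * tau * h z)) in key by (field; lra).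
  lra.
- rewrite <- te in *; specialize (key 1 ltac:(lra)); lra.
Qed.

Lemma wnorm_mv z : wnorm (mv n A z) <= (1 + tan alpha * tan alpha) * h z.
Proof.
pose proof (wnorm_ImM z) as H.
set (kz := mv n (ImM A) z) in *.
assert (E : forall l, (l < n)%nat -> ip n (col U l) (mv n A z) =
   Cadd (Cmul (RtoC (d l)) (ip n (col U l) z)) (Cmul (mkCx 0 1) (ip n (col U l) kz))).
{ intros l hl; rewrite <- (coord_spectral n U hU _ d hH z l hl), <- ip_mul_r, <- ip_add_r.
  apply ip_ext; [reflexivity|intros a ha].
  unfold kz; rewrite <- mv_scale, <- mv_add; apply mv_ext; try reflexivity; [|assumption].
  intros i j _ _; apply ReM_ImM. }
assert (W : wnorm (mv n A z) = h z + wnorm kz +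
   rsum n (fun l => 2 * re (Cmul (mkCx 0 1) (Cmul (Cconj (ip n (col U l) z)) (ip n (col U l) kz))))).
{ rewrite re_quad_spectral; unfold wnorm; rewrite <- !rsum_add; apply rsum_ext; intros l hl.
  rewrite E by assumption; specialize (hd l hl); unfold Cnorm2; simpl; field; lra. }
assert (Z : rsum n (fun l => 2 * re (Cmul (mkCx 0 1) (Cmul (Cconj (ip n (col U l) z)) (ip n (col U l) kz)))) = 0).
{ rewrite rsum_scal, <- re_csum, csum_mul_l, (parseval n U hU).
  change (ip n z kz) with (quad n (ImM A) z); rewrite quad_ImM; simpl; ring. }
rewrite W, Z; lra.
Qed.

Lemma sector_kern_bound z t : 0 < t ->
  let y := mv n A z in let x := fun i => Cadd (y i) (Cmul (RtoC t) (z i)) in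
  cos alpha ^ 2 * re (ip n x y) <= rsum n (fun l => d l / (d l + t) * Cnorm2 (ip n (col U l) x)).
Proof.
intros tp y x; set (k := cos alpha ^ 2).
assert (k01 : 0 <= k <= 1).
{ pose proof (COS_bound alpha); unfold k; simpl; nra. }
assert (kt : k * (1 + tan alpha * tan alpha) = 1) by apply cos_sqr_tan.
assert (hn : 0 <= h z).
{ rewrite re_quad_spectral; apply rsum_nonneg; intros l hl; specialize (hd l hl).
  apply Rmult_le_pos; [lra|apply Cnorm2_nonneg]. }
assert (xy : re (ip n x y) = re (ip n y y) + t * h z).
{ unfold x; rewrite ip_add_l, ip_mul_l, Cconj_RtoC; simpl; unfold h; rewrite quad_ip; fold y; ring. }
assert (L : 2 * k * re (ip n x y) - k * k * (re (ip n y y) + t * wnorm y) <=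
   rsum n (fun l => d l / (d l + t) * Cnorm2 (ip n (col U l) x))).
{ rewrite <- (parseval n U hU x y), <- (parseval_norm n U hU y), re_csum.
  unfold wnorm; rewrite <- (rsum_scal n t), <- rsum_add, <- rsum_scal, <- rsum_scal.
  unfold Rminus; rewrite <- (Rmult_1_l (- rsum _ _)), <- Ropp_mult_distr_r, Ropp_mult_distr_l, <- rsum_scal, <- rsum_add.
  apply rsum_le; intros l hl.
  pose proof (weighted_young (d l) t k (ip n (col U l) x) (ip n (col U l) y) (hd l hl) tp); lra. }
pose proof (wnorm_mv z) as w; fold y in w.
assert (W : k * k * (t * wnorm y) <= k * (t * h z)).
{ replace (k * (t * h z)) with (k * k * (t * ((1 + tan alpha * tan alpha) * h z))).
  - apply Rmult_le_compat_l; [nra|apply Rmult_le_compat_l; lra].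
  - transitivity (k * (t * h z) * (k * (1 + tan alpha * tan alpha))); [ring|rewrite kt; ring]. }
pose proof (ip_self_nonneg n y) as yn.
assert (kk : k * k * re (ip n y y) <= k * re (ip n y y)) by (apply Rmult_le_compat_r; [assumption|nra]).
rewrite xy in *; lra.
Qed.
End Sector.

Section PositiveMap.
Variables (n r : nat) (Phi : Mat -> Mat).
Hypothesis hPhi : unital_positive_linear n r Phi.

Lemma Phi_ext A B : meq n A B -> meq r (Phi A) (Phi B).
Proof. apply hPhi. Qed.

Lemma Phi_psd A : psd n A -> psd r (Phi A).
Proof. apply hPhi. Qed.

Lemma Phi_add A B : meq r (Phi (madd A B)) (madd (Phi A) (Phi B)).
Proof.
destruct hPhi as (ext & lin & _); intros i j hi hj.
rewrite (ext (madd A B) (madd (mscale C1 A) B)), lin; auto; unfold madd, mscale.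
- ring.
- intros a b _ _; ring.
Qed.

Lemma Phi_zero : meq r (Phi (fun _ _ => C0)) (fun _ _ => C0).
Proof.
intros i j hi hj; set (Z := fun _ _ : nat => C0).
assert (e : Phi Z i j = Cadd (Phi Z i j) (Phi Z i j)).
{ transitivity (Phi (madd Z Z) i j); [|apply Phi_add; assumption].
  apply Phi_ext; auto; intros a b _ _; unfold madd, Z; ring. }
transitivity (Csub (Cadd (Phi Z i j) (Phi Z i j)) (Phi Z i j)); [ring|rewrite <- e; ring].
Qed.

Lemma Phi_scale c A : meq r (Phi (mscale c A)) (mscale c (Phi A)).
Proof.
destruct hPhi as (ext & lin & _); intros i j hi hj.
rewrite (ext (mscale c A) (madd (mscale c A) (fun _ _ => C0))), lin; auto; unfold madd, mscale.
- rewrite Phi_zero by assumption; ring.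
- intros a b _ _; ring.
Qed.

Lemma Phi_sub A B : meq r (Phi (msub A B)) (msub (Phi A) (Phi B)).
Proof.
intros i j hi hj.
rewrite (Phi_ext (msub A B) (madd A (mscale (Copp C1) B))); auto.
- rewrite Phi_add by assumption; unfold madd; rewrite Phi_scale by assumption; unfold mscale, msub; ring.
- intros a b _ _; unfold msub, madd, mscale; ring.
Qed.

Lemma Phi_msum k c M : meq r (Phi (msum k (fun l => mscale (c l) (M l))))
  (msum k (fun l => mscale (c l) (Phi (M l)))).
Proof.
induction k as [|k IH]; intros i j hi hj; [apply Phi_zero; assumption|].
rewrite (Phi_ext _ (madd (msum k (fun l => mscale (c l) (M l))) (mscale (c k) (M k))))
  by (auto; intros a b _ _; reflexivity).
rewrite Phi_add by assumption; unfold madd; rewrite IH, Phi_scale by assumption; reflexivity.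
Qed.

Lemma quad_Phi_spectral U d K u : meq n K (msum n (fun l => mscale (RtoC (d l)) (proj U l))) ->
  quad r (Phi K) u = csum n (fun l => Cmul (RtoC (d l)) (quad r (Phi (proj U l)) u)).
Proof.
intros hK; rewrite (quad_ext r _ _ u (Phi_ext _ _ hK)), (quad_ext r _ _ u (Phi_msum n (fun l => RtoC (d l)) (proj U))).
apply quad_msum.
Qed.

Lemma hermitian_Phi K : hermitian n K -> hermitian r (Phi K).
Proof.
intros hK; destruct (@Loewner.hermitian_spectral n K hK) as (U & d & hU & hKU).
apply (hermitian_ext r (msum n (fun l => mscale (RtoC (d l)) (Phi (proj U l))))).
- intros i j hi hj; rewrite <- Phi_msum by assumption; symmetry; apply Phi_ext; auto.
  intros a b ha hb; rewrite hKU by assumption; apply udu_msum; assumption.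
- apply hermitian_msum; intros l hl; apply (Phi_psd _ (psd_proj n U l)).
Qed.

Lemma re_quad_Phi_ReM M u : re (quad r (Phi (ReM M)) u) = re (quad r (Phi M) u).
Proof.
assert (e : quad r (Phi M) u = Cadd (quad r (Phi (ReM M)) u) (Cmul (mkCx 0 1) (quad r (Phi (ImM M)) u))).
{ rewrite <- quad_scale, <- quad_add; apply quad_ext; intros i j hi hj.
  rewrite (Phi_ext M (madd (ReM M) (mscale (mkCx 0 1) (ImM M)))); auto.
  - rewrite Phi_add by assumption; unfold madd; rewrite Phi_scale by assumption; reflexivity.
  - intros a b _ _; apply ReM_ImM. }
rewrite e; simpl.
rewrite (hermitian_quad_real r (Phi (ImM M)) u (hermitian_Phi _ (hermitian_ImM n M))); ring.
Qed.

Lemma re_quad_Phi_spectral U d M u :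
  meq n (ReM M) (mmul n (mmul n U (rdiag d)) (madj U)) ->
  re (quad r (Phi M) u) = rsum n (fun l => d l * re (quad r (Phi (proj U l)) u)).
Proof.
intros hM; rewrite <- re_quad_Phi_ReM, (quad_Phi_spectral U d), re_csum.
- apply rsum_ext; intros; apply re_RtoC_mul.
- intros i j hi hj; rewrite hM by assumption; apply udu_msum; assumption.
Qed.

Variables (A : Mat) (alpha : R).
Hypothesis hacc : accretive n A.
Hypothesis halpha : 0 <= alpha < PI / 2.
Hypothesis hsec : forall x, Rabs (im (quad n A x)) <= tan alpha * re (quad n A x).

Lemma re_quad_Phi_nonneg u : 0 <= re (quad r (Phi A) u).
Proof.
rewrite <- re_quad_Phi_ReM; apply Phi_psd; split; [apply hermitian_ReM|intros x].
destruct (classic (nonzero_vec n x)) as [nz|z]; [apply Rlt_le, hacc, nz|].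
rewrite (quad_vec_ext n _ x (fun _ => C0)).
- unfold quad; rewrite (csum_ext n _ (fun _ => C0)); [rewrite csum_0; simpl; lra|intros; cx].
- intros i hi; apply NNPP; intros ne; apply z; exists i; auto.
Qed.

Theorem kern_positive_map t B G u : 0 < t ->
  meq n (mmul n (madd A (mscale (RtoC t) mid)) B) mid ->
  meq r (mmul r (madd (Phi A) (mscale (RtoC t) mid)) G) mid ->
  cos alpha ^ 2 * re (quad r (Phi (msub mid (mscale (RtoC t) B))) u) <=
  re (quad r (msub mid (mscale (RtoC t) G)) u).
Proof.
intros tp hB hG.
destruct (@Loewner.hermitian_spectral n (ReM A) (hermitian_ReM n A)) as (U & d & hU & hH).
assert (hd := spectral_pos n U hU (ReM A) d hH hacc).
set (k := cos alpha ^ 2).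
set (S := msum n (fun l => mscale (RtoC (d l / (d l + t))) (proj U l))).
set (Z := msub mid (mscale (RtoC t) B)).
assert (hS : psd n (msub S (mscale (RtoC k) (ReM Z)))).
{ split.
  - apply hermitian_sub; [apply hermitian_msum; intros; apply hermitian_proj|apply hermitian_scale, hermitian_ReM].
  - intros x; rewrite quad_sub, quad_scale; unfold S; rewrite quad_msum, re_sub, re_RtoC_mul, re_quad_ReM, re_csum.
    set (z := mv n B x).
    assert (hx : forall i, (i < n)%nat -> x i = Cadd (mv n A z i) (Cmul (RtoC t) (z i))).
    { intros i hi; rewrite <- (mv_id n x i hi).
      rewrite <- (mv_ext n _ _ x x hB (fun _ _ => eq_refl) i hi), mv_mul, mv_add, mv_scale.
      fold z; rewrite mv_id by assumption; reflexivity. }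
    pose proof (sector_kern_bound n A U d alpha hU hH hd halpha hsec z t tp) as h; cbv zeta in h.
    assert (e1 : quad n Z x = ip n (fun i => Cadd (mv n A z i) (Cmul (RtoC t) (z i))) (mv n A z)).
    { rewrite quad_ip; apply ip_ext; [exact hx|intros i hi].
      unfold Z; rewrite mv_sub, mv_scale, mv_id, hx by assumption; fold z; ring. }
    rewrite e1.
    assert (e2 : rsum n (fun i => re (Cmul (RtoC (d i / (d i + t))) (quad n (proj U i) x))) =
       rsum n (fun l => d l / (d l + t) * Cnorm2 (ip n (col U l) (fun i => Cadd (mv n A z i) (Cmul (RtoC t) (z i)))))).
    { apply rsum_ext; intros l hl; rewrite quad_proj, re_RtoC_mul; simpl.
      f_equal; f_equal; apply ip_ext; [reflexivity|exact hx]. }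
    rewrite e2; unfold k; lra. }
pose proof (proj2 (Phi_psd _ hS) u) as P1.
rewrite (quad_ext r _ _ u (Phi_sub _ _)), quad_sub, (quad_ext r _ _ u (Phi_scale _ _)), quad_scale in P1.
rewrite re_sub, re_RtoC_mul, re_quad_Phi_ReM in P1.
unfold S in P1; rewrite (quad_Phi_spectral U (fun l => d l / (d l + t)) _ u (fun _ _ _ _ => eq_refl)), re_csum in P1.
set (q := fun l v => re (quad r (Phi (proj U l)) v)).
assert (P2 : k * re (quad r (Phi Z) u) <= rsum n (fun l => d l / (d l + t) * q l u)).
{ rewrite (rsum_ext n _ (fun l => d l / (d l + t) * q l u)) in P1; [lra|intros; apply re_RtoC_mul]. }
set (w := mv r G u).
assert (hu : forall i, (i < r)%nat -> u i = Cadd (mv r (Phi A) w i) (Cmul (RtoC t) (w i))).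
{ intros i hi; rewrite <- (mv_id r u i hi).
  rewrite <- (mv_ext r _ _ u u hG (fun _ _ => eq_refl) i hi), mv_mul, mv_add, mv_scale.
  fold w; rewrite mv_id by assumption; reflexivity. }
assert (idn : meq n mid (msum n (fun l => mscale (RtoC 1) (proj U l)))).
{ intros i j hi hj; rewrite <- (@Loewner.unitary_mulr n U hU i j hi hj); unfold mmul, msum; apply csum_ext; intros l hl.
  unfold mscale, proj, madj, RtoC; cx. }
assert (unit_quad : forall v, re (ip r v v) = rsum n (fun l => q l v)).
{ intros v; rewrite <- quad_id, <- (quad_ext r _ _ v (proj2 (proj2 (proj2 hPhi)))).
  rewrite (quad_Phi_spectral U (fun _ => 1) mid v idn), re_csum; apply rsum_ext; intros l hl.
  rewrite re_RtoC_mul; unfold q; ring. }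
assert (Sw : re (ip r w u) = rsum n (fun l => (d l + t) * q l w)).
{ rewrite (ip_ext r w w u _ (fun _ _ => eq_refl) hu), ip_add_r, ip_mul_r, re_add, re_RtoC_mul.
  rewrite <- quad_ip, (re_quad_Phi_spectral U d A w hH), unit_quad, <- rsum_scal, <- rsum_add.
  apply rsum_ext; intros; unfold q; ring. }
assert (cs : 2 * re (ip r w u) <= rsum n (fun l => (d l + t) * q l w + q l u / (d l + t))).
{ assert (e : re (ip r w u) = rsum n (fun l => re (ip r w (mv r (Phi (proj U l)) u)))).
  { rewrite (ip_ext r w w u (fun a => csum n (fun l => mv r (Phi (proj U l)) u a)) (fun _ _ => eq_refl)).
    - rewrite ip_csum_r, re_csum; reflexivity.
    - intros a ha; rewrite <- (mv_id r u a ha).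
      rewrite <- (mv_ext r _ _ u u (proj2 (proj2 (proj2 hPhi))) (fun _ _ => eq_refl) a ha).
      rewrite (mv_ext r _ _ u u (Phi_ext _ _ idn) (fun _ _ => eq_refl) a ha).
      rewrite (mv_ext r _ _ u u (Phi_msum n (fun _ => RtoC 1) (proj U)) (fun _ _ => eq_refl) a ha).
      unfold mv, msum, mscale.
      rewrite (csum_ext r _ (fun j => csum n (fun l => Cmul (Phi (proj U l) a j) (u j)))).
      + apply csum_swap.
      + intros j hj; rewrite <- csum_mul_r; apply csum_ext; intros; unfold RtoC; cx. }
  rewrite e, <- rsum_scal; apply rsum_le; intros l hl.
  specialize (hd l hl); set (c := d l + t); assert (cp : 0 < c) by (unfold c; lra).
  destruct (Phi_psd _ (psd_proj n U l)) as [hl1 hl2].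
  specialize (hl2 (fun i => Csub (Cmul (RtoC c) (w i)) (u i))).
  rewrite quad_ip in hl2.
  rewrite (ip_ext r _ _ _ (fun i => Csub (Cmul (RtoC c) (mv r (Phi (proj U l)) w i)) (mv r (Phi (proj U l)) u i))
     (fun _ _ => eq_refl)) in hl2 by (intros; rewrite mv_vec_sub, mv_vec_mul; reflexivity).
  rewrite ip_sub_l, ip_mul_l, !ip_sub_r, !ip_mul_r, Cconj_RtoC in hl2.
  assert (sy : re (ip r u (mv r (Phi (proj U l)) w)) = re (ip r w (mv r (Phi (proj U l)) u))).
  { rewrite (hermitian_ip r _ u w hl1), re_ip_sym; reflexivity. }
  unfold q; rewrite !quad_ip.
  repeat (rewrite ?re_sub, ?re_RtoC_mul in hl2); rewrite sy in hl2.
  set (a1 := re (ip r w (mv r (Phi (proj U l)) w))) in *.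
  set (a2 := re (ip r w (mv r (Phi (proj U l)) u))) in *.
  set (a3 := re (ip r u (mv r (Phi (proj U l)) u))) in *.
  apply Rmult_le_reg_l with c; [assumption|].
  replace (c * (c * a1 + a3 / c)) with (c * c * a1 + a3) by (field; lra); lra. }
rewrite rsum_add, <- Sw in cs.
rewrite quad_sub, quad_scale, quad_id, re_sub, re_RtoC_mul, unit_quad, (quad_ip r G u); fold w.
rewrite (re_ip_sym r u w).
eapply Rle_trans; [exact P2|].
apply Rle_trans with (rsum n (fun l => q l u) + (- t) * rsum n (fun l => q l u / (d l + t))).
- rewrite <- rsum_scal, <- rsum_add; right; apply rsum_ext; intros l hl; specialize (hd l hl); field; lra.
- assert (t * re (ip r w u) <= t * rsum n (fun l => q l u / (d l + t))) by (apply Rmult_le_compat_l; lra); lra.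
Qed.
End PositiveMap.

End PositiveMaps.

Import ComplexNumbers IdentityTheorem ContourIntegrals Vectors PositiveMaps.
Open Scope R_scope.

Lemma linear_functional_msum (L : Mat -> Cx) n :
  (forall A B, meq n A B -> L A = L B) ->
  (forall c A B, L (madd (mscale c A) B) = Cadd (Cmul c (L A)) (L B)) ->
  forall k c M, L (msum k (fun l => mscale (c l) (M l))) = csum k (fun l => Cmul (c l) (L (M l))).
Proof.
intros ext lin.
assert (L0 : L (fun _ _ => C0) = C0).
{ set (Z := fun _ _ : nat => C0).
  assert (e : L Z = Cadd (Cmul C1 (L Z)) (L Z)).
  { rewrite <- lin; apply ext; intros i j _ _; unfold madd, mscale, Z; ring. }
  transitivity (Csub (Cadd (Cmul C1 (L Z)) (L Z)) (L Z)); [ring|rewrite <- e; ring]. }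
induction k as [|k IH]; intros c M; [exact L0|].
simpl; rewrite <- IH.
rewrite (ext _ (madd (mscale (c k) (M k)) (msum k (fun l => mscale (c l) (M l)))));
  [rewrite lin; ring|intros i j _ _; unfold msum, madd; simpl; ring].
Qed.

Definition unit_mat (a b : nat) : Mat := fun i j => Cmul (mid a i) (mid b j).

Lemma linear_functional_bound (L : Mat -> Cx) n :
  (forall A B, meq n A B -> L A = L B) ->
  (forall c A B, L (madd (mscale c A) B) = Cadd (Cmul c (L A)) (L B)) ->
  exists K, 0 <= K /\ forall M delta, (forall i j, (i < n)%nat -> (j < n)%nat -> Cmod (M i j) <= delta) ->
    Cmod (L M) <= K * delta.
Proof.
intros ext lin.
set (K := rsum n (fun a => rsum n (fun b => Cmod (L (unit_mat a b))))).
exists K; split.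
{ apply rsum_nonneg; intros; apply rsum_nonneg; intros; apply Cmod_nonneg. }
intros M delta HM.
assert (E : L M = csum n (fun a => csum n (fun b => Cmul (M a b) (L (unit_mat a b))))).
{ rewrite (ext M (msum n (fun a => mscale C1 (msum n (fun b => mscale (M a b) (unit_mat a b)))))).
  - rewrite (linear_functional_msum L n ext lin n (fun _ => C1)); apply csum_ext; intros a ha.
    rewrite (linear_functional_msum L n ext lin n (fun b => M a b)); ring.
  - intros i j hi hj; unfold msum, mscale, unit_mat.
    rewrite (csum_ext n _ (fun a => Cmul (mid i a) (M a j))).
    + symmetry; exact (csum_delta n (fun a => M a j) i hi).
    + intros a ha.
      rewrite (csum_ext n _ (fun b => Cmul (mid j b) (Cmul (mid i a) (M a b)))).
      * rewrite (csum_delta n (fun b => Cmul (mid i a) (M a b)) j hj); ring.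
      * intros b hb; unfold mid; rewrite (Nat.eqb_sym a i), (Nat.eqb_sym b j); ring. }
rewrite E, Rmult_comm; unfold K; rewrite <- rsum_scal.
eapply Rle_trans; [apply csum_mod|rewrite re_csum; apply rsum_le; intros a ha].
rewrite <- rsum_scal; simpl.
eapply Rle_trans; [apply csum_mod|rewrite re_csum; apply rsum_le; intros b hb]; simpl.
rewrite Cmod_mul; apply Rmult_le_compat_r; [apply Cmod_nonneg|apply HM; assumption].
Qed.

Lemma finite_bound n (P : nat -> R -> Prop) : (forall i a b, a <= b -> P i a -> P i b) ->
  (forall i, (i < n)%nat -> exists a, 0 < a /\ P i a) ->
  exists a, 0 < a /\ forall i, (i < n)%nat -> P i a.
Proof.
intros mono; induction n as [|n IH]; intros H; [exists 1; split; [lra|intros; lia]|].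
destruct IH as [a [ap Ha]]; [intros; apply H; lia|].
destruct (H n ltac:(lia)) as [b [bp Hb]].
exists (a + b); split; [lra|intros i hi].
destruct (Nat.eq_dec i n) as [->|ne]; [apply (mono n b); [lra|assumption]|].
apply (mono i a); [lra|apply Ha; lia].
Qed.

Lemma add_scalar_inverse n X t : 0 < t -> (forall x, nonzero_vec n x -> 0 <= re (quad n X x)) ->
  exists B, meq n (mmul n B (madd X (mscale (RtoC t) mid))) mid /\
            meq n (mmul n (madd X (mscale (RtoC t) mid)) B) mid.
Proof.
intros tp H; apply Loewner.injective_inverse; intros x nz; apply NNPP; intros hn.
assert (z : forall i, (i < n)%nat -> mv n (madd X (mscale (RtoC t) mid)) x i = C0).
{ intros i hi; apply NNPP; intros ne; apply hn; exists i; split; assumption. }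
assert (q : quad n (madd X (mscale (RtoC t) mid)) x = C0).
{ rewrite quad_ip, (ip_ext n x x _ (fun _ => C0) (fun _ _ => eq_refl) z).
  unfold ip; rewrite (csum_ext n _ (fun _ => C0)) by (intros; ring); apply csum_0. }
rewrite quad_add, quad_scale, quad_id in q; apply (f_equal re) in q.
rewrite re_add, re_RtoC_mul in q; simpl in q.
specialize (H x nz); pose proof (ip_self_pos n x nz).
assert (0 < t * re (ip n x x)) by (apply Rmult_lt_0_compat; assumption); lra.
Qed.

Lemma sector_all n A alpha : (forall z, numrange n A z -> sector alpha z) ->
  forall x, Rabs (im (quad n A x)) <= tan alpha * re (quad n A x).
Proof.
intros H x; destruct (classic (nonzero_vec n x)) as [nz|z].
- set (N := re (ip n x x)); assert (Np : 0 < N) by (apply ip_self_pos, nz).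
  set (s := / sqrt N); assert (sp : 0 < sqrt N) by (apply sqrt_lt_R0, Np).
  assert (ss : s * s * N = 1).
  { unfold s; rewrite <- (sqrt_sqrt N) at 3 by lra; field; lra. }
  set (y := fun i => Cmul (RtoC s) (x i)).
  assert (qy : quad n A y = Cmul (RtoC (s * s)) (quad n A x)).
  { rewrite quad_ip, (ip_ext n y y _ (fun i => Cmul (RtoC s) (mv n A x i)) (fun _ _ => eq_refl))
      by (intros; apply mv_vec_mul).
    unfold y; rewrite ip_mul_l, ip_mul_r, Cconj_RtoC, RtoC_mul, <- quad_ip; ring. }
  assert (vn : vnorm2 n y = 1).
  { unfold vnorm2; rewrite re_csum; rewrite <- ss; unfold N; rewrite ip_self; simpl.
    rewrite <- rsum_scal; apply rsum_ext; intros i hi; unfold y; simpl; rewrite Cnorm2_mul.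
    unfold Cnorm2 at 1; simpl; ring. }
  destruct (H (quad n A y)) as [_ h]; [exists y; auto|].
  rewrite qy in h; simpl in h.
  assert (s2 : 0 < s * s) by (assert (0 < s) by (apply Rinv_0_lt_compat, sp); nra).
  replace (s * s * im (quad n A x) + 0 * re (quad n A x)) with (s * s * im (quad n A x)) in h by ring.
  replace (s * s * re (quad n A x) - 0 * im (quad n A x)) with (s * s * re (quad n A x)) in h by ring.
  rewrite Rabs_mult, (Rabs_right (s * s)) in h by lra.
  apply Rmult_le_reg_l with (s * s); [assumption|lra].
- rewrite (quad_vec_ext n A x (fun _ => C0)).
  + unfold quad; rewrite (csum_ext n _ (fun _ => C0)) by (intros; cx); rewrite csum_0; simpl; rewrite Rabs_R0; lra.
  + intros i hi; apply NNPP; intros ne; apply z; exists i; auto.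
Qed.

Lemma contour_strip gamma gamma' : (forall t, curve_diff gamma t (gamma' t)) -> (forall t, in_D (gamma t)) ->
  exists X c, 0 <= c < PI /\ forall t, 0 <= t <= 1 ->
    Rabs (re (clog (gamma t))) <= X /\ Rabs (im (clog (gamma t))) <= c.
Proof.
intros gd gD.
assert (C : curve_C0 (fun t => clog (gamma t))).
{ eapply curve_diff_C0; intros t; exact (curve_diff_log _ _ _ (gd t) (gD t)). }
destruct (curve_C0_bounded _ C) as [X [_ HX]].
destruct (continuity_ab_maj (fun t => im (clog (gamma t))) 0 1 ltac:(lra) (fun t _ => proj2 (C t))) as [a [ha _]].
destruct (continuity_ab_min (fun t => im (clog (gamma t))) 0 1 ltac:(lra) (fun t _ => proj2 (C t))) as [b [hb _]].
assert (P : forall t, Rabs (im (clog (gamma t))) < PI).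
{ intros t; apply Rabs_def1; simpl; apply carg_bound. }
exists X, (Rmax (Rabs (im (clog (gamma a)))) (Rabs (im (clog (gamma b))))); split.
- split; [eapply Rle_trans; [apply Rabs_pos|apply Rmax_l]|apply Rmax_lub_lt; apply P].
- intros t ht; split; [eapply Rle_trans; [apply Rabs_re_le|apply HX, ht]|].
  specialize (ha t ht); specialize (hb t ht); cbv beta in ha, hb.
  apply Rabs_le; split.
  + assert (h := Rmax_r (Rabs (im (clog (gamma a)))) (Rabs (im (clog (gamma b))))).
    pose proof (Rle_abs (- im (clog (gamma b)))); rewrite Rabs_Ropp in *; lra.
  + assert (h := Rmax_l (Rabs (im (clog (gamma a)))) (Rabs (im (clog (gamma b))))).
    pose proof (Rle_abs (im (clog (gamma a)))); lra.
Qed.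

Lemma hol_fcalc_data F n X Y : hol_fcalc F n X Y ->
  exists (gamma gamma' : R -> Cx) (Rs : R -> Mat) (S c C : R),
   0 <= c < PI /\ 0 < C /\
   (forall t, 0 <= t <= 1 -> exists w, gamma t = cexp w /\ Rabs (re w) <= S /\ Rabs (im w) <= c) /\
   (forall i j t, (i < n)%nat -> (j < n)%nat -> 0 <= t <= 1 -> Cmod (Cmul (Rs t i j) (gamma' t)) <= C) /\
   (forall i j, (i < n)%nat -> (j < n)%nat ->
     RI01 (fun t => Cmul (Cmul (F (gamma t)) (Rs t i j)) (gamma' t)) (Cmul two_pi_i (Y i j))) /\
   (forall s B i j, 0 < s -> meq n (mmul n B (madd X (mscale (RtoC s) mid))) mid ->
     (i < n)%nat -> (j < n)%nat ->
     RI01 (fun t => Cmul (Cmul (kern s (gamma t)) (Rs t i j)) (gamma' t))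
       (Cmul two_pi_i (Cmul (RtoC (1 + s)) (Csub (mid i j) (Cmul (RtoC s) (B i j)))))).
Proof.
intros (gamma & gamma' & Rs & (hper & hd1 & hd2 & hc1 & hc2 & _ & gD & heig) & hR & hI).
assert (gd : forall t, curve_diff gamma t (gamma' t)) by (intros t; split; [apply hd1|apply hd2]).
assert (gC : curve_C0 gamma') by (intros t; split; [apply hc1|apply hc2]).
assert (gp : gamma 1 = gamma 0) by (rewrite <- (hper 0); f_equal; ring).
destruct (@Loewner.annihilating_eigenvalues n X) as (ls & hls & hann).
assert (Hls : forall l, In l ls -> encircled gamma gamma' l) by (intros l hl; apply heig, hls, hl).
destruct (contour_strip gamma gamma' gd gD) as (S & c & hc & HS).
destruct (finite_bound n (fun i M => forall j, (j < n)%nat -> forall t, 0 <= t <= 1 -> Cmod (Cmul (Rs t i j) (gamma' t)) <= M))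
  as [C [Cp HC]].
{ intros i a b ab H j hj t ht; specialize (H j hj t ht); lra. }
{ intros i hi.
  destruct (finite_bound n (fun j M => forall t, 0 <= t <= 1 -> Cmod (Cmul (Rs t i j) (gamma' t)) <= M)) as [C [Cp HC]].
  - intros j a b ab H t ht; specialize (H t ht); lra.
  - intros j hj; exact (resolvent_bounded gamma gamma' gd gC n X Rs hR ls Hls hann i j hi hj).
  - exists C; split; assumption. }
exists gamma, gamma', Rs, S, c, C; repeat split; try tauto; try apply hc.
- intros t ht; exists (clog (gamma t)); split; [symmetry; apply cexp_clog, gD|apply HS, ht].
- intros i j t hi hj ht; apply HC; assumption.
- intros s B i j sp hB hi hj.
  exact (RI01_kern_resolvent gamma gamma' gp gd gC gD n X Rs hR ls Hls hann s B i j sp hB hi hj).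
Qed.

Theorem mainTheorem15 (f : R -> R) (F : Cx -> Cx) (n r : nat)
  (Phi : Mat -> Mat) (A : Mat) (alpha : R) :
  matrix_monotone_class f ->
  analytic_extension f F ->
  unital_positive_linear n r Phi ->
  accretive n A ->
  0 <= alpha < PI / 2 ->
  (forall z, numrange n A z -> sector alpha z) ->
  forall fPhiA fA : Mat,
    hol_fcalc F r (Phi A) fPhiA ->
    hol_fcalc F n A fA ->
    loewner_le r (mscale (RtoC (cos alpha ^ 2)) (ReM (Phi fA))) (ReM fPhiA).
Proof.
intros hf hF hPhi hacc halpha hsec fPhiA fA hP hA.
pose proof (sector_all n A alpha hsec) as hs.
set (k := cos alpha ^ 2).
assert (k01 : 0 <= k <= 1) by (pose proof (COS_bound alpha); unfold k; simpl; nra).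
split.
{ apply hermitian_sub; [apply hermitian_ReM|apply hermitian_scale, hermitian_ReM]. }
intros u; rewrite quad_sub, quad_scale, re_sub, re_RtoC_mul, !re_quad_ReM.
destruct (hol_fcalc_data F n A fA hA) as (g1 & g1' & R1 & S1 & c1 & C1' & hc1 & Cp1 & hg1 & hb1 & hI1 & hK1).
destruct (hol_fcalc_data F r (Phi A) fPhiA hP) as (g2 & g2' & R2 & S2 & c2 & C2' & hc2 & Cp2 & hg2 & hb2 & hI2 & hK2).
set (S := Rmax S1 S2); set (c := Rmax c1 c2).
assert (hc : 0 <= c < PI).
{ unfold c; split; [eapply Rle_trans; [apply hc1|apply Rmax_l]|apply Rmax_lub_lt; [apply hc1|apply hc2]]. }
pose proof (strip_approx F (proj1 hF) (Loewner.monotone_real_approx hf hF) S c) as happ.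
assert (inv1 : forall t, 0 < t -> exists B, meq n (mmul n B (madd A (mscale (RtoC t) mid))) mid /\
            meq n (mmul n (madd A (mscale (RtoC t) mid)) B) mid).
{ intros t tp; apply add_scalar_inverse; [assumption|intros x nz].
  rewrite <- re_quad_ReM; apply Rlt_le, hacc, nz. }
assert (inv2 : forall t, 0 < t -> exists B, meq r (mmul r B (madd (Phi A) (mscale (RtoC t) mid))) mid /\
            meq r (mmul r (madd (Phi A) (mscale (RtoC t) mid)) B) mid).
{ intros t tp; apply add_scalar_inverse; [assumption|intros x nz].
  apply (re_quad_Phi_nonneg n r Phi hPhi A hacc). }
assert (comb : forall l, weights_ok l -> exists Y1 Y2,
   (forall i j, (i < n)%nat -> (j < n)%nat ->
     RI01 (fun t => Cmul (Cmul (combC l (g1 t)) (R1 t i j)) (g1' t)) (Cmul two_pi_i (Y1 i j))) /\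
   (forall i j, (i < r)%nat -> (j < r)%nat ->
     RI01 (fun t => Cmul (Cmul (combC l (g2 t)) (R2 t i j)) (g2' t)) (Cmul two_pi_i (Y2 i j))) /\
   k * re (quad r (Phi Y1) u) <= re (quad r Y2 u)).
{ induction 1 as [|[w t] l [hw ht] _ IH].
  - exists (fun _ _ => C0), (fun _ _ => C0); repeat split.
    + intros i j _ _; apply (RI01_eq _ C0); [ring|eapply RI01_ext; [|exact RI01_zero]; intros; simpl; ring].
    + intros i j _ _; apply (RI01_eq _ C0); [ring|eapply RI01_ext; [|exact RI01_zero]; intros; simpl; ring].
    + rewrite (quad_ext r _ _ u (Phi_zero n r Phi hPhi)).
      assert (q0 : quad r (fun _ _ => C0) u = C0).
      { unfold quad; rewrite (csum_ext r _ (fun _ => C0)); [apply csum_0|intros i _].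
        rewrite (csum_ext r _ (fun _ => C0)) by (intros; ring); rewrite csum_0; ring. }
      rewrite q0; simpl; lra.
  - destruct IH as (Y1 & Y2 & H1 & H2 & H3); simpl in hw, ht.
    destruct (inv1 t ht) as (B & hB1 & hB2), (inv2 t ht) as (G & hG1 & hG2).
    pose proof (kern_positive_map n r Phi hPhi A alpha hacc halpha hs t B G u ht hB2 hG2) as HK.
    set (m := w * (1 + t)).
    exists (madd (mscale (RtoC m) (msub mid (mscale (RtoC t) B))) Y1),
           (madd (mscale (RtoC m) (msub mid (mscale (RtoC t) G))) Y2); repeat split.
    + intros i j hi hj.
      pose proof (RI01_add _ _ _ _ (RI01_mul_l (RtoC w) _ _ (hK1 t B i j ht hB1 hi hj)) (H1 i j hi hj)) as h.
      eapply RI01_eq; [|eapply RI01_ext; [|exact h]].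
      * unfold madd, mscale, msub, m; rewrite RtoC_mul; ring.
      * intros s; cbv beta; simpl; ring.
    + intros i j hi hj.
      pose proof (RI01_add _ _ _ _ (RI01_mul_l (RtoC w) _ _ (hK2 t G i j ht hG1 hi hj)) (H2 i j hi hj)) as h.
      eapply RI01_eq; [|eapply RI01_ext; [|exact h]].
      * unfold madd, mscale, msub, m; rewrite RtoC_mul; ring.
      * intros s; cbv beta; simpl; ring.
    + rewrite (quad_ext r _ _ u (Phi_add n r Phi hPhi _ _)), quad_add.
      rewrite (quad_ext r _ _ u (Phi_scale n r Phi hPhi _ _)), quad_scale.
      rewrite (quad_add r (mscale (RtoC m) (msub mid (mscale (RtoC t) G))) Y2 u), quad_scale.
      rewrite !re_add, !re_RtoC_mul.
      assert (mn : 0 <= m) by (unfold m; apply Rmult_le_pos; lra).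
      fold k in HK; apply Rmult_le_compat_l with (r := m) in HK; [|assumption]; lra. }
destruct (linear_functional_bound (fun M => quad r (Phi M) u) n) as [K1 [K1p HK1]].
{ intros M N h; apply quad_ext, (Phi_ext n r Phi hPhi), h. }
{ intros a M N; rewrite (quad_ext r _ _ u (Phi_add n r Phi hPhi _ _)), quad_add.
  rewrite (quad_ext r _ _ u (Phi_scale n r Phi hPhi _ _)), quad_scale; reflexivity. }
destruct (linear_functional_bound (fun M => quad r M u) r) as [K2 [K2p HK2]].
{ intros M N h; apply quad_ext, h. }
{ intros a M N; rewrite quad_add, quad_scale; reflexivity. }
apply Rnot_lt_le; intros hneg.
set (gap := k * re (quad r (Phi fA) u) - re (quad r fPhiA u)) in *.
assert (gp : 0 < gap) by (unfold gap; lra).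
set (T := K1 * C1' + K2 * C2' + 1).
assert (Tp : 0 < T).
{ unfold T; assert (0 <= K1 * C1') by (apply Rmult_le_pos; lra); assert (0 <= K2 * C2') by (apply Rmult_le_pos; lra); lra. }
set (eps := gap / (2 * T)).
assert (ep : 0 < eps) by (apply Rdiv_lt_0_compat; lra).
destruct (happ eps hc ep) as (l & hw & _ & Hl).
destruct (comb l hw) as (Y1 & Y2 & H1 & H2 & H3).
assert (cmp : forall g g' Rm m Sm cm C Y Z, Sm <= S -> cm <= c ->
   (forall t, 0 <= t <= 1 -> exists w, g t = cexp w /\ Rabs (re w) <= Sm /\ Rabs (im w) <= cm) ->
   (forall i j t, (i < m)%nat -> (j < m)%nat -> 0 <= t <= 1 -> Cmod (Cmul (Rm t i j) (g' t)) <= C) ->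
   (forall i j, (i < m)%nat -> (j < m)%nat ->
     RI01 (fun t => Cmul (Cmul (F (g t)) (Rm t i j)) (g' t)) (Cmul two_pi_i (Y i j))) ->
   (forall i j, (i < m)%nat -> (j < m)%nat ->
     RI01 (fun t => Cmul (Cmul (combC l (g t)) (Rm t i j)) (g' t)) (Cmul two_pi_i (Z i j))) ->
   forall i j, (i < m)%nat -> (j < m)%nat -> Cmod (msub Y Z i j) <= eps * C).
{ intros g g' Rm m Sm cm C Y Z hS hcm hg hb hY hZ i j hi hj.
  pose proof (RI01_le _ _ _ _ (eps * C) (hY i j hi hj) (hZ i j hi hj)) as h.
  assert (h' : Cmod (Csub (Cmul two_pi_i (Y i j)) (Cmul two_pi_i (Z i j))) <= eps * C).
  { apply h; intros t ht.
    replace (Csub _ _) with (Cmul (Csub (F (g t)) (combC l (g t))) (Cmul (Rm t i j) (g' t))) by ring.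
    rewrite Cmod_mul; destruct (hg t ht) as (w & -> & h1 & h2).
    apply Rmult_le_compat; try apply Cmod_nonneg; [apply Hl; lra|apply hb; assumption]. }
  replace (Csub _ _) with (Cmul two_pi_i (msub Y Z i j)) in h' by (unfold msub; ring).
  rewrite Cmod_mul in h'.
  assert (p1 : 1 <= Cmod two_pi_i).
  { eapply Rle_trans; [|apply Rabs_im_le]; simpl; rewrite Rabs_right; pose proof PI2_1; lra. }
  pose proof (Cmod_nonneg (msub Y Z i j)); nra. }
assert (B1 := HK1 _ _ (cmp g1 g1' R1 n S1 c1 C1' fA Y1 (Rmax_l _ _) (Rmax_l _ _) hg1 hb1 hI1 H1)).
assert (B2 := HK2 _ _ (cmp g2 g2' R2 r S2 c2 C2' fPhiA Y2 (Rmax_r _ _) (Rmax_r _ _) hg2 hb2 hI2 H2)).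
cbv beta in B1, B2.
rewrite (quad_ext r _ _ u (Phi_sub n r Phi hPhi _ _)), quad_sub in B1; rewrite quad_sub in B2.
pose proof (Rle_trans _ _ _ (Rabs_re_le _) B1) as D1; pose proof (Rle_trans _ _ _ (Rabs_re_le _) B2) as D2.
rewrite re_sub in D1, D2.
apply Rle_trans with (1 := Rle_abs _) in D1.
rewrite Rabs_minus_sym in D2; apply Rle_trans with (1 := Rle_abs _) in D2.
assert (eT : eps * T = gap / 2) by (unfold eps; field; lra).
assert (d1 : k * (re (quad r (Phi fA) u) - re (quad r (Phi Y1) u)) <= K1 * (eps * C1')).
{ apply Rle_trans with (k * (K1 * (eps * C1'))); [apply Rmult_le_compat_l; lra|].
  rewrite <- (Rmult_1_l (K1 * (eps * C1'))) at 2; apply Rmult_le_compat_r; [|lra].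
  apply Rmult_le_pos; [assumption|apply Rmult_le_pos; lra]. }
assert (tot : K1 * (eps * C1') + K2 * (eps * C2') <= gap / 2).
{ rewrite <- eT; unfold T; lra. }
unfold gap in tot, gp; lra.
Qed.
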